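(* For each $q\in(0,1)$ let $w(\cdot;q)$ be a continual diagram whose subgraph $\{(s,v):|s|\le v<w(s;q)\}$ has area $1$. Let $w(s,t;q)=\sqrt t\,w(s/\sqrt t;q^{\sqrt t})$, $t>0$, be the corresponding $q$-auto-model. Suppose that for every $q\in(0,1)$ the charge $\sigma(s,t;q)=\frac12(w(s,t;q)-|s|)$ satisfies $$\int_{\mathbb{R}}(1-q^{x-s})^{-1}\frac{\partial\sigma(s,t;q)}{\partial t}ds=(1-q^x)^{-1}\exp\Big[-\ln q^{-1}\int_{\mathbb{R}}(1-q^{x-s})^{-1}\frac{\partial\sigma(s,t;q)}{\partial s}ds\Big]$$ for all $t>0$ and all real $x$ outside an interval containing the supports of $\partial_s\sigma(\cdot,t;q)$ and $\partial_t\sigma(\cdot,t;q)$. Then $w(\cdot;q)=\Omega(\cdot;q)$ for every $q\in(0,1)$.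
   Context: A continual diagram is a function $w:\mathbb{R}\to\mathbb{R}$ with $|w(s_1)-w(s_2)|\le|s_1-s_2|$ such that $w(s)=|s-s_0|$ for $|s|$ large, for some $s_0\in\mathbb{R}$. Its charge $\sigma=\frac12(w-|s|)$ is compactly supported. For $0<q<1$ and real $x$ to the right of the support of $\sigma'$, the $q$-deformed $R$-function of $w$ is $$R_w(x;q)=\frac{1-q}{1-q^x}\exp\Big[-\frac12\ln q^{-1}\int\frac{d(w(s)-|s|)}{1-q^{x-s}}\Big].$$ $\Omega(\cdot;q)$ denotes the continual diagram (the $q$-deformation of the limiting diagram) whose $q$-deformed $R$-function $R=R_{\Omega(\cdot;q)}(x;q)$ satisfies $$R\Big(1-q^{\,x-\frac{\ln q^{-1}}{1-q}R}\Big)=1-q .$$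
   Formalization: The area of the subgraph is taken as half its area in the (s,v) plane (Young-diagram units), so area 1 means ∫σ ds = 1; with plain (s,v) area 1 the growth equation has no solution, since x→∞ forces ∫∂σ/∂t ds = 1 while ∫σ(s,t) ds = t/2. *)

(* Defs.v *)
From HB Require Import structures.
From mathcomp Require Import all_boot all_order all_algebra.
From mathcomp Require Import all_classical all_reals all_analysis.

Set Implicit Arguments.
Unset Strict Implicit.
Unset Printing Implicit Defensive.

Import Order.TTheory GRing.Theory Num.Theory.
Import numFieldNormedType.Exports.
Local Open Scope classical_set_scope.
Local Open Scope ring_scope.

Section ContinualDiagrams.
Context {R : realType}.
Implicit Types (w : R -> R) (q x s t : R).

Definition continual_diagram w : Prop :=
  (forall s1 s2, `|w s1 - w s2| <= `|s1 - s2|) /\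
  exists s0, exists M, forall s, M <= `|s| -> w s = `|s - s0|.

Definition diagram_charge w s : R := (w s - `|s|) / 2.

Definition fsupp (f : R -> R) : set R := closure [set s | f s != 0].

Definition subgraph w : set (R * R) := [set p | `|p.1| <= p.2 < w p.1].

(* Area in the coordinates (x, y) of Young diagrams, where a box is a unit
   square. The graph of w lives in the rotated coordinates s = x - y,
   v = x + y, so that dx dy = ds dv / 2 and the area equals the integral of
   the charge. This unit is the one compatible with the growth equation of the
   auto-model: its limit as x goes to +oo says that the integral over s of the
   t-derivative of the charge is 1. *)
Definition diagram_area w : \bar R :=
  (2^-1%:E * (lebesgue_measure \x lebesgue_measure)%E (subgraph w))%E.

(* The Stieltjes differential d(w(s) - |s|) of a Lipschitz function is written
   as its almost everywhere defined derivative times ds; [derive1] is 0 at the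
   points where the derivative does not exist. *)
Definition qR_function w x q : R :=
  (1 - q) / (1 - q `^ x) *
  expR (- (2^-1 * ln q^-1 *
    \int[lebesgue_measure]_s
      (derive1 (fun u => w u - `|u|) s / (1 - q `^ (x - s))))).

(* Omega( . ; q) is the diagram determined by [Omega_spec q]; hence
   "w = Omega( . ; q)" is [unique (Omega_spec q) w]. *)
Definition Omega_spec q w : Prop :=
  continual_diagram w /\
  forall x, (forall s, fsupp (derive1 (diagram_charge w)) s -> s < x) ->
    qR_function w x q *
      (1 - q `^ (x - ln q^-1 / (1 - q) * qR_function w x q)) = 1 - q.

Definition auto_model (w : R -> R -> R) q t s : R :=
  Num.sqrt t * w (q `^ Num.sqrt t) (s / Num.sqrt t).

Definition auto_charge (w : R -> R -> R) q t s : R :=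
  diagram_charge (auto_model w q t) s.

Definition ds_charge (w : R -> R -> R) q t s : R :=
  derive1 (auto_charge w q t) s.

Definition dt_charge (w : R -> R -> R) q t s : R :=
  derive1 (fun u => auto_charge w q u s) t.

End ContinualDiagrams.

(* Main.v *)
Require Import Defs.
From HB Require Import structures.
From mathcomp Require Import all_boot all_order all_algebra.
From mathcomp Require Import all_classical all_reals all_analysis.
From mathcomp Require Import measurable_realfun ring lra.

Set Implicit Arguments.
Unset Strict Implicit.
Unset Printing Implicit Defensive.

Import Order.TTheory GRing.Theory Num.Theory.
Import numFieldNormedType.Exports.
Local Open Scope classical_set_scope.
Local Open Scope ring_scope.

(* Fix [q], put [L = ln (1/q)], [z = q^x], and let [S t] be the charge of the
   auto-model at time [t] and [D] its time derivative. The growth equation reads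
     [h(z, t) := \int D / (1 - z e^(Ls)) = (1 - z)^-1 exp (- L \int S' / (1 - z e^(Ls)))].
   Its right-hand side is, by zigzag approximation of the diagram, a limit of
   transforms of finite positive measures, so [D >= 0] and the charges increase
   in time. Hence their supports are uniformly bounded for small times, and the
   time derivative converges in L1, so that [h] solves a Burgers equation and is
   constant along the curves [z(t) = z exp (L^2 h (1 - t))]. At time 0 this gives
   [h (1 - z exp (L^2 h)) = 1] for small [z], the defining equation of Omega.
   Nonnegative power series carry the equation to all admissible [x], and the
   transform near [z = 0] determines the diagram through the moments of its
   charge. *)

(** Put [u = e^(Ls)] and let [P] be the integral of [S / (1 - z u)]. Integration by parts turns the
    right-hand side into [(1 - z)^-1 exp (L^2 z P_z)]. As the time derivative of [P] is [h],
    differentiating in time gives [h_t = L^2 z h h_z], the Burgers equation. The obstacle is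
    regularity in time. The auto-model runs through diagrams of different parameters; only
    derivability of the charge in [t] at each [s] is given, with no bound on [D], and the range of
    [x] varies with [t]. Positivity makes up for this: monotone charges share a support, nonnegative
    moments extend the equation to a [z]-interval independent of [t], and equal masses upgrade
    pointwise convergence to L1. At fixed [t] the sign of [D] is first known only for almost every
    [s]. Tonelli exchanges the two variables, and since the derivative in time is not known to be
    integrable, monotonicity then rests on the Goldowsky-Tonelli theorem. The curves start at time 1
    because time 0 lies outside the hypotheses and is reached only as a limit. Uniqueness compares
    with diagrams of arbitrary centre and area, whose charges need not vanish at infinity. *)

Section lipschitz_ftc.
Context {R : realType}.
Notation mu := (@lebesgue_measure R).

(** * Lipschitz functions: densities, almost everywhere derivatives, fundamental theorem of
    calculus *)

Lemma lebesgue_stieltjes_measure_oc (F : cumulative R R) (a b : R) : a <= b ->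
  lebesgue_stieltjes_measure F `]a, b]%classic = (F b - F a)%:E.
Proof.
move=> ab; rewrite /lebesgue_stieltjes_measure /measure_extension.
rewrite measurable_mu_extE/=; last exact: is_ocitv.
by rewrite wlength_itv_bnd.
Qed.

(** [C * x] splits into [F] and the nondecreasing remainder [C * x - F x]. Stieltjes measures add
    over this splitting, so that of [F] is at most [C] times Lebesgue measure. *)
Lemma stieltjes_le_lebesgue (F : cumulative R R) (C : R) (A : set R) :
  {homo (fun x => C * x - F x) : x y / x <= y} -> 0 <= C -> measurable A ->
  (lebesgue_stieltjes_measure F A <= C%:E * mu A)%E.
Proof.
move=> ndG C0 mA.
have ndF := cumulative_is_nondecreasing F.
have rcG : right_continuous (fun x => C * x - F x).
  move=> x; apply: cvgB; last exact: (cumulative_is_right_continuous F).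
  by apply: cvgM; [exact: cvg_cst|apply: cvg_within_filter; exact: cvg_id].
pose G : cumulative R R := HB.pack (fun x => C * x - F x)
  (isCumulative.Build R _ R (fun x => C * x - F x) ndG rcG).
pose CN : {nonneg R} := NngNum C0.
have ndC : {homo (fun x : R => C * x) : x y / x <= y}.
  by move=> x y xy; rewrite ler_wpM2l.
have rcC : right_continuous (fun x : R => C * x).
  by move=> x; apply: cvgM; [exact: cvg_cst|apply: cvg_within_filter; exact: cvg_id].
pose CC : cumulative R R := HB.pack (fun x : R => C * x)
  (isCumulative.Build R _ R (fun x => C * x) ndC rcC).
have E1 : lebesgue_stieltjes_measure CC A = mscale CN mu A.
  apply: lebesgue_stieltjes_measure_unique => // X /ocitvP[->|[[a b] /= ab ->]].
    by rewrite !measure0.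
  rewrite lebesgue_stieltjes_measure_oc ?ltW//= /mscale/= lebesgue_measure_itv/=.
  by rewrite lte_fin ab -EFinB -EFinM mulrBr.
have E2 : lebesgue_stieltjes_measure CC A =
    measure_add (lebesgue_stieltjes_measure F) (lebesgue_stieltjes_measure G) A.
  apply: lebesgue_stieltjes_measure_unique => // X /ocitvP[->|[[a b] /= ab ->]].
    by rewrite !measure0.
  rewrite -[RHS]/(measure_add _ _ _) measure_addE.
  transitivity ((F b - F a)%:E + (G b - G a)%:E)%E; last first.
    by congr (_ + _)%E; apply/esym; apply: lebesgue_stieltjes_measure_oc; exact: ltW.
  rewrite lebesgue_stieltjes_measure_oc ?ltW//= -EFinD.
  by congr EFin; ring.
have -> : (C%:E * mu A)%E = mscale CN mu A by [].
rewrite -E1 E2 measure_addE leeDl//.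
Qed.

(** Adding [k * x] makes [f] nondecreasing. Its Stieltjes measure, restricted to []a, b]] to be
    finite, is dominated by [2 * k] times Lebesgue measure, and [g] is the Radon-Nikodym density. *)
Lemma lipschitz_density (f : R -> R) (k a b : R) : a < b -> 0 <= k ->
  (forall x y, `|f x - f y| <= k * `|x - y|) ->
  exists g : R -> R, mu.-integrable setT (EFin \o g) /\
    forall y, a <= y <= b -> f y - f a + k * (y - a) = \int[mu]_(t in `]a, y]) g t.
Proof.
move=> ab k0 fl.
have fl' x y : x <= y -> `|f x - f y| <= k * (y - x).
  by move=> xy; rewrite (le_trans (fl _ _))// ler_wpM2l// distrC ger0_norm// subr_ge0.
have ndF : {homo (fun x => f x + k * x) : x y / x <= y}.
  move=> x y xy; have := fl' _ _ xy; rewrite ler_norml => /andP[_].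
  lra.
have ndG : {homo (fun x => 2 * k * x - (f x + k * x)) : x y / x <= y}.
  move=> x y xy; have := fl' _ _ xy; rewrite ler_norml => /andP[+ _].
  lra.
have cf : continuous f.
  move=> x; apply/cvgrPdist_le => e e0.
  near=> y; apply: (le_trans (fl _ _)).
  have : `|x - y| <= e / (k + 1).
    near: y; apply: cvgr_dist_le; [exact: cvg_id|].
    by rewrite divr_gt0// ltr_wpDl.
  rewrite ler_pdivlMr; last by rewrite ltr_wpDl.
  by apply: le_trans; rewrite mulrC ler_wpM2l// lerDl.
have rcF : right_continuous (fun x => f x + k * x).
  move=> x; apply: cvg_within_filter; apply: cvgD; first exact: cf.
  by apply: cvgM; [exact: cvg_cst|exact: cvg_id].
pose F : cumulative R R := HB.pack (fun x => f x + k * x)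
  (isCumulative.Build R _ R (fun x => f x + k * x) ndF rcF).
have mD : measurable (`]a, b]%classic : set (measurableTypeR R)) by exact: measurable_itv.
have moo : (lebesgue_stieltjes_measure F `]a, b]%classic < +oo)%E.
  by rewrite lebesgue_stieltjes_measure_oc ?ltW// ltry.
pose nu : {finite_measure set _ -> \bar R} := mfrestr mD moo.
have numu : nu `<< mu.
  apply/null_content_dominatesP => A mA A0.
  rewrite /nu/= /mfrestr/= /mrestr/=; apply/eqP; rewrite eq_le measure_ge0 andbT.
  have := @stieltjes_le_lebesgue F (2 * k) A ndG (mulr_ge0 (ler0n _ _) k0) mA.
  rewrite A0 mule0; apply: le_trans; apply: le_measure => //; rewrite ?inE//.
    exact: measurableI.
have [g [g0 gfin ig nuE]] := radon_nikodym_sigma_finite numu.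
exists (fine \o g); split.
  apply: eq_integrable ig => //= x _; by rewrite /= fineK.
move=> y /andP[ay yb].
have := nuE `]a, y]%classic (measurable_itv _).
rewrite /nu/= /mfrestr/= /mrestr/= (_ : _ `&` _ = `]a, y]%classic); last first.
  apply/seteqP; split => x /=; first by case.
  by rewrite !in_itv/= => /andP[-> xy]; rewrite xy (le_trans xy).
rewrite lebesgue_stieltjes_measure_oc//= => E.
rewrite /Rintegral; under eq_integral do rewrite /= fineK//.
by rewrite -E/=; ring.
Unshelve. all: by end_near. Qed.

(** Lebesgue differentiation of the integral of [g]; the [- k] removes the drift [k * x] that made
    [f] monotone. *)
Lemma lipschitz_ae_derive (f : R -> R) (k a b : R) : a < b -> 0 <= k ->
  (forall x y, `|f x - f y| <= k * `|x - y|) ->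
  exists g : R -> R, [/\ mu.-integrable setT (EFin \o g),
    f b - f a + k * (b - a) = \int[mu]_(t in `]a, b]) g t &
    {ae mu, forall x, x \in `]a, b[ -> derivable f x 1 /\ derive1 f x = g x - k}].
Proof.
move=> ab k0 fl; have [g [ig gE]] := lipschitz_density ab k0 fl.
exists g; split => //; first by rewrite gE// ltW/=.
have ig' y : mu.-integrable [set` Interval (BRight a) (BRight y)] (EFin \o g).
  by apply: integrableS ig => //.
have := FTC1 ig' (open_integrable_locally openT ig).
apply: filterS; first exact: (ae_filter_ringOfSetsType mu).
move=> x; rewrite in_itv/= => H /andP[ax xb].
have [d1 d2] := H ax.
set G := (fun y => _) in d1 d2.
have nearf : \forall y \near x, f y = G y + (f a - k * (y - a)).
  have : x \in `]a, b[ by rewrite in_itv/= ax.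
  move=> /near_in_itvoo; apply: filterS => y; rewrite in_itv/= => /andP[ay yb].
  by rewrite /G -gE ?ltW//; ring.
have dG : is_derive x 1 (fun y => G y + (f a - k * (y - a))) (g x - k).
  have idG : is_derive x 1 G (g x).
    by split => //; rewrite -derive1E.
  have idl : is_derive x 1 (fun y => f a - k * (y - a)) (- k).
    apply: is_derive_eq; rewrite /= /GRing.scale/=.
    by rewrite add0r subr0 mulr1 mul1r.
  exact: is_deriveD.
have nearf' : \forall y \near x, (fun y => G y + (f a - k * (y - a))) y = f y.
  by apply: filterS nearf => y ->.
have idf : is_derive x 1 f (g x - k) by apply: near_eq_is_derive nearf' dG.
split; first exact: ex_derive.
by rewrite derive1E derive_val.
Qed.

Lemma lipschitz_continuous (f : R -> R) (k : R) : 0 <= k ->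
  (forall x y, `|f x - f y| <= k * `|x - y|) -> continuous f.
Proof.
move=> k0 fl x; apply/cvgrPdist_le => e e0.
near=> y; apply: (le_trans (fl _ _)).
have : `|x - y| <= e / (k + 1).
  near: y; apply: cvgr_dist_le; [exact: cvg_id|].
  by rewrite divr_gt0// ltr_wpDl.
rewrite ler_pdivlMr; last by rewrite ltr_wpDl.
by apply: le_trans; rewrite mulrC ler_wpM2l// lerDl.
Unshelve. all: by end_near. Qed.

Definition diff_quotient (f : R -> R) (h x : R) : R := h^-1 * (f (x + h) - f x).

Lemma derivable_cvgP (f : R -> R) (x : R) : derivable f x 1 <->
  cvg (diff_quotient f h x @[h --> 0^']).
Proof.
rewrite /derivable; suff -> : (fun h : R => h^-1 *: ((f \o shift x) (h *: 1) - f x)) =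
  (fun h => diff_quotient f h x) by [].
by apply/funext => h; rewrite /diff_quotient /= /GRing.scale/= mulr1 [h + x]addrC.
Qed.

Lemma derive1_cvg (f : R -> R) (x : R) : derivable f x 1 ->
  diff_quotient f h x @[h --> 0^'] --> derive1 f x.
Proof.
move=> df; rewrite derive1E; have := df; rewrite /derivable /derive.
suff -> : (fun h : R => h^-1 *: ((f \o shift x) (h *: 1) - f x)) =
  (fun h => diff_quotient f h x) by [].
by apply/funext => h; rewrite /diff_quotient /= /GRing.scale/= mulr1 [h + x]addrC.
Qed.

Lemma derive1_not_derivable (f : R -> R) (x : R) : ~ derivable f x 1 -> derive1 f x = 0.
Proof.
move=> ndf; rewrite derive1E /derive.
have : ~ cvg (h^-1 *: ((f \o shift x) (h *: 1) - f x) @[h --> 0^']) by [].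
exact: dvgP.
Qed.

Lemma diff_quotient_seq (f : R -> R) (x : R) : derivable f x 1 ->
  diff_quotient f n.+1%:R^-1 x @[n --> \oo] --> derive1 f x.
Proof.
move=> /derive1_cvg /cvgr_dnbhsP; apply; split => [n|].
  by rewrite invr_eq0 pnatr_eq0.
exact: cvg_harmonic.
Qed.

Lemma countable_bigcapT_measurable d (T : measurableType d) (I : countType)
    (F : I -> set T) : (forall i, measurable (F i)) -> measurable (\bigcap_i F i).
Proof.
move=> mF; rewrite -[X in measurable X]setCK setC_bigcap; apply: measurableC.
by apply: countable_bigcupT_measurable => // i; exact: measurableC.
Qed.

Lemma measurable_diff_quotient (f : R -> R) (h : R) : continuous f ->
  measurable_fun setT (diff_quotient f h).
Proof.
move=> cf; apply: measurable_funM => //; apply: measurable_funB.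
  apply: (@measurableT_comp _ _ _ _ _ _ f); first exact: continuous_measurable_fun.
  exact: measurable_funD.
exact: continuous_measurable_fun.
Qed.

(** The difference quotient is continuous in its increment away from 0, so a Cauchy condition over
    rational increments suffices. Derivability becomes a countable combination of measurable
    conditions. *)
Lemma derivable_cauchyP (f : R -> R) (x : R) : continuous f ->
  derivable f x 1 <-> forall k : nat, exists n : nat, forall p : rat * rat,
    0 < `|ratr p.1 : R| < n.+1%:R^-1 -> 0 < `|ratr p.2 : R| < n.+1%:R^-1 ->
    `|diff_quotient f (ratr p.1) x - diff_quotient f (ratr p.2) x| <= k.+1%:R^-1.
Proof.
move=> cf; split.
  move=> /derive1_cvg /cvgrPdist_le H k.
  have e0 : 0 < (k.+1%:R^-1 / 2 : R) by rewrite divr_gt0.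
  have [e /= e1 He] := H _ e0.
  have [n _ Hn] : \forall n \near \oo, (n.+1%:R^-1 : R) < e.
    by apply: cvgr_lt; first exact: cvg_harmonic.
  exists n => -[h h'] /= /andP[h0 hn] /andP[h'0 h'n].
  have := Hn n (leqnn n) => /= ne.
  have B (u : R) : 0 < `|u| < n.+1%:R^-1 -> `|derive1 f x - diff_quotient f u x| <= k.+1%:R^-1 / 2.
    move=> /andP[u0 un]; apply: He => /=; first by rewrite sub0r normrN (lt_trans un).
    by rewrite -normr_gt0.
  rewrite -(subrKA (derive1 f x)) (le_trans (ler_normD _ _))//.
  rewrite [leRHS]splitr lerD//; last by apply: B; rewrite h'0.
  by rewrite distrC; apply: B; rewrite h0.
move=> H; apply/derivable_cvgP.
have cq (h : R) : h != 0 -> {for h, continuous (fun h => diff_quotient f h x)}.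
  move=> h0; apply: cvgM; first by apply: cvgV => //; exact: cvg_id.
  apply: cvgB; last exact: cvg_cst.
  apply: (@cvg_comp _ _ _ (fun h => x + h) f); last exact: cf.
  by apply: cvgD; [exact: cvg_cst|exact: cvg_id].
apply: cauchy_cvg; apply: cauchy_exP => e e0.
have [k _ Hk] : \forall n \near \oo, (n.+1%:R^-1 : R) < e.
  by apply: cvgr_lt; first exact: cvg_harmonic.
have {Hk}ke := Hk k (leqnn k); have [n Hn] := H k.
have n0 : (0 : R) < n.+1%:R^-1 by [].
pose r0 : rat := n.+2%:R^-1.
have r0E : ratr r0 = n.+2%:R^-1 :> R by rewrite fmorphV/= ratr_nat.
have r0P : 0 < `|ratr r0 : R| < n.+1%:R^-1.
  rewrite r0E ger0_norm// invr_gt0 ltr0n/=.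
  by rewrite ltf_pV2 ?posrE ?ltr0n// ltr_nat.
exists (diff_quotient f (ratr r0) x).
exists n.+1%:R^-1 => // h hn h0.
have {}hn : `|h| < n.+1%:R^-1 by have := hn; rewrite /= sub0r normrN.
rewrite /ball/=; apply: le_lt_trans ke.
rewrite leNgt; apply/negP => lt1.
have cd : {for h, continuous (fun h => `|diff_quotient f (ratr r0) x - diff_quotient f h x|)}.
  apply: cvg_norm; apply: cvgB; first exact: cvg_cst.
  exact: cq.
have : \forall u \near h, k.+1%:R^-1 < `|diff_quotient f (ratr r0) x - diff_quotient f u x|.
  exact: (cvgr_gt _ cd).
have nh : \forall u \near h, 0 < `|u| < n.+1%:R^-1.
  near=> u; apply/andP; split; near: u.
    by apply: (cvgr_gt `|h|); [apply: cvg_norm; exact: cvg_id|rewrite normr_gt0].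
  by apply: (cvgr_lt `|h|) => //; apply: cvg_norm; exact: cvg_id.
move=> /filterI/(_ nh); rewrite nbhsE/= => -[U [oU Uh] HU].
have [v [Ur [r _ rE]]] := dense_rat (ex_intro _ h Uh : U !=set0) oU.
have [/= lt2 rP] := HU _ Ur.
have := Hn (r0, r) r0P; rewrite /= rE => /(_ rP).
by rewrite leNgt lt2.
Unshelve. all: by end_near. Qed.

Lemma measurable_derivable (f : R -> R) : continuous f ->
  measurable [set x | derivable f x 1].
Proof.
move=> cf.
rewrite (_ : [set _ | _] = \bigcap_k \bigcup_n \bigcap_(p : rat * rat)
  [set x | 0 < `|ratr p.1 : R| < n.+1%:R^-1 -> 0 < `|ratr p.2 : R| < n.+1%:R^-1 ->
    `|diff_quotient f (ratr p.1) x - diff_quotient f (ratr p.2) x| <= k.+1%:R^-1]); last first.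
  apply/seteqP; split => x /=.
    move=> /(derivable_cauchyP _ cf) H k _; have [n Hn] := H k.
    by exists n => // p _; exact: Hn.
  move=> H; apply/(derivable_cauchyP _ cf) => k; have [n _ Hn] := H k I.
  by exists n => p; exact: Hn.
apply: bigcapT_measurable => k; apply: bigcupT_measurable => n.
apply: countable_bigcapT_measurable => -[h h'] /=.
have [c1|c1] := boolP (0 < `|ratr h : R| < n.+1%:R^-1); last first.
  rewrite (_ : [set _ | _] = setT)//.
  by apply/seteqP; split => // x _ /= a1; rewrite a1 in c1.
have [c2|c2] := boolP (0 < `|ratr h' : R| < n.+1%:R^-1); last first.
  rewrite (_ : [set _ | _] = setT)//.
  by apply/seteqP; split => // x _ /= _ a1; rewrite a1 in c2.
rewrite (_ : [set _ | _] = [set x | `|diff_quotient f (ratr h) x - diff_quotient f (ratr h') x| <= k.+1%:R^-1]); last first.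
  by apply/seteqP; split => x /=; [apply|].
rewrite -[X in measurable X]setTI; apply: measurable_fun_le => //.
apply: measurableT_comp => //; apply: measurable_funB; exact: measurable_diff_quotient.
Qed.

(** Off the set [E] of derivability [derive1] has its default value 0, so difference quotients cut
    off by the indicator of [E] converge to it everywhere. *)
Lemma measurable_derive1 (f : R -> R) : continuous f -> measurable_fun setT (derive1 f).
Proof.
move=> cf; pose E := [set x | derivable f x 1].
have mE : measurable E by exact: measurable_derivable.
apply: (@measurable_fun_cvg _ _ _ _ (fun n x => \1_E x * diff_quotient f n.+1%:R^-1 x)).
  by move=> n; apply: measurable_funM; [exact: measurable_indic|exact: measurable_diff_quotient].
move=> x _; have [Ex|nEx] := pselect (E x).
  rewrite indicE mem_set//; under eq_fun do rewrite mul1r.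
  exact: diff_quotient_seq.
rewrite indicE memNset//; under eq_fun do rewrite mul0r.
rewrite derive1_not_derivable//; exact: cvg_cst.
Qed.

Lemma derive1_lipschitz_le (f : R -> R) (k x : R) : 0 <= k ->
  (forall x y, `|f x - f y| <= k * `|x - y|) -> `|derive1 f x| <= k.
Proof.
move=> k0 fl; have [df|ndf] := pselect (derivable f x 1); last first.
  by rewrite derive1_not_derivable// normr0.
have := diff_quotient_seq df => /cvg_norm H.
rewrite -(cvg_lim _ H)//; apply: limr_le; first exact: cvgP H.
near=> n => /=.
rewrite /diff_quotient normrM ger0_norm// ler_pdivrMl//.
by rewrite (le_trans (fl _ _))// addrAC subrr add0r ger0_norm// mulrC.
Unshelve. all: by end_near. Qed.

Lemma bounded_integrable_itv (f : R -> R) (k a b : R) : measurable_fun setT f ->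
  (forall x, `|f x| <= k) -> mu.-integrable `[a, b] (EFin \o f).
Proof.
move=> mf fk; apply: measurable_bounded_integrable => //.
- by rewrite /= lebesgue_measure_itv/=; case: ifP => _; rewrite -?EFinB ltry.
- exact: measurable_funTS.
- by exists k; split => [|M kM x _]; [exact: num_real|rewrite /= (le_trans (fk x))// ltW].
Qed.

(** The points where [derive1] takes its default value form a null set in []a, b[]. This is what
    allows [derive1] times [ds] to stand for the Stieltjes differential. *)
Lemma lipschitz_FTC (f : R -> R) (k a b : R) : a <= b -> 0 <= k ->
  (forall x y, `|f x - f y| <= k * `|x - y|) ->
  \int[mu]_(x in `[a, b]) derive1 f x = f b - f a.
Proof.
rewrite le_eqVlt => /predU1P[<- _ _|ab k0 fl].
  by rewrite set_itv1 Rintegral_set1 subrr.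
have [g [ig gE gae]] := lipschitz_ae_derive ab k0 fl.
have cf := lipschitz_continuous k0 fl.
have mf := measurable_derive1 cf.
have igab : mu.-integrable `]a, b[ (EFin \o g) by apply: integrableS ig.
have ik : mu.-integrable `]a, b[ (EFin \o cst k).
  have : mu.-integrable `[a, b] (EFin \o cst k).
    apply: continuous_compact_integrable; first exact: segment_compact.
    exact: cst_continuous.
  by apply: integrableS => //; exact: subset_itv_oo_cc.
have if' : mu.-integrable `[a, b] (EFin \o derive1 f).
  apply: (bounded_integrable_itv _ _ mf) => x; exact: (derive1_lipschitz_le _ k0 fl).
rewrite -Rintegral_itv_obnd_cbnd; last by apply: integrableS if' => //; exact: subset_itv_oc_cc.
rewrite -Rintegral_itv_bndo_bndc; last by apply: integrableS if' => //; exact: subset_itv_oo_cc.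
have -> : \int[mu]_(x in `]a, b[) derive1 f x = \int[mu]_(x in `]a, b[) (g x - k).
  rewrite /Rintegral; congr fine; apply: ae_eq_integral => //.
  - apply/measurable_EFinP; exact: measurable_funTS.
  - apply/measurable_EFinP; apply: measurable_funB => //.
    by have /integrableP[/measurable_EFinP] := igab.
  - apply: filterS gae; first exact: (ae_filter_ringOfSetsType mu).
    by move=> x /= H xab; rewrite (H xab).2.
rewrite RintegralB// Rintegral_cst//= lebesgue_measure_itv/= lte_fin ab/=.
rewrite Rintegral_itv_bndo_bndc; last exact: integrableS ig.
by rewrite -gE; ring.
Qed.
Lemma near_cst_derive1 (f : R -> R) (s c : R) : (\forall t \near s, f t = c) -> derive1 f s = 0.
Proof.
move=> nr; have d0 : is_derive s 1 (cst c : R -> R) 0 by exact: is_derive_cst.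
have nr' : \forall t \near s, cst c t = f t by apply: filterS nr => t ->.
by have d1 := near_eq_is_derive nr' d0; rewrite derive1E derive_val.
Qed.

End lipschitz_ftc.

(** * Monotonicity from a derivative that is nonnegative almost everywhere (Goldowsky-Tonelli) *)

Section goldowsky.
Context {R : realType}.
Notation mu := (@lebesgue_measure R).

Lemma null_sum_cover (A : set R) (e : R) : 0 < e -> mu A = 0 -> measurable A ->
  exists U : nat -> set R, [/\ forall n, open (U n), forall n, A `<=` U n &
    (\sum_(0 <= n <oo) mu (U n) <= e%:E)%E].
Proof.
move=> e0 A0 mA.
have H n : exists U : set R, [/\ open U, A `<=` U & (mu U <= (e / (2 ^ n.+1)%:R)%:E)%E].
  have [||U [oU AU UA]] := @lebesgue_regularity_outer R A (e / (2 ^ n.+1)%:R) mA.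
  - exact: (eq_ind_r (fun x => (x < +oo)%E) (ltry 0) A0).
  - by rewrite divr_gt0// ltr0n expn_gt0.
  exists U; split => //.
  have mU : measurable U by exact: open_measurable.
  rewrite (_ : U = (U `\` A) `|` A); last by rewrite setUC setDUK.
  rewrite (le_trans (measureU2 _ _ _))//; first exact: measurableD.
  by rewrite [X in (_ + X)%E]A0 adde0 ltW.
have [U HU] := choice H.
exists U; split => [n|n|]; [by have [] := HU n|by have [] := HU n|].
apply: le_trans (_ : (\sum_(0 <= n <oo) (0 + (e / (2 ^ n.+1)%:R)%:E) <= _)%E).
  by apply: lee_nneseries => // n _; rewrite add0e; have [] := HU n.
apply: le_trans (epsilon_trick xpredT (fun=> lexx 0%E) (ltW e0)) _.
by rewrite eseries0// add0e.
Qed.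

(** No integrability of the derivative is assumed. A small slope [eta] and an increasing function
    [h] of total growth at most [e / 2] are added so that the sum never drops immediately to the
    right of a point; a supremum argument then compares the endpoints. *)
Lemma derivable_ae_ge0_nondecreasing (f : R -> R) :
  (forall t, derivable f t 1) -> {ae mu, forall t, 0 <= derive1 f t} ->
  {homo f : t1 t2 / t1 <= t2}.
Proof.
move=> df [A [mA A0 HA]] t1 t2 t12.
apply/ler_addgt0Pr => e e0.
(* Over [[t1, t2]] this slope adds at most [e / 2]; the [+ 1] keeps the quotient meaningful when
   [t1 = t2]. *)
pose eta := e / 2 / (t2 - t1 + 1).
have M0 : 0 < t2 - t1 + 1 by rewrite ltr_wpDl// subr_ge0.
have eta0 : 0 < eta by rewrite !divr_gt0.
have e20 : 0 < e / 2 by rewrite divr_gt0.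
have [U [oU AU Ue]] := null_sum_cover e20 A0 mA.
(* [H] has infinite slope at the points of the null set [A], which offsets the
   possibly negative derivative of [f] there. *)
pose H t := (\sum_(0 <= n <oo) mu (U n `&` `[t1, t]))%E.
have mU n : measurable (U n) by exact: open_measurable.
have mUI n (i : interval R) : measurable (U n `&` [set` i]) by apply: measurableI.
have He t : (H t <= (e / 2)%:E)%E.
  apply: le_trans Ue; apply: lee_nneseries => // n _.
  by apply: le_measure; [rewrite inE; exact: mUI|rewrite inE; exact: mU|exact: subIsetl].
have H0 t : (0 <= H t)%E by exact: nneseries_ge0.
have Hfin t : H t \is a fin_num.
  by rewrite ge0_fin_numE// (le_lt_trans (He t))// ltry.
pose h t := fine (H t).
have HE s t : t1 <= s -> s <= t ->
    H t = (H s + \sum_(0 <= n <oo) mu (U n `&` `]s, t]))%E.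
  move=> ts st; rewrite -nneseriesD//; apply: eq_eseriesr => n _.
  rewrite -measureU//; last first.
    rewrite -subset0 => x /= [[_]]; rewrite !in_itv/= => /andP[_ xs] [_ /andP[sx _]].
    by rewrite ltNge xs in sx.
  exact: mUI.
  exact: mUI.
  rewrite -setIUr; congr (mu (_ `&` _)).
  apply/seteqP; split => x /=; rewrite !in_itv/=.
    move=> /andP[tx xt]; have [xs|sx] := leP x s; [left|right].
      by rewrite tx.
    by [].
  move=> [/andP[-> xs]|/andP[sx ->]]; first by rewrite (le_trans xs).
  by rewrite (le_trans ts (ltW sx)).
have hmono s t : t1 <= s -> s <= t -> h s <= h t.
  move=> ts st; rewrite /h fine_le// (HE _ _ ts st) leeDl//.
  exact: nneseries_ge0.
(* For [t'] close to [t] the first [K] open sets all contain [[t, t']], and each contributes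
   [t' - t] to the growth of [h]. *)
have hK (K : nat) t : A t -> t1 <= t -> \forall t' \near t^'+, h t + K%:R * (t' - t) <= h t'.
  move=> At tt.
  have UK : \forall t' \near t^'+, forall n, (n < K)%N -> `[t, t'] `<=` U n.
    elim: K => [|K IH]; first by near=> t'.
    have [d /= d0 dU] : nbhs t (U K) by apply: open_nbhs_nbhs; split => //; exact: AU.
    near=> t'; move=> n; rewrite ltnS leq_eqVlt => /predU1P[->|nK]; last first.
      by move: n nK; near: t'.
    move=> x /=; rewrite in_itv/= => /andP[tx xt']; apply: dU => /=.
    rewrite ltr_distlC; apply/andP; split.
      by rewrite ltrBlDr (le_lt_trans tx)// ltrDl.
    rewrite (le_lt_trans xt')//; near: t'; apply: nbhs_right_lt.
    by rewrite ltrDl.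
  near=> t'.
  have tt' : t < t' by near: t'; exact: nbhs_right_gt.
  have HU : forall n, (n < K)%N -> `[t, t'] `<=` U n by near: t'.
  rewrite -lee_fin EFinD /h !fineK// (HE _ _ tt (ltW tt')) leeD2l//.
  apply: le_trans (nneseries_lim_ge K _); last by [].
  rewrite big_mkord (eq_bigr (fun=> (t' - t)%:E)); last first.
    move=> n _; rewrite (_ : _ `&` _ = `]t, t']%classic); last first.
      apply/seteqP; split => x /=; first by case.
      by move=> xt; split => //; apply: (HU n (ltn_ord n)); exact: subset_itv_oc_cc xt.
    by rewrite lebesgue_measure_itv/= lte_fin tt' -EFinB.
  by rewrite sumEFin sumr_const card_ord mulr_natl.
pose g t := f t + eta * (t - t1) + h t.
have gright t : t1 <= t -> \forall t' \near t^'+, g t <= g t'.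
  move=> tt.
  have dq (c : R) : 0 < c -> \forall t' \near t^'+, f t + (derive1 f t - c) * (t' - t) <= f t'.
    move=> c0; have /cvgrPdist_lt /(_ _ c0)[d /= d0 Hd] := derive1_cvg (df t).
    near=> t'.
    have tt' : t < t' by near: t'; exact: nbhs_right_gt.
    have := Hd (t' - t); rewrite /= sub0r normrN gtr0_norm ?subr_gt0//.
    have -> : t' - t < d.
      by rewrite ltrBlDl; near: t'; apply: nbhs_right_lt; rewrite ltrDl.
    rewrite subr_eq0 gt_eqF// => /(_ isT isT).
    rewrite /diff_quotient [t + _]addrC subrK ltr_norml => /andP[_].
    rewrite ltrBlDl -ltrBlDr => /ltW; rewrite ler_pdivlMl ?subr_gt0//.
    by rewrite mulrC; lra.
  have [At|nAt] := pselect (A t).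
    (* [K] is at least [1 - derive1 f t]: the growth of [h] outweighs a drop of [f], whose slope
       just after [t] is at least [derive1 f t - 1]. *)
    pose K := (Num.bound `|derive1 f t|).+1.
    have KP : - derive1 f t + 1 <= K%:R.
      rewrite /K -natr1 lerD2r ltW// (le_lt_trans _ (archi_boundP (normr_ge0 (derive1 f t))))//.
      by rewrite -normrN ler_norm.
    near=> t'.
    have tt' : t < t' by near: t'; exact: nbhs_right_gt.
    have h1 : h t + K%:R * (t' - t) <= h t' by near: t'; exact: hK.
    have h2 : f t + (derive1 f t - 1) * (t' - t) <= f t' by near: t'; exact: dq.
    have h3 : (- derive1 f t + 1) * (t' - t) <= K%:R * (t' - t).
      by rewrite ler_wpM2r// subr_ge0 ltW.
    have h4 : 0 <= eta * (t' - t) by rewrite mulr_ge0 ?(ltW eta0)// subr_ge0 ltW.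
    by rewrite /g; lra.
  have ft : 0 <= derive1 f t.
    by apply: contrapT => H1; apply: nAt; exact: HA.
  near=> t'.
  have tt' : t < t' by near: t'; exact: nbhs_right_gt.
  have h1 : h t <= h t' by apply: hmono => //; exact: ltW.
  have h2 : f t + (derive1 f t - eta) * (t' - t) <= f t' by near: t'; exact: dq.
  have h3 : 0 <= derive1 f t * (t' - t) by rewrite mulr_ge0// subr_ge0 ltW.
  by rewrite /g; lra.
pose S := [set t | t1 <= t <= t2 /\ forall t', t1 <= t' <= t -> g t1 <= g t'].
have S1 : S t1.
  by split; [rewrite lexx|move=> t' /andP[h1 h2]; rewrite (@le_anti _ _ t' t1) ?h1 ?h2].
have hsS : has_sup S by split; [exists t1|exists t2 => t [/andP[]]].
pose tau := sup S.
have t1tau : t1 <= tau by apply: ub_le_sup => //; case: hsS.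
have taut2 : tau <= t2 by apply: ge_sup; [exists t1|move=> t [/andP[]]].
have gl t' : t1 <= t' -> t' < tau -> g t1 <= g t'.
  move=> h1 h2; have tt : 0 < tau - t' by rewrite subr_gt0.
  have [s [_ Ss]] := sup_adherent tt hsS.
  rewrite -/tau opprB addrC subrK => ts.
  by apply: Ss; rewrite h1 ltW.
have gtau : g t1 <= g tau.
  rewrite leNgt; apply/negP => gt.
  have t1t : t1 < tau.
    by rewrite lt_neqAle t1tau andbT; apply/negP => /eqP E; rewrite -E ltxx in gt.
  (* Continuity of [h] is avoided by freezing it at [h tau]: [phi] is continuous at [tau] and lies
     above [g] on its left, so [g tau < g t1] would spread to points left of [tau]. *)
  pose phi t := f t + eta * (t - t1) + h tau.
  have cphi : {for tau, continuous phi}.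
    apply: cvgD; last exact: cvg_cst.
    apply: cvgD; first exact/differentiable_continuous/derivable1_diffP/df.
    apply: cvgM; first exact: cvg_cst.
    by apply: cvgB; [exact: cvg_id|exact: cvg_cst].
  have np : \forall t \near tau, phi t < g t1 by exact: (cvgr_lt _ cphi).
  have nl : \forall t \near tau^'-, [/\ phi t < g t1, t < tau & t1 < t].
    near=> t; split; near: t.
    - by rewrite /at_left near_withinE; apply: filterS np => ? ? _.
    - exact: nbhs_left_lt.
    - exact: nbhs_left_gt.
  have [t [p1 p2 p3]] := @filter_ex _ (tau^'-) _ _ nl.
  have := gl t (ltW p3) p2; rewrite leNgt => /negP; apply.
  apply: le_lt_trans p1; rewrite /g /phi lerD2l; apply: hmono; exact: ltW.
have Stau : S tau.
  split; first by rewrite t1tau.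
  move=> t' /andP[h1]; rewrite le_eqVlt => /predU1P[->//|h2]; exact: gl.
have tauE : tau = t2.
  apply/eqP; rewrite eq_le taut2 leNgt; apply/negP => lt2.
  have [d /= d0 Hd] := gright _ t1tau.
  pose t' := Num.min t2 (tau + d / 2).
  have tt' : tau < t' by rewrite lt_min lt2 ltrDl divr_gt0.
  suff : S t' by move=> /(ub_le_sup (proj2 hsS)); rewrite leNgt tt'.
  split; first by rewrite (le_trans t1tau (ltW tt')) ge_min lexx.
  move=> r /andP[r1 r2]; have [rt|tr] := leP r tau; first by apply: Stau.2; rewrite r1.
  apply: (le_trans gtau); apply: Hd => //=.
  rewrite distrC gtr0_norm ?subr_gt0// ltrBlDl (le_lt_trans r2)//.
  rewrite gt_min; apply/orP; right; rewrite ltrD2l ltr_pdivrMr// ltr_pMr// ltr1n//.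
rewrite -tauE.
have hl : h tau <= e / 2 by rewrite -lee_fin fineK.
have hl0 : 0 <= h t1 by rewrite fine_ge0.
have etal : eta * (tau - t1) <= e / 2.
  rewrite /eta mulrAC ler_pdivrMr// ler_wpM2l ?(ltW e20)// tauE lerDl//.
by move: gtau; rewrite /g subrr mulr0 addr0; lra.
Unshelve. all: by end_near. Qed.
End goldowsky.

(** * Coefficients recovered from values at small arguments *)

Section coefficients.
Context {R : realType}.

Lemma cvgr_sum (I : Type) (r : seq I) (f : nat -> I -> R) (a : I -> R) :
  (forall i, f n i @[n --> \oo] --> a i) ->
  \sum_(i <- r) f n i @[n --> \oo] --> \sum_(i <- r) a i.
Proof.
move=> fa; elim: r => [|i r IH].
  by rewrite big_nil; under eq_fun do rewrite big_nil; exact: cvg_cst.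
by rewrite big_cons; under eq_fun do rewrite big_cons; exact: cvgD.
Qed.

(** Strong induction on [k]. After division by [z ^+ k] the lower terms vanish in the limit and the
    remainder is of order [z] uniformly in [n], so one fixed small [z] isolates [d n k] up to
    [e / 2]. *)
Lemma coef_cvg0 (d : nat -> nat -> R) (D : nat -> R -> R) (C B zs : R) :
  0 < zs -> 0 <= C -> 0 <= B ->
  (forall n k z, 0 < z < zs ->
    `|D n z - \sum_(j < k.+1) d n j * z ^+ j| <= C * (B * z) ^+ k.+1) ->
  (forall z, 0 < z < zs -> D n z @[n --> \oo] --> 0) ->
  forall k, d n k @[n --> \oo] --> 0.
Proof.
move=> zs0 C0 B0 DE D0; elim/ltn_ind => k IH.
apply/cvgr0Pnorm_le => e e0.
pose z := Num.min (zs / 2) (e / 2 / (C * B ^+ k.+1 + 1)).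
have M0 : 0 < C * B ^+ k.+1 + 1 by rewrite ltr_wpDl// mulr_ge0// exprn_ge0.
have z0 : 0 < z by rewrite lt_min !divr_gt0.
have zzs : 0 < z < zs.
  rewrite z0/= gt_min; apply/orP; left; rewrite ltr_pdivrMr//.
  by rewrite ltr_pMr// ltr1n.
have zM : C * B ^+ k.+1 * z <= e / 2.
  apply: (@le_trans _ _ ((C * B ^+ k.+1 + 1) * z)).
    by rewrite ler_wpM2r ?(ltW z0)// lerDl.
  by rewrite mulrC -ler_pdivlMr// ge_min lexx orbT.
pose T n := (`|D n z| + \sum_(j < k) `|d n j| * z ^+ j) / z ^+ k.
have T0 : T n @[n --> \oo] --> 0.
  rewrite -[X in _ --> X](mul0r (z ^+ k)^-1); apply: cvgM; last exact: cvg_cst.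
  rewrite -[X in _ --> X](addr0 0); apply: cvgD.
    by rewrite -(@normr0 R R); apply: cvg_norm; exact: D0.
  have S0 : \sum_(j < k) `|0 : R| * z ^+ j = 0.
    by rewrite big1// => i _; rewrite normr0 mul0r.
  rewrite -[X in _ --> X]S0.
  apply: cvgr_sum => j; apply: cvgM; last exact: cvg_cst.
  by apply: cvg_norm; apply: IH.
have dT n : `|d n k| <= T n + e / 2.
  apply: le_trans (_ : T n + C * B ^+ k.+1 * z <= _); last by rewrite lerD2l.
  have zk : 0 < z ^+ k by rewrite exprn_gt0.
  rewrite -(ler_pM2r zk) mulrDl divfK ?gt_eqF//.
  have := DE n k z zzs; rewrite big_ord_recr/= => H.
  have -> : C * B ^+ k.+1 * z * z ^+ k = C * (B * z) ^+ k.+1.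
    by rewrite exprMn [z ^+ k.+1]exprS !mulrA.
  rewrite -{1}(ger0_norm (ltW zk)) -normrM.
  rewrite (_ : d n k * z ^+ k = D n z - \sum_(i < k) d n i * z ^+ i -
    (D n z - (\sum_(i < k) d n i * z ^+ i + d n k * z ^+ k))); last by ring.
  rewrite (le_trans (ler_normB _ _))// lerD//.
  rewrite (le_trans (ler_normB _ _))// lerD2l.
  rewrite (le_trans (ler_norm_sum _ _ _))//; apply: ler_sum => i _.
  by rewrite normrM (ger0_norm (_ : 0 <= z ^+ i))// exprn_ge0// ltW.
near=> n; rewrite (le_trans (dT n))// [leRHS]splitr lerD2r.
near: n; move/cvgr0Pnorm_le : T0 => /(_ (e / 2)); rewrite divr_gt0// => /(_ isT).
by apply: filterS => n; apply: le_trans; exact: ler_norm.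
Unshelve. all: by end_near. Qed.

Lemma coef_eq0 (d : nat -> R) (C B zs : R) : 0 < zs -> 0 <= C -> 0 <= B ->
  (forall k z, 0 < z < zs ->
    `|\sum_(j < k.+1) d j * z ^+ j| <= C * (B * z) ^+ k.+1) ->
  forall k, d k = 0.
Proof.
move=> zs0 C0 B0 H k.
have := @coef_cvg0 (fun=> d) (fun _ _ => 0) C B zs zs0 C0 B0.
have h1 : forall (n k : nat) (z : R), 0 < z < zs ->
   `|0 - \sum_(j < k.+1) d j * z ^+ j| <= C * (B * z) ^+ k.+1.
  by move=> _ m z zz; rewrite sub0r normrN; exact: H.
move=> /(_ h1 (fun _ _ => cvg_cst _) k) h2.
by apply: (@cvg_unique _ (@Rhausdorff R) (d k @[n --> \oo])) h2; exact: cvg_cst.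
Qed.

End coefficients.

(** * Finite positive measures and interlacing products *)

Section atoms.
Context {R : realType}.
Implicit Types (s : seq (R * R)).

(** An entry pairs a weight [x.1] with a position [x.2]; the list stands for a finite positive
    measure on [[0, b]]. *)
Definition atoms_in (b : R) s : Prop :=
  forall x, x \in s -> 0 <= x.1 /\ 0 <= x.2 <= b.

Definition atoms_int (f : R -> R) s : R := \sum_(x <- s) x.1 * f x.2.

Lemma atoms_in_le b b' s : b <= b' -> atoms_in b s -> atoms_in b' s.
Proof. by move=> bb sb x /sb[-> /andP[-> /le_trans->]]. Qed.

(** Partial fractions: [(1 - z c) / ((1 - z u) (1 - z d))] has coefficient [(c - u) / (d - u)] at
    [u] and [(d - c) / (d - u)] at [d]. Both are nonnegative since [u <= c <= d], and they sum to 1,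
    which keeps the mass. *)
Lemma atoms_mul s (c d : R) : 0 <= c <= d -> atoms_in c s ->
  exists s', [/\ atoms_in d s', atoms_int (cst 1) s' = atoms_int (cst 1) s &
    forall z, 0 <= z -> z * d < 1 -> atoms_int (fun u => (1 - z * u)^-1) s' =
      atoms_int (fun u => (1 - z * u)^-1) s * ((1 - z * c) / (1 - z * d))].
Proof.
move=> /andP[c0]; rewrite le_eqVlt => /predU1P[<-|cd] sc.
  exists s; split => // z z0 zc; rewrite divff ?mulr1//.
  by rewrite gt_eqF// subr_gt0.
pose p (x : R * R) := x.1 * ((d - c) / (d - x.2)).
exists ((\sum_(x <- s) p x, d) :: [seq (x.1 * ((c - x.2) / (d - x.2)), x.2) | x <- s]).
have du x : x \in s -> 0 < d - x.2.
  by move=> /sc[_ /andP[_ xc]]; rewrite subr_gt0 (le_lt_trans xc).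
split.
- move=> x; rewrite inE => /predU1P[->/=|/mapP[y ys ->/=]].
    split; last by rewrite lexx (le_trans c0)// ltW.
    rewrite big_seq_cond sumr_ge0// => y /andP[ys _]; rewrite /p.
    have [y0 _] := sc _ ys.
    by rewrite mulr_ge0// divr_ge0 ?subr_ge0// ?(ltW cd)// ltW// -subr_gt0 du.
  have [y0 /andP[y1 y2]] := sc _ ys; split.
    by rewrite mulr_ge0// divr_ge0 ?subr_ge0// ltW// -subr_gt0 du.
  by rewrite y1 (le_trans y2)// ltW.
- rewrite /atoms_int big_cons big_map/= mulr1 -big_split/= !big_seq.
  apply: eq_bigr => x xs; rewrite /p /cst/=; have := du _ xs => /lt0r_neq0 h.
  by field.
- move=> z z0 zd; rewrite /atoms_int big_cons big_map/= !mulr_suml -big_split/= !big_seq.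
  apply: eq_bigr => x xs; rewrite /p; have h := lt0r_neq0 (du _ xs).
  have [_ /andP[x0 xc]] := sc _ xs.
  have h1 : 1 - z * d != 0 by rewrite gt_eqF// subr_gt0.
  have h2 : 1 - z * x.2 != 0.
    rewrite gt_eqF// subr_gt0 (le_lt_trans _ zd)// ler_wpM2l// (le_trans xc)// ltW//.
  by field; rewrite h h1 h2.
Qed.

(** Each factor adds an atom at [e i.+1], not to the left of the earlier ones, so [atoms_mul]
    applies again. The result is the transition measure of a zigzag diagram with minima [e] and
    maxima [c], in exponential coordinates. *)
Lemma atoms_prod (e c : nat -> R) (n : nat) : 0 <= e 0%N ->
  (forall i, e i <= c i <= e i.+1) ->
  exists s, [/\ atoms_in (e n) s, atoms_int (cst 1) s = 1 &
    forall z, 0 <= z -> z * e n < 1 -> atoms_int (fun u => (1 - z * u)^-1) s =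
      (1 - z * e 0%N)^-1 * \prod_(i < n) ((1 - z * c i) / (1 - z * e i.+1))].
Proof.
move=> e0 ec.
have nd i : e i <= e i.+1 by have /andP[/le_trans h /h] := ec i.
have en0 i : 0 <= e i by elim: i => // i /le_trans; apply.
elim: n => [|n [s [sn s1 sz]]].
  exists [:: (1, e 0%N)]; split => [x|| z z0 z1]; rewrite /atoms_int ?big_seq1 ?mulr1//.
    by rewrite inE => /eqP -> /=; rewrite e0 lexx.
  by rewrite big_ord0/= mul1r mulr1.
have /andP[h1 h2] := ec n.
have sc : atoms_in (c n) s by exact: atoms_in_le sn.
have [|s' [s'n s'1 s'z]] := @atoms_mul s (c n) (e n.+1) _ sc.
  by rewrite h2 (le_trans (en0 n)).
exists s'; split => //; first by rewrite s'1.
move=> z z0 z1; rewrite s'z// sz//; last first.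
  by rewrite (le_lt_trans _ z1)// ler_wpM2l.
by rewrite big_ord_recr/= !mulrA.
Qed.

End atoms.

(** * Polynomials approximating a step *)

Section steps.
Context {R : realType}.

(** As [m^n (u / (m T))^n = (u / T)^n], the Bernoulli inequalities show that this tends to 1 for
    [0 <= u < T] and to 0 for [T < u <= m T]. These are the step polynomials of the elementary proof
    of the Stone-Weierstrass theorem. *)
Definition step_poly (m : nat) (T : R) (n : nat) : {poly R} :=
  (1 - ((m%:R * T)^-1 *: 'X) ^+ n) ^+ (m ^ n).

Lemma step_polyE m T n u : (step_poly m T n).[u] = (1 - (u / T / m%:R) ^+ n) ^+ (m ^ n).
Proof.
rewrite /step_poly !hornerE; congr ((1 - _ ^+ _) ^+ _).
by rewrite invfM mulrC mulrA mulrAC.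
Qed.

Lemma bernoulli_ge (x : R) (n : nat) : 0 <= x <= 1 -> 1 - n%:R * x <= (1 - x) ^+ n.
Proof.
move=> /andP[x0 x1]; elim: n => [|n IH]; first by rewrite mul0r subr0 expr0.
have h : 0 <= 1 - x by rewrite subr_ge0.
rewrite exprS -natr1; apply: le_trans (ler_wpM2l h IH).
have : 0 <= n%:R * x * x by rewrite !mulr_ge0.
nra.
Qed.

(** From [1 + n x <= (1 + x)^n] and [(1 - x) (1 + x) <= 1]. *)
Lemma bernoulli_le (x : R) (n : nat) : 0 <= x <= 1 -> (1 - x) ^+ n * (1 + n%:R * x) <= 1.
Proof.
move=> /andP[x0 x1].
have h : 0 <= 1 - x by rewrite subr_ge0.
have h2 : 1 + n%:R * x <= (1 + x) ^+ n.
  elim: n => [|n IH]; first by rewrite mul0r addr0 expr0.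
  have h' : 0 <= 1 + x by rewrite addr_ge0.
  rewrite exprS -natr1; apply: le_trans (ler_wpM2l h' IH).
  have : 0 <= n%:R * x * x by rewrite !mulr_ge0.
  nra.
apply: le_trans (ler_wpM2l (exprn_ge0 _ h) h2) _.
rewrite -exprMn exprn_ile1//; nra.
Qed.

Lemma step_poly_itv m T n u : (0 < m)%N -> 0 < T -> 0 <= u <= m%:R * T ->
  0 <= (step_poly m T n).[u] <= 1.
Proof.
move=> m0 T0 /andP[u0 uT]; rewrite step_polyE.
have m1 : (0 : R) < m%:R by rewrite ltr0n.
have h : 0 <= u / T / m%:R <= 1.
  rewrite !divr_ge0//= ?(ltW T0)// ler_pdivrMr// mul1r ler_pdivrMr//.
have h1 : 0 <= (u / T / m%:R) ^+ n <= 1.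
  by move/andP : h => [h1 h2]; rewrite exprn_ge0// exprn_ile1.
by move/andP : h1 => [h1 h2]; rewrite exprn_ge0 ?subr_ge0// exprn_ile1// ?subr_ge0// gerBl.
Qed.

Lemma step_poly_cvg1 m (T u : R) : (0 < m)%N -> 0 < T -> 0 <= u < T ->
  (step_poly m T n).[u] @[n --> \oo] --> (1 : R).
Proof.
move=> m0 T0 /andP[u0 uT].
have m1 : (0 : R) < m%:R by rewrite ltr0n.
have umT : 0 <= u <= m%:R * T.
  by rewrite u0 (le_trans (ltW uT))// ler_peMl ?(ltW T0)// ler1n.
apply: (@squeeze_cvgr _ _ _ _ (fun n => 1 - (u / T) ^+ n) (fun=> 1)).
- near=> n; have /andP[_ ->] := step_poly_itv n m0 T0 umT; rewrite andbT step_polyE.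
  have h : 0 <= (u / T / m%:R) ^+ n <= 1.
    rewrite exprn_ge0 ?divr_ge0 ?(ltW T0)// exprn_ile1// ?divr_ge0 ?(ltW T0)//.
    by rewrite ler_pdivrMr// mul1r ler_pdivrMr//; case/andP: umT.
  apply: le_trans (bernoulli_ge (m ^ n) h).
  rewrite [X in _ - _ * X]exprMn exprVn natrX [X in _ <= _ - X]mulrCA divff ?mulr1//.
  by rewrite gt_eqF// exprn_gt0.
- rewrite -[X in _ --> X](subr0 1); apply: cvgB; first exact: cvg_cst.
  apply: cvg_expr; rewrite ger0_norm ?divr_ge0 ?(ltW T0)//.
  by rewrite ltr_pdivrMr// mul1r.
- exact: cvg_cst.
Unshelve. all: by end_near. Qed.

Lemma step_poly_cvg0 m (T u : R) : (0 < m)%N -> 0 < T -> T < u <= m%:R * T ->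
  (step_poly m T n).[u] @[n --> \oo] --> (0 : R).
Proof.
move=> m0 T0 /andP[uT umT].
have m1 : (0 : R) < m%:R by rewrite ltr0n.
have u0 : 0 < u by rewrite (lt_trans T0).
have umT' : 0 <= u <= m%:R * T by rewrite (ltW u0).
apply: (@squeeze_cvgr _ _ _ _ (fun=> 0) (fun n => (T / u) ^+ n)).
- near=> n; have /andP[-> _] := step_poly_itv n m0 T0 umT'; rewrite /= step_polyE.
  have h : 0 <= (u / T / m%:R) ^+ n <= 1.
    rewrite exprn_ge0 ?divr_ge0 ?(ltW T0) ?(ltW u0)// exprn_ile1// ?divr_ge0 ?(ltW T0) ?(ltW u0)//.
    by rewrite ler_pdivrMr// mul1r ler_pdivrMr//; case/andP: umT.
  have := bernoulli_le (m ^ n) h.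
  have -> : (m ^ n)%:R * (u / T / m%:R) ^+ n = (u / T) ^+ n :> R.
    rewrite [X in _ * X]exprMn exprVn natrX mulrCA divff ?mulr1//.
    by rewrite gt_eqF// exprn_gt0.
  set y := (_ - _) ^+ _ => H.
  have y0 : 0 <= y by rewrite exprn_ge0// subr_ge0; case/andP: h.
  have ut : 0 < (u / T) ^+ n by rewrite exprn_gt0// divr_gt0.
  rewrite -[T / u]invf_div exprVn -[leRHS]mul1r ler_pdivlMr//.
  by apply: le_trans H; rewrite mulrDr mulr1 lerDr.
- exact: cvg_cst.
- apply: cvg_expr; rewrite ger0_norm ?divr_ge0 ?(ltW T0) ?(ltW u0)//.
  by rewrite ltr_pdivrMr// mul1r.
Unshelve. all: by end_near. Qed.

End steps.

(** * From nonnegative polynomial integrals to a nonnegative density *)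

Section positivity.
Context {R : realType}.
Notation mu := (@lebesgue_measure R).

Lemma Rdominated_cvg (f_ : nat -> R -> R) (f g : R -> R) :
  (forall n, measurable_fun setT (f_ n)) -> measurable_fun setT f ->
  {ae mu, forall x, f_ n x @[n --> \oo] --> f x} ->
  mu.-integrable setT (EFin \o g) -> (forall n x, `|f_ n x| <= g x) ->
  mu.-integrable setT (EFin \o f) /\
  \int[mu]_x f_ n x @[n --> \oo] --> \int[mu]_x f x.
Proof.
move=> mf_ mf cvf ig fg.
have H1 : {ae mu, forall x, setT x -> (EFin \o f_ n) x @[n --> \oo] --> (EFin \o f) x}.
  apply: filterS cvf; first exact: (ae_filter_ringOfSetsType mu).
  by move=> x h _; apply: cvg_EFin; [exact: nearW|exact: h].
have H2 : {ae mu, forall x n, setT x -> (`|(EFin \o f_ n) x| <= (EFin \o g) x)%E}.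
  by apply: aeW => x n _; rewrite /= lee_fin.
have [iF _ cv] := @dominated_convergence _ (measurableTypeR R) R mu setT measurableT
  (fun n => EFin \o f_ n) (EFin \o f) (EFin \o g) (fun n => (measurable_EFinP _ _).2 (mf_ n)) ((measurable_EFinP _ _).2 mf) H1 ig H2.
split => //; rewrite /Rintegral; apply: fine_cvg; rewrite fineK//.
exact: integrable_fin_num.
Qed.

(** [P n] is the step down at [e^(Ld)] times one minus the step down at [e^(Lc)]. It has values in
    [[0, 1]] on the support and tends to the indicator of [[c, d]] away from [c] and [d], so
    dominated convergence applies. *)
Lemma poly_pos_interval (g : R -> R) (L b : R) : 0 < L ->
  mu.-integrable setT (EFin \o g) -> (forall s, b < `|s| -> g s = 0) ->
  (forall P : {poly R}, (forall v, 0 <= v <= expR (L * b) -> 0 <= P.[v]) ->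
    0 <= \int[mu]_s (g s * P.[expR (L * s)])) ->
  forall c d, c <= d -> 0 <= \int[mu]_(s in `[c, d]) g s.
Proof.
move=> L0 ig gb Ppos c d cd.
pose B := expR (L * b).
(* [step_poly] is controlled only up to [m] times its threshold; for both thresholds this has to
   reach the right edge [B]. *)
have [m [m0 mc md]] : exists m : nat, [/\ (0 < m)%N, B <= m%:R * expR (L * c) &
    B <= m%:R * expR (L * d)].
  have h1 : 0 <= B / expR (L * c) by rewrite divr_ge0// expR_ge0.
  exists (Num.bound (B / expR (L * c))).+1; split => //.
    rewrite -ler_pdivrMr ?expR_gt0// (le_trans (ltW (archi_boundP h1)))//.
    by rewrite ler_nat.
  apply: (@le_trans _ _ ((Num.bound (B / expR (L * c))).+1%:R * expR (L * c))).
    rewrite -ler_pdivrMr ?expR_gt0// (le_trans (ltW (archi_boundP h1)))//.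
    by rewrite ler_nat.
  by rewrite ler_wpM2l// ler_expR ler_wpM2l// ltW.
pose Q T n := step_poly m (expR (L * T)) n.
pose P n := Q d n * (1 - Q c n).
have Q01 T n v : B <= m%:R * expR (L * T) -> 0 <= v <= B -> 0 <= (Q T n).[v] <= 1.
  move=> mT /andP[v0 vB]; apply: step_poly_itv => //; first exact: expR_gt0.
  by rewrite v0 (le_trans vB).
have P01 n v : 0 <= v <= B -> 0 <= (P n).[v] <= 1.
  move=> vB; rewrite /P hornerM hornerD hornerN hornerC.
  have /andP[h1 h2] := Q01 d n v md vB; have /andP[h3 h4] := Q01 c n v mc vB.
  by rewrite mulr_ge0 ?subr_ge0//= mulr_ile1 ?subr_ge0// gerBl.
have uB s : `|s| <= b -> 0 <= expR (L * s) <= B.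
  move=> sb; rewrite expR_ge0/= ler_expR ler_wpM2l ?(ltW L0)//.
  by rewrite (le_trans (ler_norm _)).
have mg : measurable_fun setT g by have /integrableP[/measurable_EFinP] := ig.
have mexp : measurable_fun setT (fun s : R => expR (L * s)).
  apply: (@measurableT_comp _ _ _ _ _ _ expR); first exact: measurable_expR.
  exact: measurable_funM.
have mP (p : {poly R}) : measurable_fun setT (fun s : R => p.[expR (L * s)]).
  apply: (@measurableT_comp _ _ _ _ _ _ (horner p)) => //.
  exact: continuous_measurable_fun (@continuous_horner _ p).
pose F n s := g s * (P n).[expR (L * s)].
pose G := g \_ `[c, d].
have mF n : measurable_fun setT (F n) by apply: measurable_funM.
have mG : measurable_fun setT G.
  apply/(measurable_restrictT _ _).1 => //; exact: measurable_funTS.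
have aecd : {ae mu, forall s, s != c /\ s != d}.
  have : mu.-negligible ([set c] `|` [set d]).
    apply: negligibleU; apply/negligibleP => //; exact: lebesgue_measure_set1.
  apply: negligibleS => s /= /not_andP[] /negP; rewrite negbK => /eqP ->; [by left|by right].
have cvgF : {ae mu, forall s, F n s @[n --> \oo] --> G s}.
  apply: filterS aecd; first exact: (ae_filter_ringOfSetsType mu).
  move=> s [sc sd].
  rewrite /F /G; have [sb|bs] := leP `|s| b; last first.
    rewrite /patch gb//; case: ifP => _; under eq_fun do rewrite mul0r; exact: cvg_cst.
  have usB := uB _ sb.
  rewrite -[X in _ --> X]mulr1 /patch.
  suff H : (P n).[expR (L * s)] @[n --> \oo] --> ((s \in `[c, d]%classic)%:R : R).
    case: ifPn => scd; first by rewrite scd in H; exact: (cvgM (cvg_cst _) H).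
    rewrite (negbTE scd) in H; rewrite mul0r -(mulr0 (g s)); exact: (cvgM (cvg_cst _) H).
  rewrite /P; under eq_fun do rewrite hornerM hornerD hornerN hornerC.
  have -> : (s \in `[c, d]%classic)%:R = (s < d)%R%:R * (1 - (s < c)%R%:R) :> R.
    rewrite mem_setE in_itv/= le_eqVlt eq_sym (negbTE sc) /= [s <= d]le_eqVlt (negbTE sd)/=.
    have [cs|sc'] := ltP c s; first by rewrite [s < c]ltNge (ltW cs)/= subr0 mulr1.
    by rewrite [s < c]lt_neqAle sc sc' /= subrr mulr0.
  have stepcvg T : B <= m%:R * expR (L * T) -> s != T ->
      (Q T n).[expR (L * s)] @[n --> \oo] --> ((s < T)%R%:R : R).
    move=> mT sT; have [lt|] := ltP s T.
      apply: step_poly_cvg1 => //; first exact: expR_gt0.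
      by rewrite expR_ge0 ltr_expR ltr_pM2l.
    rewrite le_eqVlt eq_sym (negbTE sT)/= => Ts.
    apply: step_poly_cvg0 => //; first exact: expR_gt0.
    rewrite ltr_expR ltr_pM2l// Ts/=; case/andP: usB => _ /le_trans; exact.
  apply: cvgM; first exact: stepcvg.
  by apply: cvgB; [exact: cvg_cst|exact: stepcvg].
have domF n s : `|F n s| <= `|g s|.
  rewrite /F normrM; have [sb|bs] := leP `|s| b; last by rewrite gb// normr0 mul0r.
  have /andP[h1 h2] := P01 n _ (uB _ sb).
  by rewrite ler_piMr// ger0_norm.
have [iG cv] := Rdominated_cvg mF mG cvgF (integrable_abse ig) domF.
rewrite Rintegral_mkcond -(cvg_lim _ cv)//.
apply: limr_ge; first by apply/cvg_ex; eexists; exact: cv.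
by near=> n; apply: Ppos => v vB; have /andP[] := P01 n v vB.
Unshelve. all: by end_near. Qed.

(** Lebesgue differentiation: almost everywhere [g] is the limit of its averages over short
    intervals. *)
Lemma interval_pos_ae (g : R -> R) : mu.-integrable setT (EFin \o g) ->
  (forall c d, c <= d -> 0 <= \int[mu]_(s in `[c, d]) g s) ->
  {ae mu, forall s, 0 <= g s}.
Proof.
move=> ig gpos.
have ig' A : measurable A -> mu.-integrable A (EFin \o g).
  by move=> mA; apply: integrableS ig.
have := FTC1Ny (fun y => ig' _ (measurable_itv _)) (open_integrable_locally openT ig).
apply: filterS; first exact: (ae_filter_ringOfSetsType mu).
move=> x [dF <-]; have H := diff_quotient_seq dF.
rewrite -(cvg_lim _ H)//; apply: limr_ge; first by apply/cvg_ex; eexists; exact: H.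
near=> n; rewrite /diff_quotient mulr_ge0// subr_ge0.
rewrite -subr_ge0 Rintegral_itvB//; last 2 first.
- exact: ig'.
- by rewrite bnd_simp lerDl.
rewrite Rintegral_itv_obnd_cbnd; last exact: ig'.
by apply: gpos; rewrite lerDl.
Unshelve. all: by end_near. Qed.

End positivity.

(** * Power series with nonnegative coefficients *)

Section nonneg_power_series.
Context {R : realType}.
Implicit Types (a b : nat -> R) (f g : R -> R) (r : R).

(** Convergence includes the endpoint [r]. Nonnegative coefficients make the partial sums monotone,
    so products, limits and exponentials follow from real order arguments alone. *)
Definition psum r a f : Prop := (forall k, 0 <= a k) /\
  forall z, 0 <= z <= r -> \sum_(k < n) a k * z ^+ k @[n --> \oo] --> f z.

Definition psum_like r f : Prop := exists a, psum r a f.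

Definition cauchy_prod a b (k : nat) : R := \sum_(i < k.+1) a i * b (k - i)%N.

Lemma psum_partial_le r a f n z : psum r a f -> 0 <= z <= r ->
  \sum_(k < n) a k * z ^+ k <= f z.
Proof.
move=> [a0 af] zr; have := af z zr => H; rewrite -(cvg_lim _ H)//.
have /andP[z0 _] := zr.
apply: (@nondecreasing_cvgn_le R (fun n => \sum_(k < n) a k * z ^+ k)) => [|].
  apply/nondecreasing_seqP => m; rewrite big_ord_recr/= lerDl mulr_ge0//.
  exact: exprn_ge0.
by apply/cvg_ex; eexists; exact: H.
Qed.

Lemma psum_ge0 r a f z : psum r a f -> 0 <= z <= r -> 0 <= f z.
Proof. by move=> pf zr; have := psum_partial_le 0 pf zr; rewrite big_ord0. Qed.

Lemma psum_of_bounds r a f : (forall k, 0 <= a k) ->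
  (forall z n, 0 <= z <= r -> \sum_(k < n) a k * z ^+ k <= f z) ->
  (forall z e, 0 <= z <= r -> 0 < e -> exists n, f z - e <= \sum_(k < n) a k * z ^+ k) ->
  psum r a f.
Proof.
move=> a0 le ge; split => // z zr; have /andP[z0 _] := zr.
apply/cvgrPdist_le => e e0; have [n Hn] := ge z e zr e0.
exists n => // m /= nm; rewrite ger0_norm ?subr_ge0 ?le// lerBlDr -lerBlDl.
apply: (le_trans Hn); rewrite -!(big_mkord xpredT (fun k => a k * z ^+ k)).
rewrite (big_cat_nat _ nm)//= lerDl sumr_ge0// => i _.
by rewrite mulr_ge0// exprn_ge0.
Qed.

Lemma psum_ex r a f z e : psum r a f -> 0 <= z <= r -> 0 < e ->
  exists n, f z - e <= \sum_(k < n) a k * z ^+ k.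
Proof.
move=> [a0 af] zr e0; have /cvgrPdist_le /(_ e e0)[n _ Hn] := af z zr.
exists n; have := Hn n (leqnn n); rewrite /= ler_norml => /andP[_].
by rewrite lerBlDr -lerBlDl.
Qed.

(** The product of the partial sums of order [n] lies between the partial sums of the Cauchy product
    of orders [n] and [n + n]. *)
Lemma psumM r a b f g : psum r a f -> psum r b g ->
  psum r (cauchy_prod a b) (fun z => f z * g z).
Proof.
move=> pf pg; have [a0 _] := pf; have [b0 _] := pg.
have c0 k : 0 <= cauchy_prod a b k by rewrite sumr_ge0// => i _; rewrite mulr_ge0.
pose p n := \poly_(i < n) a i; pose q n := \poly_(i < n) b i.
have pE n z : (p n).[z] = \sum_(k < n) a k * z ^+ k by rewrite horner_poly.
have qE n z : (q n).[z] = \sum_(k < n) b k * z ^+ k by rewrite horner_poly.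
have cle n k : 0 <= (p n * q n)`_k <= cauchy_prod a b k.
  rewrite coefM; apply/andP; split.
    by rewrite sumr_ge0// => i _; rewrite !coef_poly; case: ifP => _; case: ifP => _; rewrite ?mul0r ?mulr0 ?mulr_ge0.
  apply: ler_sum => i _; rewrite !coef_poly.
  by case: ifP => _; case: ifP => _; rewrite ?mul0r ?mulr0 ?mulr_ge0.
have ceq n k : (k < n)%N -> (p n * q n)`_k = cauchy_prod a b k.
  move=> kn; rewrite coefM; apply: eq_bigr => i _; rewrite !coef_poly.
  rewrite (leq_ltn_trans _ kn); last by rewrite -ltnS.
  by rewrite (leq_ltn_trans _ kn)// leq_subr.
have spq n : (size (p n * q n)%R <= n + n)%N.
  apply: leq_trans (size_polyMleq _ _) _.
  apply: leq_trans (leq_pred _) _.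
  by rewrite leq_add// size_poly.
have pqE n z : (p n * q n).[z] = \sum_(k < n + n) (p n * q n)`_k * z ^+ k.
  by rewrite (horner_coef_wide z (spq n)).
apply: psum_of_bounds => // [z n zr|z e zr e0]; have /andP[z0 _] := zr.
  apply: (@le_trans _ _ ((p n).[z] * (q n).[z])).
    rewrite -hornerM pqE big_split_ord/= -[leLHS]addr0 lerD//; last first.
      by rewrite sumr_ge0// => i _; rewrite mulr_ge0 ?exprn_ge0//; have /andP[] := cle n (n + i)%N.
    by apply: ler_sum => i _; rewrite ceq.
  rewrite pE qE; apply: ler_pM; [| |exact: psum_partial_le pf zr|exact: psum_partial_le pg zr].
    by rewrite sumr_ge0// => i _; rewrite mulr_ge0// exprn_ge0.
  by rewrite sumr_ge0// => i _; rewrite mulr_ge0// exprn_ge0.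
have H : (p n).[z] * (q n).[z] @[n --> \oo] --> f z * g z.
  under eq_fun do rewrite pE qE.
  by apply: cvgM; [exact: pf.2|exact: pg.2].
have /cvgrPdist_le /(_ e e0)[n _ Hn] := H.
exists (n + n)%N; have := Hn n (leqnn n); rewrite /= ler_norml => /andP[_].
rewrite lerBlDr -lerBlDl => /le_trans; apply.
rewrite -hornerM pqE; apply: ler_sum => i _; rewrite ler_wpM2r ?exprn_ge0//.
by have /andP[] := cle n i.
Qed.

Lemma psum_ext r a f g : (forall z, 0 <= z <= r -> f z = g z) -> psum r a f -> psum r a g.
Proof. by move=> fg [a0 af]; split => // z zr; rewrite -fg//; exact: af. Qed.

Lemma psum_finite r (p : {poly R}) : (forall k, 0 <= p`_k) -> psum r (fun k => p`_k) (horner p).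
Proof.
move=> p0; split => // z _; apply/cvgrPdist_le => e e0.
exists (size p) => // n /= pn; rewrite (horner_coef_wide z pn) subrr normr0 ltW//.
Qed.

Lemma psumD r a b f g : psum r a f -> psum r b g ->
  psum r (fun k => a k + b k) (fun z => f z + g z).
Proof.
move=> [a0 af] [b0 bg]; split => [k|z zr]; first by rewrite addr_ge0.
under eq_fun do under eq_bigr do rewrite mulrDl.
under eq_fun do rewrite big_split/=.
by apply: cvgD; [exact: af|exact: bg].
Qed.

Lemma psumZ r c a f : 0 <= c -> psum r a f -> psum r (fun k => c * a k) (fun z => c * f z).
Proof.
move=> c0 [a0 af]; split => [k|z zr]; first by rewrite mulr_ge0.
under eq_fun do under eq_bigr do rewrite -mulrA.
under eq_fun do rewrite -mulr_sumr.
by apply: cvgM; [exact: cvg_cst|exact: af].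
Qed.

(** Monotone convergence of coefficients: [a_ n k] increases with [n] and stays below
    [f r / r ^+ k]. *)
Lemma psum_lim r (a_ : nat -> nat -> R) (f_ : nat -> R -> R) f : 0 < r ->
  (forall n, psum r (a_ n) (f_ n)) -> (forall n k, a_ n k <= a_ n.+1 k) ->
  (forall z, 0 <= z <= r -> f_ n z @[n --> \oo] --> f z) ->
  psum_like r f.
Proof.
move=> r0 pf nd cvf.
have rr : 0 <= r <= r by rewrite ltW//= lexx.
have ndk k : {homo (fun n => a_ n k) : n m / (n <= m)%N >-> n <= m}.
  by apply/nondecreasing_seqP => n; exact: nd.
have ndf z : 0 <= z <= r -> {homo (fun n => f_ n z) : n m / (n <= m)%N >-> n <= m}.
  move=> zr; have /andP[z0 _] := zr; apply/nondecreasing_seqP => n.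
  have H1 := (pf n).2 z zr; have H2 := (pf n.+1).2 z zr.
  rewrite -(cvg_lim _ H1)// -(cvg_lim _ H2)//.
  apply: ler_lim; [by apply/cvg_ex; eexists; exact: H1|by apply/cvg_ex; eexists; exact: H2|].
  by apply: nearW => m; apply: ler_sum => i _; rewrite ler_wpM2r// exprn_ge0.
have fle n z : 0 <= z <= r -> f_ n z <= f z.
  move=> zr; have H := cvf z zr; rewrite -(cvg_lim _ H)//.
  apply: (@nondecreasing_cvgn_le R (fun n => f_ n z)); first exact: ndf.
  by apply/cvg_ex; eexists; exact: H.
have cva k : cvg (a_ n k @[n --> \oo]).
  apply: nondecreasing_is_cvgn; first exact: ndk.
  exists (f r / r ^+ k) => _ [n _ <-]; rewrite ler_pdivlMr ?exprn_gt0//.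
  apply: le_trans (fle n r rr); apply: le_trans (psum_partial_le k.+1 (pf n) rr).
  rewrite big_ord_recr/= lerDr sumr_ge0// => i _.
  by rewrite mulr_ge0 ?exprn_ge0 ?(ltW r0)//; exact: (pf n).1.
pose a k := lim (a_ n k @[n --> \oo]).
have ale n k : a_ n k <= a k.
  by apply: (@nondecreasing_cvgn_le R (fun n => a_ n k)); [exact: ndk|exact: cva].
exists a; apply: psum_of_bounds => [k|z m zr|z e zr e0].
- by apply: le_trans (ale 0%N k); exact: (pf 0%N).1.
- have H : \sum_(k < m) a_ n k * z ^+ k @[n --> \oo] --> \sum_(k < m) a k * z ^+ k.
    by apply: cvgr_sum => k; apply: cvgM; [exact: cva|exact: cvg_cst].
  rewrite -(cvg_lim _ H)//; apply: limr_le; first by apply/cvg_ex; eexists; exact: H.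
  apply: nearW => n; apply: le_trans (fle n z zr); exact: psum_partial_le (pf n) zr.
- have e2 : 0 < e / 2 by rewrite divr_gt0.
  have /cvgrPdist_le /(_ _ e2)[n _ Hn] := cvf z zr.
  have := Hn n (leqnn n); rewrite /= ler_norml => /andP[_ H1].
  have [m Hm] := psum_ex (pf n) zr e2; have /andP[z0 _] := zr.
  exists m; apply: (@le_trans _ _ (\sum_(k < m) a_ n k * z ^+ k)); first by lra.
  by apply: ler_sum => k _; rewrite ler_wpM2r// exprn_ge0.
Qed.

Lemma psum_expR r f : 0 < r -> psum_like r f -> psum_like r (fun z => expR (f z)).
Proof.
move=> r0 [a pf].
pose one : {poly R} := 1.
pose pw := fix pw m := if m is m'.+1 then cauchy_prod a (pw m') else fun k => one`_k.
have pwP m : psum r (pw m) (fun z => f z ^+ m).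
  elim: m => [|m IH] /=.
    apply: psum_ext (psum_finite _ _) => [z _|k]; first by rewrite hornerC expr0.
    by rewrite coefC; case: ifP.
  by apply: psum_ext (psumM pf IH) => z _; rewrite exprS.
pose c := fix c n := if n is n'.+1 then (fun k => c n' k + (n'`!%:R)^-1 * pw n' k) else fun k => (0 : {poly R})`_k.
have cP n : psum r (c n) (fun z => \sum_(m < n) (m`!%:R)^-1 * f z ^+ m).
  elim: n => [|n IH] /=.
    apply: psum_ext (psum_finite _ _) => [z _|k]; first by rewrite hornerC big_ord0.
    by rewrite coef0.
  apply: psum_ext (psumD IH (psumZ _ (pwP n))) => [z _|]; first by rewrite big_ord_recr.
  by rewrite invr_ge0.
apply: (psum_lim r0 cP) => [n k|z zr] /=.
  by rewrite lerDl mulr_ge0 ?invr_ge0//; exact: (pwP n).1.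
rewrite (_ : (fun n => _) = series (exp_coeff (f z))); last first.
  apply/funext => n; rewrite /series/= big_mkord; apply: eq_bigr => m _.
  by rewrite mulrC.
exact: is_cvg_series_exp_coeff.
Qed.

(** For [k >= n] and [0 <= z <= r] one has [z^k <= r^k (z / r)^n], so the tail at [z] is at most the
    tail at [r] times a geometric factor. *)
Lemma psum_tail r a f z n : 0 < r -> psum r a f -> 0 <= z <= r ->
  `|f z - \sum_(k < n) a k * z ^+ k| <= f r * (r^-1 * z) ^+ n.
Proof.
move=> r0 pf zr; have rr : 0 <= r <= r by rewrite ltW//= lexx.
have [a0 af] := pf; have /andP[z0 zler] := zr.
rewrite ger0_norm ?subr_ge0 ?(psum_partial_le n pf zr)//.
rewrite lerBlDr; have H := af z zr; rewrite -(cvg_lim _ H)//.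
apply: limr_le; first by apply/cvg_ex; eexists; exact: H.
exists n => // m /= nm; rewrite -!(big_mkord xpredT (fun k => a k * z ^+ k)).
rewrite (big_cat_nat _ nm)//= addrC lerD2r.
apply: (@le_trans _ _ ((\sum_(n <= k < m) a k * r ^+ k) * (r^-1 * z) ^+ n)).
  rewrite mulr_suml big_seq_cond [leRHS]big_seq_cond; apply: ler_sum => k.
  rewrite mem_index_iota andbT => /andP[nk km].
  rewrite -mulrA ler_wpM2l// exprMn -{1}(subnK nk) exprD -{2}(subnK nk) exprD.
  rewrite exprVn mulrA mulfK ?expf_neq0 ?gt_eqF//.
  by rewrite ler_wpM2r ?exprn_ge0// lerXn2r ?nnegrE ?(ltW r0)//.
rewrite ler_wpM2r ?exprn_ge0 ?mulr_ge0 ?invr_ge0 ?(ltW r0)//.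
apply: le_trans (psum_partial_le m pf rr).
rewrite -(big_mkord xpredT (fun k => a k * r ^+ k)) [leRHS](big_cat_nat _ nm)//= lerDr.
by rewrite sumr_ge0// => i _; rewrite mulr_ge0 ?exprn_ge0 ?(ltW r0).
Qed.

(** The stand-in for analytic continuation: the tail bounds feed [coef_eq0], so agreement on a short
    interval forces equal coefficients and hence equality up to [r]. *)
Lemma psum_identity r f g e : 0 < r -> 0 < e -> psum_like r f -> psum_like r g ->
  (forall z, 0 < z < e -> f z = g z) -> forall z, 0 <= z <= r -> f z = g z.
Proof.
move=> r0 e0 [a pf] [b pg] fg z zr.
have rr : 0 <= r <= r by rewrite ltW//= lexx.
have ab k : a k - b k = 0.
  apply: (@coef_eq0 R (fun k => a k - b k) (f r + g r) r^-1 (Num.min e r)).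
  - by rewrite lt_min e0.
  - by rewrite addr_ge0// ?(psum_ge0 pf)// (psum_ge0 pg).
  - by rewrite invr_ge0 ltW.
  - move=> n y /andP[y0]; rewrite lt_min => /andP[ye yr].
    have yr' : 0 <= y <= r by rewrite !ltW.
    under eq_bigr do rewrite mulrBl; rewrite sumrB mulrDl.
    rewrite -(subrKA (f y)) {2}fg ?y0// (le_trans (ler_normD _ _))//.
    rewrite lerD//; first by rewrite distrC; exact: psum_tail.
    exact: psum_tail.
have E : a = b by apply/funext => k; apply/eqP; rewrite -subr_eq0 ab.
have H1 := pf.2 z zr; have H2 := pg.2 z zr; rewrite -E in H2.
exact: (cvg_unique _ H1 H2).
Qed.

End nonneg_power_series.

(** * The logarithmic kernel and its derivatives *)

Section log_kernel.
Context {R : realType} (L z b : R).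
Hypotheses (L0 : 0 < L) (z0 : 0 < z) (zb : z * expR (L * b) <= 2^-1).

(** The logarithm of an interlacing product is a sum of differences of [lker], while the exponent of
    the growth equation is an integral of its derivative [kker] against the differential of the
    charge. *)
Definition lker (s : R) : R := - ln (1 - z * expR (L * s)).
Definition kker (s : R) : R := L * ((1 - z * expR (L * s))^-1 - 1).

Lemma zu_itv s : s <= b -> 0 < z * expR (L * s) <= 2^-1.
Proof.
move=> sb; rewrite mulr_gt0 ?expR_gt0//= (le_trans _ zb)// ler_pM2l//.
by rewrite ler_expR ler_pM2l.
Qed.

Lemma one_sub_zu s : s <= b -> 2^-1 <= 1 - z * expR (L * s) < 1.
Proof. by move=> /zu_itv/andP[h1 h2]; apply/andP; split; lra. Qed.

Lemma is_derive_zu (s : R) : is_derive s 1 (fun s => 1 - z * expR (L * s)) (- (L * (z * expR (L * s)))).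
Proof.
apply: is_derive_eq; rewrite /GRing.scale/=.
by rewrite !(mulr0, addr0, mulr1, add0r, mulr0, sub0r); ring.
Qed.

Lemma is_derive_lker (s : R) : s <= b -> is_derive s 1 lker (kker s).
Proof.
move=> sb; have /andP[h1 h2] := one_sub_zu sb.
have h : 0 < 1 - z * expR (L * s) by apply: lt_le_trans h1.
have d1 := is_derive_zu s.
have d2 : is_derive (1 - z * expR (L * s)) 1 (@ln R) (1 - z * expR (L * s))^-1 by exact: is_derive1_ln.
have d3 : is_derive s 1 (fun s => ln (1 - z * expR (L * s)))
    (- (L * (z * expR (L * s))) * (1 - z * expR (L * s))^-1).
  have := @is_derive1_comp R (@ln R) (fun s => 1 - z * expR (L * s)) s _ _ d2 d1.
  by move=> H; apply: is_derive_eq H _; rewrite mulrC.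
rewrite (_ : kker s = - (- (L * (z * expR (L * s))) * (1 - z * expR (L * s))^-1)).
  exact: is_deriveN.
by rewrite /kker; field; rewrite gt_eqF.
Qed.

Lemma is_derive_kker (s : R) : s <= b ->
  is_derive s 1 kker (L * (L * (z * expR (L * s)) / (1 - z * expR (L * s)) ^+ 2)).
Proof.
move=> sb; have /andP[h1 h2] := one_sub_zu sb.
have h : 1 - z * expR (L * s) != 0 by rewrite gt_eqF// (lt_le_trans _ h1).
have d1 := is_derive_zu s.
have d2 : is_derive s 1 (fun s => (1 - z * expR (L * s))^-1 - 1)
   (L * (z * expR (L * s)) / (1 - z * expR (L * s)) ^+ 2).
  have d2' := @is_deriveV R (fun s => 1 - z * expR (L * s)) s _ 1 h d1.
  have d3 : is_derive s 1 (fun=> 1 : R) 0 by exact: is_derive_cst.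
  have d4 := is_deriveB d2' d3.
  apply: is_derive_eq d4 _.
  by rewrite subr0 /GRing.scale/= -exprVn; ring.
have d5 := is_deriveZ L d2.
by apply: is_derive_eq d5 _.
Qed.

(** The derivative of [kker] is [L^2 y / (1 - y)^2] with [y = z e^(Ls) <= 1/2], hence at most
    [2 L^2]. *)
Lemma kker_lip x y : x <= b -> y <= b -> `|kker y - kker x| <= 2 * L ^+ 2 * `|y - x|.
Proof.
wlog xy : x y / x <= y.
  move=> H xb yb; have [xy|/ltW yx] := leP x y; first exact: H.
  by rewrite distrC [`|y - x|]distrC; exact: H.
move=> xb yb; move: xy; rewrite le_eqVlt => /predU1P[->|xy].
  by rewrite !subrr normr0 mulr0.
have [||c] := @MVT _ kker (fun s => L * (L * (z * expR (L * s)) / (1 - z * expR (L * s)) ^+ 2)) _ _ xy.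
- move=> s; rewrite in_itv/= => /andP[_ sy]; apply: is_derive_kker.
  by rewrite (le_trans (ltW sy)).
- apply: continuous_in_subspaceT => s; rewrite inE/= in_itv/= => /andP[_ sy].
  apply: differentiable_continuous; apply/derivable1_diffP.
  have h := is_derive_kker (le_trans sy yb); exact: ex_derive.
rewrite in_itv/= => /andP[_ cy] ->; rewrite normrM ler_wpM2r//.
have cb := le_trans (ltW cy) yb.
have /andP[h1 h2] := one_sub_zu cb; have /andP[h3 h4] := zu_itv cb.
rewrite ger0_norm; last first.
  by rewrite !mulr_ge0 ?(ltW L0)// ?expR_ge0 ?(ltW z0)// invr_ge0 exprn_ge0// (le_trans _ h1).
rewrite [X in X <= _](_ : _ = L ^+ 2 * (z * expR (L * c) / (1 - z * expR (L * c)) ^+ 2)); last by ring.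
rewrite mulrC ler_wpM2r ?exprn_ge0 ?(ltW L0)//.
rewrite ler_pdivrMr; last by rewrite exprn_gt0// (lt_le_trans _ h1).
nra.
Qed.

Lemma lker_taylor x y : x <= y -> y <= b ->
  `|lker y - lker x - kker y * (y - x)| <= 2 * L ^+ 2 * (y - x) ^+ 2.
Proof.
rewrite le_eqVlt => /predU1P[-> yb|xy yb].
  by rewrite !subrr mulr0 subr0 normr0 expr0n mulr0.
have [||c] := @MVT _ lker kker _ _ xy.
- move=> s; rewrite in_itv/= => /andP[_ sy]; apply: is_derive_lker.
  by rewrite (le_trans (ltW sy)).
- apply: continuous_in_subspaceT => s; rewrite inE/= in_itv/= => /andP[_ sy].
  apply: differentiable_continuous; apply/derivable1_diffP.
  have h := is_derive_lker (le_trans sy yb); exact: ex_derive.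
rewrite in_itv/= => /andP[xc cy] ->; rewrite -mulrBl normrM.
have h := kker_lip yb (le_trans (ltW cy) yb).
rewrite [X in _ <= _ * X]expr2 mulrA (ger0_norm (_ : 0 <= y - x)); last by rewrite subr_ge0 ltW.
rewrite ler_wpM2r ?subr_ge0 ?(ltW xy)// (le_trans h)//.
rewrite ler_wpM2l ?mulr_ge0 ?exprn_ge0 ?(ltW L0)//.
by rewrite distrC gtr0_norm ?subr_gt0// lerD2l lerN2 ltW.
Qed.

End log_kernel.

(** * Integrals of compactly supported functions *)

Section compact_integrals.
Context {R : realType}.
Notation mu := (@lebesgue_measure R).

Lemma Rintegral_support (f : R -> R) (b : R) : (forall s, b < `|s| -> f s = 0) ->
  \int[mu]_s f s = \int[mu]_(s in `[- b, b]) f s.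
Proof.
move=> f0; rewrite [RHS]Rintegral_mkcond; apply: eq_Rintegral => s _.
rewrite /patch; case: ifPn => //; rewrite notin_setE/= in_itv/= => /negP.
by rewrite -ler_norml -ltNge => /f0.
Qed.

Lemma integrable_support (f : R -> R) (b : R) : measurable_fun setT f ->
  (forall s, b < `|s| -> f s = 0) -> mu.-integrable `[- b, b] (EFin \o f) ->
  mu.-integrable setT (EFin \o f).
Proof.
move=> mf f0 iF.
have := (@integrable_mkcond _ (measurableTypeR R) R mu `[- b, b] (EFin \o f) (measurable_itv _)).1 iF.
rewrite (_ : _ \_ _ = EFin \o f)//; apply/funext => s.
rewrite /patch/=; case: ifPn => //; rewrite notin_setE/= in_itv/= => /negP.
by rewrite -ler_norml -ltNge => /f0 ->.
Qed.

Lemma support_le (f : R -> R) (b s : R) : (forall s, b < `|s| -> f s = 0) ->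
  f s != 0 -> s <= b.
Proof.
move=> f0 fs; rewrite (le_trans (ler_norm _))// leNgt; apply/negP => /f0 h.
by rewrite h eqxx in fs.
Qed.

Lemma support_expR_le (L : R) (f : R -> R) (b s : R) : 0 < L ->
  (forall s, b < `|s| -> f s = 0) -> f s != 0 -> expR (L * s) <= expR (L * b).
Proof. by move=> L0 f0 fs; rewrite ler_expR ler_pM2l//; exact: support_le f0 fs. Qed.

(** The bound is asked only where [f] does not vanish, because the kernels [(1 - z e^(Ls))^-1] with
    [z > 0] have a pole, kept off the support of [f] in the applications. *)
Lemma integrable_mul_bounded (f g : R -> R) (C : R) :
  mu.-integrable setT (EFin \o f) -> measurable_fun setT g ->
  (forall s, f s != 0 -> `|g s| <= C) -> mu.-integrable setT (EFin \o (fun s => g s * f s)).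
Proof.
move=> iF mg gC; have mf : measurable_fun setT f by have /integrableP[/measurable_EFinP] := iF.
have iCf := integrableZl measurableT C iF.
apply: (le_integrable _ _ _ iCf) => //.
- by apply/measurable_EFinP; exact: measurable_funM.
- move=> s _ /=; rewrite lee_fin normrM normrM.
  have [->|fs0] := eqVneq (f s) 0; first by rewrite normr0 !mulr0.
  by rewrite ler_wpM2r// (le_trans (gC _ fs0))// ler_norm.
Qed.

Lemma integrable_subr (A : set (measurableTypeR R)) (f g : R -> R) : measurable A ->
  mu.-integrable A (EFin \o f) -> mu.-integrable A (EFin \o g) ->
  mu.-integrable A (EFin \o (fun s => f s - g s)).
Proof.
move=> mA i1 i2; apply: eq_integrable (integrableB mA i1 i2) => // s _.
Qed.

Lemma Rintegral_split (f : R -> R) (x y z : R) : x <= y -> y <= z ->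
  mu.-integrable `[x, z] (EFin \o f) ->
  \int[mu]_(s in `[x, z]) f s = \int[mu]_(s in `[x, y]) f s + \int[mu]_(s in `[y, z]) f s.
Proof.
move=> xy yz iF.
rewrite -[\int[mu]_(s in `[y, z]) _]Rintegral_itv_obnd_cbnd; last first.
  apply: integrableS iF => //; apply: subset_itv; rewrite bnd_simp//.
rewrite -(@Rintegral_itvB _ _ (BLeft x) (BRight z) y)//; by rewrite addrC subrK.
Qed.

Lemma measurable_expM (c : R) : measurable_fun setT (fun s : R => expR (c * s)).
Proof.
apply: (@measurableT_comp _ _ _ _ _ _ expR); first exact: measurable_expR.
exact: measurable_funM.
Qed.

(** The continuous functions [x / (x^2 + 1 / (n + 1))] converge to the inverse everywhere, including
    the convention that 0 has inverse 0. *)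
Lemma measurable_inv : measurable_fun setT (@GRing.inv R).
Proof.
have h n (x : R) : 0 < x ^+ 2 + n.+1%:R^-1 by rewrite ltr_wpDl// sqr_ge0.
apply: (@measurable_fun_cvg _ _ _ _ (fun n (x : R) => x / (x ^+ 2 + n.+1%:R^-1))).
  move=> n; apply: continuous_measurable_fun => x.
  apply: cvgM; first exact: cvg_id.
  apply: cvgV; first by rewrite gt_eqF.
  apply: cvgD; last exact: cvg_cst.
  exact: exprn_continuous.
move=> x _; have [->|x0] := eqVneq x 0.
  by under eq_fun do rewrite mul0r; rewrite invr0; exact: cvg_cst.
have -> : x^-1 = x / (x ^+ 2 + 0) by rewrite addr0; field.
apply: cvgM; first exact: cvg_cst.
apply: cvgV; first by rewrite addr0 expf_neq0.
by apply: cvgD; [exact: cvg_cst|exact: cvg_harmonic].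
Qed.

Lemma measurable_ker (L z : R) : measurable_fun setT (fun s : R => (1 - z * expR (L * s))^-1).
Proof.
apply: (@measurableT_comp _ _ _ _ _ _ (@GRing.inv R)); first exact: measurable_inv.
apply: measurable_funB => //; apply: measurable_funM => //; exact: measurable_expM.
Qed.

End compact_integrals.

(** * Charges of centred diagrams and zigzag approximation *)

Section charges.
Context {R : realType} (v : R -> R) (b : R).
Hypotheses (b0 : 0 < b) (v_lip : forall x y, `|v x - v y| <= `|x - y|)
  (v_out : forall s, b <= `|s| -> v s = `|s|).
Notation mu := (@lebesgue_measure R).
Notation sg := (diagram_charge v).

Lemma charge_lip x y : `|sg x - sg y| <= 1 * `|x - y|.
Proof.
rewrite /diagram_charge -mulrBl normrM mul1r (ger0_norm (_ : 0 <= 2^-1))//.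
rewrite ler_pdivrMr// mulr_natr mulr2n.
rewrite (_ : v x - `|x| - (v y - `|y|) = (v x - v y) - (`|x| - `|y|)); last by ring.
rewrite (le_trans (ler_normB _ _))// lerD//; exact: ler_dist_dist.
Qed.

Lemma charge_out s : b <= `|s| -> sg s = 0.
Proof. by move=> /v_out; rewrite /diagram_charge => ->; rewrite subrr mul0r. Qed.

(** Slopes of size at most 1, read from the two ends [- b] and [b], give [v s >= |s|]. *)
Lemma charge_ge0 s : 0 <= sg s.
Proof.
rewrite /diagram_charge divr_ge0// subr_ge0.
have [bs|/ltW sb] := leP b `|s|; first by rewrite v_out.
have vb : v b = b by rewrite v_out ?ger0_norm ?(ltW b0).
have vNb : v (- b) = b by rewrite v_out normrN ger0_norm ?(ltW b0).
have h1 := v_lip b s; have h2 := v_lip s (- b).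
move: sb; rewrite ler_norml => /andP[s1 s2].
move: h1; rewrite (ger0_norm (_ : 0 <= b - s)) ?subr_ge0// vb ler_norml => /andP[_ h1].
move: h2; rewrite (ger0_norm (_ : 0 <= s - - b)) ?vNb; last by rewrite opprK -lerBlDr sub0r.
rewrite ler_norml => /andP[h2 _].
by rewrite ler_norml; apply/andP; split; lra.
Qed.

Lemma charge_continuous : continuous sg.
Proof. exact: (lipschitz_continuous ler01 charge_lip). Qed.

Lemma dcharge_out s : b < `|s| -> derive1 sg s = 0.
Proof.
move=> bs; have cN : {for s, continuous (fun t : R => `|t|)} by exact: norm_continuous.
have nr : \forall t \near s, b < `|t| by exact: (cvgr_gt _ cN).
apply: (@near_cst_derive1 R _ _ 0); apply: filterS nr => t /ltW; exact: charge_out.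
Qed.

Lemma measurable_dcharge : measurable_fun setT (derive1 sg).
Proof. exact: measurable_derive1 charge_continuous. Qed.

Lemma dcharge_le s : `|derive1 sg s| <= 1.
Proof. exact: (derive1_lipschitz_le _ ler01 charge_lip). Qed.

Lemma integrable_dcharge : mu.-integrable setT (EFin \o derive1 sg).
Proof.
apply: (integrable_support measurable_dcharge dcharge_out).
exact: (bounded_integrable_itv _ _ measurable_dcharge dcharge_le).
Qed.

Lemma Rintegral_dcharge : \int[mu]_s derive1 sg s = 0.
Proof.
rewrite (Rintegral_support dcharge_out).
rewrite (lipschitz_FTC _ ler01 charge_lip); last by rewrite -subr_ge0 opprK addr_ge0// ltW.
by rewrite !charge_out ?subrr// ?normrN ger0_norm// ltW.
Qed.

(** A path from [(x, v x)] rising with slope 1 and then falling with slope -1 ends at [(y, v y)]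
    exactly when the descent has this length; the bounds place the turning point in [[x, y]]. *)
Lemma charge_slope x y : x <= y -> 0 <= ((y - x) - (v y - v x)) / 2 <= y - x.
Proof.
move=> xy; have := v_lip y x; rewrite (ger0_norm (_ : 0 <= y - x)) ?subr_ge0//.
by rewrite ler_norml => /andP[h1 h2]; apply/andP; split; lra.
Qed.

Section zigzag.
Variables (L z : R).
Hypotheses (L0 : 0 < L) (z0 : 0 < z) (zb : z * expR (L * b) <= 2^-1).

Lemma measurable_kker : measurable_fun setT (kker L z).
Proof.
apply: measurable_funM => //; apply: measurable_funB => //; exact: measurable_ker.
Qed.

Lemma ker_le s : s <= b -> `|(1 - z * expR (L * s))^-1| <= 2.
Proof.
move=> sb; have /andP[h1 h2] := one_sub_zu L0 z0 zb sb.
have h : 0 < 1 - z * expR (L * s) by apply: lt_le_trans h1.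
by rewrite ger0_norm ?invr_ge0 ?(ltW h)// invf_ple ?posrE.
Qed.

Lemma dcharge_neq0 s : derive1 sg s != 0 -> s <= b.
Proof. exact: support_le dcharge_out. Qed.

Lemma integrable_kker_dcharge :
  mu.-integrable setT (EFin \o (fun s => kker L z s * derive1 sg s)).
Proof.
apply: (@integrable_mul_bounded _ _ _ (L * 3) integrable_dcharge measurable_kker).
move=> s /dcharge_neq0 sb; rewrite /kker normrM ger0_norm ?(ltW L0)//.
rewrite ler_wpM2l ?(ltW L0)// (le_trans (ler_normB _ _))// normr1.
by have := ker_le sb; lra.
Qed.

Lemma charge_cell x y : x <= y -> y <= b ->
  `|\int[mu]_(s in `[x, y]) (kker L z s * derive1 sg s) - kker L z y * (sg y - sg x)|
    <= 2 * L ^+ 2 * (y - x) ^+ 2.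
Proof.
move=> xy yb; rewrite -(lipschitz_FTC xy ler01 charge_lip).
have i1 : mu.-integrable `[x, y] (EFin \o derive1 sg) by apply: integrableS integrable_dcharge.
have i2 : mu.-integrable `[x, y] (EFin \o (fun s => kker L z s * derive1 sg s)).
  by apply: integrableS integrable_kker_dcharge.
have i3 : mu.-integrable `[x, y] (EFin \o (fun s => kker L z y * derive1 sg s)).
  by apply: integrableZl i1.
have i4 : mu.-integrable `[x, y] (EFin \o (fun s => (kker L z s * derive1 sg s) - (kker L z y * derive1 sg s))).
  exact: (integrable_subr _ i2 i3).
rewrite -RintegralZl// -RintegralB//.
have i5 : mu.-integrable `[x, y] (EFin \o cst (2 * L ^+ 2 * (y - x))).
  apply: (@bounded_integrable_itv _ _ `|2 * L ^+ 2 * (y - x)|) => //.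
apply: (le_trans (le_normr_Rintegral _ i4)) => //.
apply: le_trans (_ : \int[mu]_(s in `[x, y]) cst (2 * L ^+ 2 * (y - x)) s <= _).
  apply: le_Rintegral => //; first exact: integrable_norm i4.
  move=> s; rewrite /= in_itv/= => /andP[xs sy].
  rewrite -mulrBl normrM (le_trans (ler_wpM2l _ (dcharge_le s)))// mulr1.
  rewrite (le_trans (kker_lip L0 z0 zb yb (le_trans sy yb)))//.
  rewrite ler_wpM2l ?mulr_ge0 ?exprn_ge0 ?(ltW L0)//.
  by rewrite distrC ger0_norm ?subr_ge0// lerD2l lerN2.
rewrite Rintegral_cst//= lebesgue_measure_itv/= lte_fin.
case: ifPn => [_|]; first by rewrite /= -mulrA -expr2.
rewrite -leNgt => yx; rewrite (@le_anti _ _ y x) ?yx ?xy//.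
by rewrite subrr expr0n !mulr0.
Qed.

(** One tooth of the zigzag. For [x >= 0] the descent [a] is minus the increment of the charge; for
    [y <= 0] it is larger by [y - x], which the terms with [Num.min _ 0] absorb. Cells across 0 are
    excluded because of the kink of [|s|]. The constant 6 covers at most three errors
    [2 L^2 (y - x)^2]. *)
Lemma zigzag_cell x y : x <= y -> y <= b -> (y <= 0) \/ (0 <= x) ->
  `|lker L z y - lker L z (y - ((y - x) - (v y - v x)) / 2)
    - (lker L z (Num.min y 0) - lker L z (Num.min x 0))
    + \int[mu]_(s in `[x, y]) (kker L z s * derive1 sg s)| <= 6 * L ^+ 2 * (y - x) ^+ 2.
Proof.
move=> xy yb yx0.
have /andP[a0 a1] := charge_slope xy.
set a := (_ / 2) in a0 a1 *.
have h1 : `|lker L z y - lker L z (y - a) - kker L z y * a| <= 2 * L ^+ 2 * (y - x) ^+ 2.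
  have := @lker_taylor _ L z b L0 z0 zb (y - a) y.
  rewrite (_ : y - (y - a) = a); last by ring.
  rewrite gerBl.
  move=> /(_ a0 yb)/le_trans; apply.
  by rewrite ler_wpM2l ?mulr_ge0 ?exprn_ge0 ?(ltW L0)// lerXn2r ?nnegrE// subr_ge0.
have h2 := charge_cell xy yb.
set I := (\int[mu]_(s in `[x, y]) _) in h2 *.
move: h1 h2; rewrite !ler_norml => /andP[p1 p2] /andP[p3 p4].
case: yx0 => [y0|x0].
  have x0 : x <= 0 by rewrite (le_trans xy).
  rewrite !min_l//.
  have := lker_taylor L0 z0 zb xy yb; rewrite ler_norml => /andP[p5 p6].
  have aE : kker L z y * a = kker L z y * (y - x) - kker L z y * (sg y - sg x).
    rewrite -mulrBr /diagram_charge (ler0_norm x0) (ler0_norm y0) /a.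
    by congr (_ * _); field.
  by apply/andP; split; lra.
have y0 : 0 <= y by rewrite (le_trans x0).
rewrite !min_r// subrr subr0.
have aE : kker L z y * a = - (kker L z y * (sg y - sg x)).
  rewrite -mulrN /diagram_charge (ger0_norm x0) (ger0_norm y0) /a.
    by congr (_ * _); field.
have : 0 <= L ^+ 2 * (y - x) ^+ 2 by rewrite mulr_ge0// sqr_ge0.
by move=> h; apply/andP; split; lra.
Qed.

(** [2 (n + 1)] cells of length [b / (n + 1)] cover [[- b, b]], and node [n.+1] is exactly 0, so no
    cell straddles the kink and the [lker] terms telescope. *)
Lemma zigzag_sum (n k : nat) (e := fun i : nat => - b + b / n.+1%:R * i%:R) :
  (k <= n.+1 + n.+1)%N ->
  `|lker L z (- b) + \sum_(i < k) (lker L z (e i.+1) -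
      lker L z (e i.+1 - ((e i.+1 - e i) - (v (e i.+1) - v (e i))) / 2))
    - (lker L z (Num.min (e k) 0) - \int[mu]_(s in `[- b, e k]) (kker L z s * derive1 sg s))|
  <= k%:R * (6 * L ^+ 2 * (b / n.+1%:R) ^+ 2).
Proof.
have n0 : 0 < n.+1%:R :> R by [].
have d0 : 0 < b / n.+1%:R by rewrite divr_gt0.
have eS i : e i.+1 - e i = b / n.+1%:R by rewrite /e -natr1; ring.
have en : e n.+1 = 0 by rewrite /e divfK ?gt_eqF// addNr.
have e2n : e (n.+1 + n.+1)%N = b.
  by rewrite /e natrD mulrDr divfK ?gt_eqF// addrA addNr add0r.
have emono i j : (i <= j)%N -> e i <= e j.
  by move=> ij; rewrite /e lerD2l ler_wpM2l ?ler_nat// ltW.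
elim: k => [_|k IH kn].
  have e0 : e 0%N = - b by rewrite /e mulr0 addr0.
  rewrite big_ord0 addr0 mul0r e0 min_l ?oppr_le0 ?(ltW b0)//.
  by rewrite set_itv1 Rintegral_set1 subr0 subrr normr0.
have ek : e k <= e k.+1 by exact: emono.
have ekb : e k.+1 <= b by rewrite -e2n; exact: emono.
have bek : - b <= e k by rewrite -[leLHS](_ : e 0%N = _) ?emono// /e mulr0 addr0.
have side : e k.+1 <= 0 \/ 0 <= e k.
  have [kn'|nk] := leqP k.+1 n.+1; [left|right]; rewrite -en; exact: emono.
have := zigzag_cell ek ekb side; rewrite eS.
have := IH (ltnW kn).
rewrite big_ord_recr/= eS.
have iI : mu.-integrable `[- b, e k.+1] (EFin \o (fun s => kker L z s * derive1 sg s)).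
  by apply: integrableS integrable_kker_dcharge.
rewrite (Rintegral_split bek ek iI) -(natr1 k) (mulrDl k%:R) mul1r !ler_norml.
set S := \sum_(i < k) _; set M1 := lker L z (Num.min (e k.+1) 0).
set M0 := lker L z (Num.min (e k) 0); set I0 := \int[mu]_(s in `[- b, e k]) _.
set I1 := \int[mu]_(s in `[e k, e k.+1]) _; set B1 := lker L z (e k.+1).
set C1 := lker L z (e k.+1 - _); set A := lker L z (- b).
set T := 6 * L ^+ 2 * _; set T' := k%:R * T.
move: S M1 M0 I0 I1 B1 C1 A T T' => S M1 M0 I0 I1 B1 C1 A T T'.
by move=> /andP[p1 p2] /andP[p3 p4]; apply/andP; split; lra.
Qed.

End zigzag.

Lemma expR_lker (L z s : R) : 0 < L -> 0 < z -> z * expR (L * b) <= 2^-1 -> s <= b ->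
  expR (lker L z s) = (1 - z * expR (L * s))^-1.
Proof.
move=> L0 z0 zb sb; have /andP[h1 _] := one_sub_zu L0 z0 zb sb.
by rewrite /lker expRN lnK// posrE (lt_le_trans _ h1).
Qed.

(** The summand [- 1] in [kker] contributes nothing because [derive1 sg] has integral 0. *)
Lemma Rintegral_kker_dcharge (L z : R) : 0 < L -> 0 < z -> z * expR (L * b) <= 2^-1 ->
  \int[mu]_s (kker L z s * derive1 sg s) =
  L * \int[mu]_s ((1 - z * expR (L * s))^-1 * derive1 sg s).
Proof.
move=> L0 z0 zb.
have i1 : mu.-integrable setT (EFin \o (fun s => (1 - z * expR (L * s))^-1 * derive1 sg s)).
  apply: (@integrable_mul_bounded _ _ _ 2 integrable_dcharge (measurable_ker _ _)).
  by move=> s /dcharge_neq0; exact: ker_le.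
rewrite -[RHS]subr0 -(mulr0 L) -Rintegral_dcharge -mulrBr.
rewrite -RintegralB//; last exact: integrable_dcharge.
rewrite -RintegralZl//; last exact: (integrable_subr measurableT i1 integrable_dcharge).
by apply: eq_Rintegral => s _; rewrite /kker; ring.
Qed.

(** At the last node [Num.min b 0 = 0], and [lker L z 0 = - ln (1 - z)] supplies the factor
    [(1 - z)^-1]. The error is [2 (n + 1)] cells times [6 L^2 (b / (n + 1))^2]. *)
Lemma zigzag_atoms (L : R) (n : nat) : 0 < L -> exists s : seq (R * R),
  [/\ atoms_in (expR (L * b)) s, atoms_int (cst 1) s = 1 &
   forall z, 0 < z -> z * expR (L * b) <= 2^-1 ->
   `|ln (atoms_int (fun u => (1 - z * u)^-1) s) -
     (- ln (1 - z) - L * \int[mu]_s ((1 - z * expR (L * s))^-1 * derive1 sg s))|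
     <= 12 * L ^+ 2 * b ^+ 2 / n.+1%:R /\
   0 < atoms_int (fun u => (1 - z * u)^-1) s].
Proof.
move=> L0.
have n0 : 0 < n.+1%:R :> R by [].
pose e (i : nat) := - b + b / n.+1%:R * i%:R.
pose c (i : nat) := e i.+1 - ((e i.+1 - e i) - (v (e i.+1) - v (e i))) / 2.
have e0 : e 0%N = - b by rewrite /e mulr0 addr0.
have e2n : e (n.+1 + n.+1)%N = b.
  by rewrite /e natrD mulrDr divfK ?gt_eqF// addrA addNr add0r.
have emono i j : (i <= j)%N -> e i <= e j.
  by move=> ij; rewrite /e lerD2l ler_wpM2l ?ler_nat// divr_ge0// ltW.
have ec i : e i <= c i <= e i.+1.
  have /andP[h1 h2] := charge_slope (emono i i.+1 (leqnSn i)).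
  by rewrite /c gerBl h1 andbT; lra.
have [||s [s1 s2 s3]] := @atoms_prod R (fun i => expR (L * e i)) (fun i => expR (L * c i)) (n.+1 + n.+1).
- exact: expR_ge0.
- by move=> i; rewrite !ler_expR !ler_pM2l.
exists s; rewrite e2n in s1 s3; split => // z z0 zb.
have zb1 : z * expR (L * b) < 1 by apply: le_lt_trans zb _; rewrite invf_lt1// ltr1n.
rewrite s3 ?(ltW z0)// e0.
have eb i : (i <= n.+1 + n.+1)%N -> e i <= b by move=> h; rewrite -e2n; exact: emono.
have -> : (1 - z * expR (L * - b))^-1 * \prod_(i < n.+1 + n.+1)
      ((1 - z * expR (L * c i)) / (1 - z * expR (L * e i.+1))) =
    expR (lker L z (- b) + \sum_(i < n.+1 + n.+1) (lker L z (e i.+1) - lker L z (c i))).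
  rewrite expRD expR_sum -(expR_lker L0 z0 zb); last by rewrite -e0 eb.
  congr (_ * _); apply: eq_bigr => i _.
  have ei : e i.+1 <= b by apply: eb; exact: ltn_ord.
  have ci : c i <= b by have /andP[_ /le_trans] := ec i; exact.
  by rewrite expRD expRN !(expR_lker L0 z0 zb)// invrK mulrC.
rewrite expR_gt0 expRK; split => //.
have := @zigzag_sum L z L0 z0 zb n (n.+1 + n.+1) (leqnn _).
rewrite -/(e (n.+1 + n.+1)%N) e2n min_r ?(ltW b0)//.
rewrite -(Rintegral_kker_dcharge L0 z0 zb) [X in _ -> `|_ - (_ - X)| <= _](@Rintegral_support _ _ b); last first.
  by move=> t /dcharge_out ->; rewrite mulr0.
rewrite /lker mulr0 expR0 mulr1 => /le_trans; apply.
by rewrite natrD le_eqVlt; apply/orP; left; apply/eqP; field.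
Qed.
End charges.

(** * Moments, and positivity of the growth rate *)

Section moments.
Context {R : realType}.
Notation mu := (@lebesgue_measure R).

Lemma geom_remainder (y rho : R) (n : nat) : 0 <= y <= rho -> rho < 1 ->
  `|(1 - y)^-1 - \sum_(j < n) y ^+ j| <= (1 - rho)^-1 * y ^+ n.
Proof.
move=> /andP[y0 yr] r1.
have h : 0 < 1 - y by rewrite subr_gt0 (le_lt_trans yr).
have -> : (1 - y)^-1 - \sum_(j < n) y ^+ j = (1 - y)^-1 * y ^+ n.
  have := subrX1 y n; set S := \sum_(j < n) _ => E.
  apply: (mulfI (lt0r_neq0 h)); rewrite mulrBr mulVKf ?gt_eqF// divff ?gt_eqF//.
  have -> : (1 - y) * S = - ((y - 1) * S) by ring.
  by rewrite -E; ring.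
rewrite ger0_norm ?mulr_ge0 ?invr_ge0 ?(ltW h) ?exprn_ge0//.
rewrite ler_wpM2r ?exprn_ge0// lef_pV2 ?posrE ?subr_gt0//; last exact: le_lt_trans r1.
by rewrite lerD2l lerN2.
Qed.

Lemma integrable_sumr (n : nat) (f : nat -> R -> R) :
  (forall j, mu.-integrable setT (EFin \o f j)) ->
  mu.-integrable setT (EFin \o (fun s => \sum_(j < n) f j s)) /\
  \int[mu]_s (\sum_(j < n) f j s) = \sum_(j < n) \int[mu]_s f j s.
Proof.
move=> If; elim: n => [|n [IH1 IH2]].
  split; last first.
    rewrite big_ord0; under eq_Rintegral do rewrite big_ord0.
    by rewrite /Rintegral integral0.
  apply: eq_integrable (integrable0 mu setT) => // s _ /=.
  by rewrite big_ord0.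
split.
  apply: eq_integrable (integrableD measurableT IH1 (If n)) => // s _ /=.
  by rewrite big_ord_recr.
rewrite big_ord_recr/= -IH2 -RintegralD//.
by apply: eq_Rintegral => s _; rewrite big_ord_recr.
Qed.

Section kernel_moments.
Variables (L B : R) (phi : R -> R).
Hypotheses (iphi : mu.-integrable setT (EFin \o phi))
  (phiB : forall s, phi s != 0 -> expR (L * s) <= B).

Lemma measurable_mom j : measurable_fun setT (fun s : R => expR (L * s) ^+ j).
Proof. by apply: measurable_funX; exact: measurable_expM. Qed.

Lemma integrable_mom j : mu.-integrable setT (EFin \o (fun s => expR (L * s) ^+ j * phi s)).
Proof.
apply: (@integrable_mul_bounded _ _ _ (B ^+ j) iphi (measurable_mom j)) => s /phiB uB.
rewrite ger0_norm ?exprn_ge0 ?expR_ge0// lerXn2r ?nnegrE ?expR_ge0//.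
exact: le_trans uB.
Qed.

Lemma ker_bound (z rho : R) s : 0 <= z -> z * B <= rho -> rho < 1 -> phi s != 0 ->
  0 <= z * expR (L * s) <= rho.
Proof.
move=> z0 zB r1 /phiB uB; rewrite mulr_ge0 ?expR_ge0//= (le_trans _ zB)//.
by rewrite ler_wpM2l.
Qed.

Lemma integrable_kermom (z rho : R) : 0 <= z -> z * B <= rho -> rho < 1 ->
  mu.-integrable setT (EFin \o (fun s => (1 - z * expR (L * s))^-1 * phi s)).
Proof.
move=> z0 zB r1.
apply: (@integrable_mul_bounded _ _ _ (1 - rho)^-1 iphi (measurable_ker _ _)) => s p0.
have /andP[h1 h2] := ker_bound z0 zB r1 p0.
have h : 0 < 1 - z * expR (L * s) by rewrite subr_gt0 (le_lt_trans h2).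
rewrite ger0_norm ?invr_ge0 ?(ltW h)// lef_pV2 ?posrE ?subr_gt0 ?(le_lt_trans h2)//.
by rewrite lerD2l lerN2.
Qed.

Lemma moment_remainder (z rho : R) (n : nat) : 0 <= z -> z * B <= rho -> rho < 1 ->
  `|\int[mu]_s ((1 - z * expR (L * s))^-1 * phi s) -
    \sum_(j < n) (\int[mu]_s (expR (L * s) ^+ j * phi s)) * z ^+ j| <=
  (1 - rho)^-1 * (\int[mu]_s `|phi s|) * (B * z) ^+ n.
Proof.
move=> z0 zB r1.
pose f j s := z ^+ j * (expR (L * s) ^+ j * phi s).
have fi j : mu.-integrable setT (EFin \o f j).
  exact: (integrableZl measurableT (z ^+ j) (integrable_mom j)).
have [If IfE] := integrable_sumr n fi.
rewrite (_ : \sum_(j < n) _ = \int[mu]_s (\sum_(j < n) f j s)); last first.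
  rewrite IfE; apply: eq_bigr => j _; rewrite /f RintegralZl//; last exact: integrable_mom.
  by rewrite mulrC.
have ik := integrable_kermom z0 zB r1.
rewrite -RintegralB//.
have id := integrable_subr measurableT ik If.
apply: (le_trans (le_normr_Rintegral measurableT id)).
have inrm : mu.-integrable setT (EFin \o (fun s => `|phi s|)) by exact: integrable_norm iphi.
have iC : mu.-integrable setT (EFin \o (fun s => ((1 - rho)^-1 * (B * z) ^+ n) * `|phi s|)).
  exact: (integrableZl measurableT _ inrm).
rewrite [leRHS](_ : _ = \int[mu]_s (((1 - rho)^-1 * (B * z) ^+ n) * `|phi s|)); last first.
  by rewrite RintegralZl//; ring.
apply: le_Rintegral => //; first exact: integrable_norm id.
move=> s _.
have -> : (1 - z * expR (L * s))^-1 * phi s - \sum_(j < n) f j s =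
   ((1 - z * expR (L * s))^-1 - \sum_(j < n) (z * expR (L * s)) ^+ j) * phi s.
  rewrite mulrBl mulr_suml; congr (_ - _); apply: eq_bigr => j _.
  by rewrite /f exprMn mulrA.
rewrite normrM; have [->|p0] := eqVneq (phi s) 0; first by rewrite normr0 !mulr0.
rewrite ler_wpM2r//; have hb := ker_bound z0 zB r1 p0.
apply: (le_trans (geom_remainder n hb r1)).
rewrite ler_wpM2l ?invr_ge0 ?subr_ge0 ?(ltW r1)//.
have /andP[h1 h2] := hb.
rewrite lerXn2r ?nnegrE// ?mulr_ge0//; last by rewrite mulrC ler_wpM2r// phiB.
by rewrite (le_trans (expR_ge0 (L * s)))// phiB.
Qed.

Lemma psum_integral (r rho : R) : 0 <= B -> r * B <= rho -> rho < 1 ->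
  (forall j, 0 <= \int[mu]_s (expR (L * s) ^+ j * phi s)) ->
  psum r (fun j => \int[mu]_s (expR (L * s) ^+ j * phi s))
    (fun z => \int[mu]_s ((1 - z * expR (L * s))^-1 * phi s)).
Proof.
move=> B0 rB r1 c0; split => // z /andP[z0 zr].
have zB : z * B <= rho by rewrite (le_trans _ rB)// ler_wpM2r.
have bz0 : 0 <= B * z by rewrite mulr_ge0.
have bz1 : `|B * z| < 1 by rewrite ger0_norm// mulrC (le_lt_trans zB).
set C := (1 - rho)^-1 * \int[mu]_s `|phi s|.
have H : C * (B * z) ^+ n @[n --> \oo] --> 0.
  rewrite -(mulr0 C); apply: cvgM; first exact: cvg_cst.
  exact: cvg_expr.
apply/cvgrPdist_le => e e0; move/cvgr0Pnorm_le : H => /(_ e e0).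
apply: filterS => n Hn; apply: (le_trans (moment_remainder n z0 zB r1)).
exact: le_trans (ler_norm _) Hn.
Qed.

Lemma moment_poly (P : {poly R}) : \int[mu]_s (phi s * P.[expR (L * s)]) =
  \sum_(j < size P) P`_j * \int[mu]_s (expR (L * s) ^+ j * phi s).
Proof.
pose f j s := P`_j * (expR (L * s) ^+ j * phi s).
have fi j : mu.-integrable setT (EFin \o f j).
  exact: (integrableZl measurableT _ (integrable_mom j)).
have [_ If] := integrable_sumr (size P) fi.
transitivity (\int[mu]_s \sum_(j < size P) f j s).
  apply: eq_Rintegral => s _; rewrite horner_coef mulr_sumr.
  by apply: eq_bigr => j _; rewrite /f; ring.
by rewrite If; apply: eq_bigr => j _; rewrite RintegralZl//; exact: integrable_mom.
Qed.

End kernel_moments.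

Lemma atoms_remainder (s : seq (R * R)) (B z rho : R) (n : nat) :
  atoms_in B s -> 0 <= z -> z * B <= rho -> rho < 1 ->
  `|atoms_int (fun u => (1 - z * u)^-1) s -
    \sum_(j < n) atoms_int (fun u => u ^+ j) s * z ^+ j| <=
  (1 - rho)^-1 * atoms_int (cst 1) s * (B * z) ^+ n.
Proof.
move=> sB z0 zB r1; rewrite /atoms_int.
under [X in _ - X]eq_bigr do rewrite mulr_suml.
rewrite exchange_big/= -sumrB (le_trans (ler_norm_sum _ _ _))//.
rewrite mulr_sumr mulr_suml big_seq [leRHS]big_seq; apply: ler_sum => x xs.
have [x0 /andP[u0 uB]] := sB x xs.
have hb : 0 <= z * x.2 <= rho by rewrite mulr_ge0//= (le_trans _ zB)// ler_wpM2l.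
have -> : x.1 * (1 - z * x.2)^-1 - \sum_(i < n) x.1 * x.2 ^+ i * z ^+ i =
    x.1 * ((1 - z * x.2)^-1 - \sum_(i < n) (z * x.2) ^+ i).
  rewrite mulrBr mulr_sumr; congr (_ - _); apply: eq_bigr => i _.
  by rewrite exprMn; ring.
rewrite normrM (ger0_norm x0) /cst mulr1 -[leRHS]mulrA mulrCA ler_wpM2l//.
apply: (le_trans (geom_remainder n hb r1)).
rewrite ler_wpM2l ?invr_ge0 ?subr_ge0 ?(ltW r1)//.
rewrite lerXn2r ?nnegrE ?mulr_ge0//; first exact: le_trans uB.
by rewrite mulrC ler_wpM2r.
Qed.

Lemma atoms_int_poly (s : seq (R * R)) (P : {poly R}) :
  atoms_int (horner P) s = \sum_(j < size P) P`_j * atoms_int (fun u => u ^+ j) s.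
Proof.
rewrite /atoms_int; under [RHS]eq_bigr do rewrite mulr_sumr.
rewrite exchange_big/=; apply: eq_bigr => x _; rewrite horner_coef mulr_sumr.
by apply: eq_bigr => j _; ring.
Qed.

(** By the equation, the transform of [g] is the limit of the transforms of the zigzag measures
    [sn n]. Hence their moments converge to those of [g], and [g] integrates every polynomial
    nonnegative on [[0, B]] to a nonnegative number. *)
Lemma charge_growth_ae_ge0 (v g : R -> R) (b L zs : R) : 0 < b -> 0 < L -> 0 < zs ->
  (forall x y, `|v x - v y| <= `|x - y|) -> (forall s, b <= `|s| -> v s = `|s|) ->
  mu.-integrable setT (EFin \o g) -> (forall s, b < `|s| -> g s = 0) ->
  (forall z, 0 < z < zs -> \int[mu]_s ((1 - z * expR (L * s))^-1 * g s) =
    (1 - z)^-1 * expR (- (L * \int[mu]_s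
      ((1 - z * expR (L * s))^-1 * derive1 (diagram_charge v) s)))) ->
  {ae mu, forall s, 0 <= g s}.
Proof.
move=> b0 L0 zs0 vl vo ig gb eqn.
apply: (interval_pos_ae ig); apply: (@poly_pos_interval R g L b L0 ig gb) => P P0.
set B := expR (L * b) in P0.
have B0 : 0 < B by exact: expR_gt0.
have B1 : 1 < B by rewrite expR_gt1 mulr_gt0.
have gB s : g s != 0 -> expR (L * s) <= B by exact: support_expR_le.
have [sn Hs] := choice (fun n => zigzag_atoms b0 vl vo n L0).
pose d n k := atoms_int (fun u => u ^+ k) (sn n) - \int[mu]_s (expR (L * s) ^+ k * g s).
pose H z := \int[mu]_s ((1 - z * expR (L * s))^-1 * g s).
pose Dn n z := atoms_int (fun u => (1 - z * u)^-1) (sn n) - H z.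
(* Below [zs] the equation holds; below [2^-1 / B] the geometric expansions on [[0, B]] have ratio
   at most 1/2. *)
pose zt := Num.min zs (2^-1 / B).
have zt0 : 0 < zt by rewrite lt_min zs0 divr_gt0// invr_gt0.
have half : 2^-1 < 1 :> R by rewrite invf_lt1// ltr1n.
pose C := (1 - 2^-1)^-1 * 1 + (1 - 2^-1)^-1 * \int[mu]_s `|g s|.
have ztB z : z < zt -> z * B <= 2^-1.
  by rewrite lt_min => /andP[_ /ltW]; rewrite ler_pdivlMr.
have dk : forall k, d n k @[n --> \oo] --> 0.
  apply: (@coef_cvg0 R d Dn C B zt) => //; [|exact: ltW|move=> n k z /andP[z0 zzt]|move=> z /andP[z0 zzt]].
  - rewrite /C addr_ge0// ?mulr_ge0// ?invr_ge0 ?subr_ge0 ?(ltW half)//.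
    by apply: Rintegral_ge0.
  - have [s1 s2 _] := Hs n.
    have h1 := atoms_remainder k.+1 s1 (ltW z0) (ztB _ zzt) half.
    have h2 := moment_remainder ig gB k.+1 (ltW z0) (ztB _ zzt) half.
    rewrite /Dn /d (_ : \sum_(j < k.+1) _ = \sum_(j < k.+1) atoms_int (fun u => u ^+ j) (sn n) * z ^+ j
       - \sum_(j < k.+1) (\int[mu]_s (expR (L * s) ^+ j * g s)) * z ^+ j); last first.
      by rewrite -sumrB; apply: eq_bigr => j _; rewrite mulrBl.
    rewrite s2 in h1.
    rewrite [X in `|X|](_ : _ = (atoms_int (fun u => (1 - z * u)^-1) (sn n) -
       \sum_(j < k.+1) atoms_int (fun u => u ^+ j) (sn n) * z ^+ j) -
       (H z - \sum_(j < k.+1) (\int[mu]_s (expR (L * s) ^+ j * g s)) * z ^+ j)); last by ring.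
    by rewrite (le_trans (ler_normB _ _))// /C mulrDl lerD.
  - have zB := ztB _ zzt.
    pose E := - ln (1 - z) - L * \int[mu]_s ((1 - z * expR (L * s))^-1 * derive1 (diagram_charge v) s).
    have z1 : 0 < 1 - z.
      rewrite subr_gt0 (lt_le_trans _ (ltW half))//.
      by apply: lt_le_trans zB; rewrite ltr_pMr.
    have HE : H z = expR E.
      rewrite /H eqn; last by move: zzt; rewrite lt_min z0 => /andP[].
      by rewrite /E expRD (expRN (ln _)) lnK ?posrE.
    have lnc : ln (atoms_int (fun u => (1 - z * u)^-1) (sn n)) @[n --> \oo] --> E.
      have c0 : 12 * L ^+ 2 * b ^+ 2 / n.+1%:R @[n --> \oo] --> (0 : R).
        rewrite -(mulr0 (12 * L ^+ 2 * b ^+ 2)); apply: cvgM; first exact: cvg_cst.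
        exact: cvg_harmonic.
      apply/cvgrPdist_le => e e0; move/cvgr0Pnorm_le : c0 => /(_ e e0).
      apply: filterS => n Hn; have [_ _ /(_ z z0 zB)[h _]] := Hs n.
      by rewrite distrC (le_trans h)// (le_trans (ler_norm _) Hn).
    rewrite -(subrr (H z)); apply: cvgB; last exact: cvg_cst.
    rewrite HE.
    have -> : (fun n => atoms_int (fun u => (1 - z * u)^-1) (sn n)) =
        (fun n => expR (ln (atoms_int (fun u => (1 - z * u)^-1) (sn n)))).
      apply/funext => n; have [_ _ /(_ z z0 zB)[_ h]] := Hs n.
      by rewrite lnK.
    by apply: (cvg_comp _ _ lnc); exact: continuous_expR.
have cv : atoms_int (horner P) (sn n) @[n --> \oo] --> \int[mu]_s (g s * P.[expR (L * s)]).
  rewrite (moment_poly ig gB); under eq_fun do rewrite atoms_int_poly.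
  apply: cvgr_sum => j; apply: cvgM; first exact: cvg_cst.
  rewrite -[X in _ --> X]add0r; have := dk j => h.
  rewrite (_ : (fun n => _) = (fun n => d n j + \int[mu]_s (expR (L * s) ^+ j * g s))); last first.
    by apply/funext => n; rewrite /d subrK.
  by apply: cvgD => //; exact: cvg_cst.
rewrite -(cvg_lim _ cv)//; apply: limr_ge; first by apply/cvg_ex; eexists; exact: cv.
apply: nearW => n; rewrite /atoms_int big_seq sumr_ge0// => x xs.
have [s1 _ _] := Hs n; have [x0 xB] := s1 x xs.
by rewrite mulr_ge0// P0.
Qed.

End moments.

(** * Integration by parts, differentiation under the integral, joint measurability *)

Section integration_by_parts_lipschitz.
Context {R : realType}.
Notation mu := (@lebesgue_measure R).

Lemma clamp_lip (b x y : R) :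
  `|Num.max (- b) (Num.min b x) - Num.max (- b) (Num.min b y)| <= `|x - y|.
Proof.
wlog xy : x y / x <= y.
  move=> W; have [xy|/ltW yx] := leP x y; first exact: W.
  by rewrite distrC [leRHS]distrC; apply: W.
rewrite [leRHS]distrC (ger0_norm (_ : 0 <= y - x)) ?subr_ge0//.
rewrite ler_norml /Num.max /Num.min.
by case: (ltP b x) => h1; case: (ltP b y) => h2; do 2?(case: ltP => ?);
  apply/andP; split; lra.
Qed.

(** [phi] is controlled only on [[- b, b]], as a kernel may have a pole beyond. Composing it with
    the clamp onto that interval makes its product with [sg] globally Lipschitz and changes nothing
    where [sg] lives. The derivative of the product integrates to 0 since [sg] vanishes at both
    ends. *)
Lemma lipschitz_IBP (sg phi psi : R -> R) (b C F : R) : 0 < b -> 0 <= C ->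
  (forall x y, `|sg x - sg y| <= 1 * `|x - y|) -> (forall s, b <= `|s| -> sg s = 0) ->
  (forall x y, `|x| <= b -> `|y| <= b -> `|phi x - phi y| <= C * `|x - y|) ->
  (forall x, `|x| <= b -> `|phi x| <= F) ->
  (forall s : R, `|s| < b -> is_derive s 1 phi (psi s)) ->
  measurable_fun setT phi -> measurable_fun setT psi ->
  (forall s, `|s| < b -> `|psi s| <= C) ->
  \int[mu]_s (phi s * derive1 sg s) = - \int[mu]_s (psi s * sg s).
Proof.
move=> b0 C0 sgl sgo phil phiF dphi mphi mpsi psiC.
have bb : - b < b by rewrite -subr_gt0 opprK addr_gt0.
have F0 : 0 <= F by apply: le_trans (phiF 0 _) => //; rewrite normr0 ltW.
pose cl s := Num.max (- b) (Num.min b s).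
have clb s : `|cl s| <= b.
  rewrite ler_norml /cl le_max lexx/= ge_max ge_min lexx andbT.
  by rewrite (ltW bb).
have clid s : `|s| <= b -> cl s = s.
  rewrite ler_norml => /andP[h1 h2]; rewrite /cl (min_r h2) (max_r h1)//.
have sgb s : `|sg s| <= 2 * b.
  have [bs|/ltW sb] := leP b `|s|; first by rewrite sgo// normr0 mulr_ge0// ltW.
  have sgb0 : sg b = 0 by apply: sgo; rewrite ger0_norm// ltW.
  have := sgl s b; rewrite sgb0 subr0 mul1r => /le_trans; apply.
  rewrite (le_trans (ler_normB _ _))// (ger0_norm (ltW b0)).
  by rewrite mulr_natl mulr2n lerD2r.
pose f s := sg s * phi (cl s).
have fl x y : `|f x - f y| <= (F + 2 * b * C) * `|x - y|.
  rewrite /f (_ : _ - _ = (sg x - sg y) * phi (cl x) + sg y * (phi (cl x) - phi (cl y))); last by ring.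
  rewrite (le_trans (ler_normD _ _))// !normrM mulrDl lerD//.
    rewrite mulrC ler_pM//; first exact: phiF.
    by rewrite -[leRHS]mul1r sgl.
  rewrite -mulrA ler_pM//.
  by rewrite (le_trans (phil _ _ (clb _) (clb _)))// ler_wpM2l// clamp_lip.
have K0 : 0 <= F + 2 * b * C by rewrite addr_ge0// !mulr_ge0// ltW.
have := lipschitz_FTC (ltW bb) K0 fl.
rewrite /f !sgo ?normrN ?ger0_norm ?(ltW b0)// !mul0r subrr => ftc.
have csg := lipschitz_continuous ler01 sgl.
have msg' := measurable_derive1 csg.
have msg : measurable_fun setT sg by exact: continuous_measurable_fun.
have sg'le s := derive1_lipschitz_le s ler01 sgl.
have sg'0 s : b < `|s| -> derive1 sg s = 0.
  move=> bs.
  have nr : \forall t \near s, cst 0 t = sg t.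
    have : \forall t \near s, b < `|t|.
      have cN : {for s, continuous (fun t : R => `|t|)} by exact: norm_continuous.
      exact: (cvgr_gt _ cN).
    by apply: filterS => t /ltW/sgo ->.
  have d0 : is_derive s 1 (cst 0 : R -> R) 0 by exact: is_derive_cst.
  by have d1 := near_eq_is_derive nr d0; rewrite derive1E derive_val.
have isg' : mu.-integrable setT (EFin \o derive1 sg).
  by apply: (integrable_support msg' sg'0); exact: bounded_integrable_itv msg' sg'le.
have isg : mu.-integrable setT (EFin \o sg).
  apply: (@integrable_support _ _ b msg) => [s /ltW/sgo//|].
  exact: bounded_integrable_itv msg sgb.
have i1 : mu.-integrable setT (EFin \o (fun s => phi s * derive1 sg s)).
  apply: (@integrable_mul_bounded _ _ _ F isg' mphi) => s h; apply: phiF.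
  by rewrite leNgt; apply/negP => /sg'0 h0; rewrite h0 eqxx in h.
have i2 : mu.-integrable setT (EFin \o (fun s => psi s * sg s)).
  apply: (@integrable_mul_bounded _ _ _ C isg mpsi) => s h; apply: psiC.
  by rewrite ltNge; apply/negP => /sgo h0; rewrite h0 eqxx in h.
apply/eqP; rewrite -subr_eq0 opprK -RintegralD//; apply/eqP.
rewrite (@Rintegral_support _ _ b); last first.
  by move=> s bs; rewrite sg'0// sgo ?(ltW bs)// !mulr0 addr0.
rewrite -ftc.
have i12 : mu.-integrable setT (EFin \o (fun s => phi s * derive1 sg s + psi s * sg s)).
  by apply: eq_integrable (integrableD measurableT i1 i2) => // s _.
have cf := lipschitz_continuous K0 fl.
have mf' := measurable_derive1 cf.
have if' : mu.-integrable `[- b, b] (EFin \o derive1 f).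
  by apply: (bounded_integrable_itv _ _ mf') => x; exact: (derive1_lipschitz_le _ K0 fl).
have i12' (A : set (measurableTypeR R)) : measurable A -> mu.-integrable A (EFin \o (fun s => phi s * derive1 sg s + psi s * sg s)).
  by move=> mA; apply: integrableS i12.
rewrite -[LHS]Rintegral_itv_obnd_cbnd; last exact: i12'.
rewrite -[LHS]Rintegral_itv_bndo_bndc; last exact: i12'.
rewrite -[RHS]Rintegral_itv_obnd_cbnd; last by apply: integrableS if' => //; exact: subset_itv_oc_cc.
rewrite -[RHS]Rintegral_itv_bndo_bndc; last by apply: integrableS if' => //; exact: subset_itv_oo_cc.
rewrite /Rintegral; congr fine.
have [g [_ _ gae]] := lipschitz_ae_derive bb ler01 sgl.
apply: ae_eq_integral => //.
- by have /integrableP[] := i12' `]- b, b[%classic (measurable_itv _).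
- by apply/measurable_EFinP; exact: measurable_funTS.
- apply: filterS gae; first exact: (ae_filter_ringOfSetsType mu).
  move=> s /= H sb; have [dsg _] := H sb; congr EFin.
  have sb' : `|s| < b by move: sb; rewrite in_itv/= -ltr_norml.
  have nr : \forall t \near s, sg t * phi t = f t.
    have : \forall t \near s, `|t| < b.
      have cN : {for s, continuous (fun t : R => `|t|)} by exact: norm_continuous.
      exact: (cvgr_lt _ cN).
    by apply: filterS => t /ltW tb; rewrite /f clid.
  have dsg1 : is_derive s 1 sg (derive1 sg s) by split => //; rewrite derive1E.
  have dM := is_deriveM dsg1 (dphi _ sb').
  have df := near_eq_is_derive nr dM.
  by rewrite [in RHS]derive1E derive_val /GRing.scale/=; ring.
Qed.

(** A remainder quadratic in the increment, uniform where [phi] is nonzero, takes the place of a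
    domination argument. *)
Lemma derive_integral (phi : R -> R) (F : R -> R -> R) (G : R -> R) (t C d : R) :
  0 < d -> 0 <= C -> mu.-integrable setT (EFin \o phi) ->
  (forall y, `|y| < d -> mu.-integrable setT (EFin \o (fun s => F (t + y) s * phi s))) ->
  mu.-integrable setT (EFin \o (fun s => G s * phi s)) ->
  (forall y s, `|y| < d -> phi s != 0 -> `|F (t + y) s - F t s - y * G s| <= C * y ^+ 2) ->
  is_derive t 1 (fun y => \int[mu]_s (F y s * phi s)) (\int[mu]_s (G s * phi s)).
Proof.
move=> d0 C0 iphi iF iG H.
set I := (fun y => _).
suff H1 : diff_quotient I h t @[h --> 0^'] --> \int[mu]_s (G s * phi s).
  have dI : derivable I t 1 by apply/derivable_cvgP/cvg_ex; eexists; exact: H1.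
  by split => //; rewrite -derive1E; apply: cvg_unique (derive1_cvg dI) H1.
have inrm : mu.-integrable setT (EFin \o (fun s => `|phi s|)) by exact: integrable_norm iphi.
pose K := C * \int[mu]_s `|phi s|.
have K0 : 0 <= K by rewrite mulr_ge0// Rintegral_ge0.
have iF0 : mu.-integrable setT (EFin \o (fun s => F t s * phi s)).
  by have := iF 0; rewrite normr0 addr0; apply.
have B y : y != 0 -> `|y| < d -> `|diff_quotient I y t - \int[mu]_s (G s * phi s)| <= K * `|y|.
  move=> y0 yd; rewrite /diff_quotient /I.
  have i1 := iF y yd.
  have iyG : mu.-integrable setT (EFin \o (fun s => y * (G s * phi s))) by exact: (integrableZl measurableT y iG).
  have i2 := integrable_subr measurableT i1 iF0.
  have i3 := integrable_subr measurableT i2 iyG.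
  have -> : y^-1 * (\int[mu]_s (F (t + y) s * phi s) - \int[mu]_s (F t s * phi s)) -
      \int[mu]_s (G s * phi s) = y^-1 * \int[mu]_s (F (t + y) s * phi s - F t s * phi s - y * (G s * phi s)).
    rewrite RintegralB// RintegralB// RintegralZl//.
    by field.
  rewrite normrM normfV ler_pdivrMl ?normr_gt0//.
  apply: (le_trans (le_normr_Rintegral measurableT i3)).
  have iC : mu.-integrable setT (EFin \o (fun s => C * y ^+ 2 * `|phi s|)) by exact: (integrableZl measurableT _ inrm).
  rewrite [leRHS](_ : _ = \int[mu]_s (C * y ^+ 2 * `|phi s|)); last first.
    rewrite RintegralZl// /K -(real_normK (num_real y)); ring.
  apply: le_Rintegral => //; first exact: integrable_norm i3.
  move=> s _; have [->|p0] := eqVneq (phi s) 0; first by rewrite !mulr0 !subr0 normr0 mulr0.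
  rewrite (_ : _ - _ - _ = (F (t + y) s - F t s - y * G s) * phi s); last by ring.
  by rewrite normrM ler_wpM2r// H.
have ycv (c : R) : 0 < c -> \forall y \near (0 : R)^', `|y| < c.
  by move=> c0; exists c => // x /=; rewrite sub0r normrN.
apply/cvgrPdist_le => e e0; near=> y.
rewrite distrC; have y0 : y != 0 by near: y; exact: nbhs_dnbhs_neq.
apply: (le_trans (B y y0 _)); first by near: y; exact: ycv.
have : `|y| < e / (K + 1) by near: y; apply: ycv; rewrite divr_gt0// ltr_wpDl.
rewrite ltr_pdivlMr ?ltr_wpDl// => /ltW; apply: le_trans.
by rewrite mulrC ler_wpM2l// lerDl.
Unshelve. all: by end_near. Qed.

(** Rounding the first argument down to a grid of mesh [1 / (n + 1)] cuts the plane into countably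
    many strips, on each of which only the second argument matters; the Lipschitz bound gives
    pointwise convergence. *)
Lemma measurable_caratheodory (f : R -> R -> R) (C : R) :
  (forall t x y, `|f x t - f y t| <= C * `|x - y|) ->
  (forall s, measurable_fun setT (f s)) ->
  measurable_fun setT (fun p : R * R => f p.1 p.2).
Proof.
move=> fl mf.
pose a (n : nat) (s : R) : R := (Num.floor (n.+1%:R * s))%:~R / n.+1%:R.
apply: (@measurable_fun_cvg _ _ _ _ (fun n (p : R * R) => f (a n p.1) p.2)).
  move=> n _ Y mY; rewrite setTI.
  have n0 : 0 < n.+1%:R :> R by [].
  have -> : (fun p : R * R => f (a n p.1) p.2) @^-1` Y = \bigcup_(k : int)
     ([set s : R | (k%:~R / n.+1%:R <= s < (k + 1)%:~R / n.+1%:R)] `*` (f (k%:~R / n.+1%:R) @^-1` Y)).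
    apply/seteqP; split => [[s t] /= fY|[s t] [k _ [/= /andP[k1 k2] fY]]].
      exists (Num.floor (n.+1%:R * s)) => //; split => //=.
      rewrite ler_pdivrMr// mulrC floor_le//= ltr_pdivlMr// mulrC.
      exact: floorD1_gt.
    rewrite /a /= (_ : Num.floor _ = k)//; apply: floor_def.
    by rewrite mulrC -ler_pdivrMr// k1/= -ltr_pdivlMr.
  apply: countable_bigcupT_measurable => // k; apply: measurableX.
    rewrite (_ : [set _ | _] = `[k%:~R / n.+1%:R, (k + 1)%:~R / n.+1%:R[%classic)//.
  by rewrite -[X in measurable X]setTI; exact: mf.
move=> [s t] _ /=.
have C0 : 0 <= C by have := le_trans (normr_ge0 _) (fl 0 1 0); rewrite subr0 normr1 mulr1.
have h0 : C * n.+1%:R^-1 @[n --> \oo] --> (0 : R).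
  by rewrite -(mulr0 C); apply: cvgM; [exact: cvg_cst|exact: cvg_harmonic].
apply/cvgrPdist_le => e e0; move/cvgr0Pnorm_le : h0 => /(_ e e0).
apply: filterS => n Hn; have n0 : 0 < n.+1%:R :> R by [].
rewrite (le_trans (fl _ _ _))// (le_trans _ (le_trans (ler_norm _) Hn))// ler_wpM2l//.
have h1 : a n s <= s by rewrite /a ler_pdivrMr// mulrC floor_le.
rewrite ger0_norm ?subr_ge0// lerBlDl -[leLHS](mulfK (lt0r_neq0 n0)) -[X in _ + X]mul1r.
rewrite /a -mulrDl ler_wpM2r ?invr_ge0// mulrC ltW//.
by have := floorD1_gt (n.+1%:R * s); rewrite intrD.
Qed.

End integration_by_parts_lipschitz.

(** * The transform of a charge as a power series *)

Section charge_transform.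
Context {R : realType} (v : R -> R) (b : R).
Hypotheses (b0 : 0 < b) (v_lip : forall x y, `|v x - v y| <= `|x - y|)
  (v_out : forall s, b <= `|s| -> v s = `|s|).
Notation mu := (@lebesgue_measure R).
Notation sg := (diagram_charge v).

Lemma expR_lip (c x y : R) : 0 <= c -> `|x| <= b -> `|y| <= b ->
  `|expR (c * x) - expR (c * y)| <= c * expR (c * b) * `|x - y|.
Proof.
wlog xy : x y / x <= y.
  move=> W c0 xb yb; have [xy|/ltW yx] := leP x y; first exact: W.
  by rewrite distrC [`|x - y|]distrC; exact: W.
move=> c0 xb yb; move: xy; rewrite le_eqVlt => /predU1P[->|xy].
  by rewrite !subrr normr0 mulr0.
have d (s : R) : is_derive s 1 (fun s => expR (c * s)) (c * expR (c * s)).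
  apply: is_derive_eq; rewrite /GRing.scale/=.
  by rewrite !(mulr0, addr0, mulr1, add0r); ring.
have cts : {within `[x, y], continuous (fun s => expR (c * s))}.
  apply: continuous_subspaceT => s.
  apply: differentiable_continuous; apply/derivable1_diffP.
  by have h := d s; exact: ex_derive.
have [e] := @MVT _ (fun s => expR (c * s)) (fun s => c * expR (c * s)) _ _ xy (fun s _ => d s) cts.
rewrite in_itv/= => /andP[_ ey] E.
rewrite distrC E normrM distrC ler_wpM2r// ger0_norm ?mulr_ge0 ?expR_ge0//.
rewrite ler_wpM2l// ler_expR ler_wpM2l//.
by rewrite (le_trans (ltW ey))// (le_trans (ler_norm _)).
Qed.

Lemma measurable_charge : measurable_fun setT sg.
Proof. exact: continuous_measurable_fun (charge_continuous v_lip). Qed.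

Lemma charge_le s : `|sg s| <= 2 * b.
Proof.
have [bs|/ltW sb] := leP b `|s|; first by rewrite (charge_out v_out)// normr0 mulr_ge0// ltW.
have sgb0 : sg b = 0 by apply: (charge_out v_out); rewrite ger0_norm// ltW.
have := charge_lip v_lip s b; rewrite sgb0 subr0 mul1r => /le_trans; apply.
rewrite (le_trans (ler_normB _ _))// (ger0_norm (ltW b0)).
by rewrite mulr_natl mulr2n lerD2r.
Qed.

Lemma integrable_charge : mu.-integrable setT (EFin \o sg).
Proof.
apply: (@integrable_support _ _ b measurable_charge) => [s /ltW/(charge_out v_out)//|].
exact: bounded_integrable_itv measurable_charge charge_le.
Qed.

Lemma dcharge_moment (c : R) : 0 <= c ->
  \int[mu]_s (expR (c * s) * derive1 sg s) = - \int[mu]_s (c * expR (c * s) * sg s).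
Proof.
move=> c0.
apply: (@lipschitz_IBP R sg _ (fun s => c * expR (c * s)) b (c * expR (c * b)) (expR (c * b))) => //.
- by rewrite mulr_ge0// expR_ge0.
- exact: charge_lip.
- exact: charge_out.
- by move=> x y xb yb; exact: expR_lip.
- move=> x xb; rewrite ger0_norm ?expR_ge0// ler_expR ler_wpM2l//.
  by rewrite (le_trans (ler_norm _)).
- move=> s _; apply: is_derive_eq; rewrite /GRing.scale/=.
  by rewrite !(mulr0, addr0, mulr1, add0r); ring.
- exact: measurable_expM.
- by apply: measurable_funM => //; exact: measurable_expM.
- move=> s sb; rewrite ger0_norm ?mulr_ge0 ?expR_ge0// ler_wpM2l// ler_expR ler_wpM2l//.
  by rewrite (le_trans (ler_norm _))// ltW.
Qed.

(** Integration by parts moves the derivative onto the exponential, and the charge is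
    nonnegative. *)
Lemma dcharge_moment_le0 (L : R) (j : nat) : 0 < L ->
  \int[mu]_s (expR (L * s) ^+ j * derive1 sg s) <= 0.
Proof.
move=> L0; have -> : (fun s => expR (L * s) ^+ j * derive1 sg s) = (fun s => expR (j%:R * L * s) * derive1 sg s).
  by apply/funext => s; rewrite -mulrA expRM_natl.
rewrite dcharge_moment ?mulr_ge0 ?(ltW L0)// oppr_le0; apply: Rintegral_ge0 => s _.
apply: mulr_ge0; last exact: (charge_ge0 b0 v_lip v_out).
by rewrite !mulr_ge0 ?expR_ge0 ?(ltW L0).
Qed.

Lemma psum_geometric (r : R) : r < 1 -> psum_like r (fun z : R => (1 - z)^-1).
Proof.
move=> r1; exists (fun=> 1); split => // z /andP[z0 zr].
have z1 : `|z| < 1 by rewrite ger0_norm// (le_lt_trans zr).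
have H : (1 - r)^-1 * z ^+ n @[n --> \oo] --> 0.
  by rewrite -(mulr0 (1 - r)^-1); apply: cvgM; [exact: cvg_cst|exact: cvg_expr].
apply/cvgrPdist_le => e e0; move/cvgr0Pnorm_le : H => /(_ e e0).
apply: filterS => n Hn; under eq_bigr do rewrite mul1r.
have zr' : 0 <= z <= r by rewrite z0.
apply: (le_trans (geom_remainder n zr' r1)); exact: le_trans (ler_norm _) Hn.
Qed.

(** The moments of [- L * derive1 sg] are nonnegative, hence so are the coefficients of the
    exponent, of its exponential and of the product with the geometric series. [B] is left free so
    that the range follows the true right edge of the support of [derive1 sg] rather than [b]. *)
Lemma psum_charge_transform (L r B rho : R) : 0 < L -> 0 < r -> r < 1 -> 0 <= B ->
  (forall s, derive1 sg s != 0 -> expR (L * s) <= B) -> r * B <= rho -> rho < 1 ->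
  psum_like r (fun z => (1 - z)^-1 *
    expR (- (L * \int[mu]_s ((1 - z * expR (L * s))^-1 * derive1 sg s)))).
Proof.
move=> L0 r0 r1 B0 uB rB rho1.
have [a pa] := psum_geometric r1.
have i' := integrable_dcharge v_lip v_out.
have iphi : mu.-integrable setT (EFin \o (fun s => - L * derive1 sg s)).
  exact: (integrableZl measurableT (- L) i').
have phiB s : - L * derive1 sg s != 0 -> expR (L * s) <= B.
  by rewrite mulf_eq0 negb_or => /andP[_ /uB].
have P := psum_integral iphi phiB B0 rB rho1.
have c0 j : 0 <= \int[mu]_s (expR (L * s) ^+ j * (- L * derive1 sg s)).
  rewrite (_ : (fun s => _) = (fun s => - L * (expR (L * s) ^+ j * derive1 sg s))); last first.
    by apply/funext => s; ring.
  rewrite RintegralZl//; last exact: (integrable_mom i' uB j).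
  by rewrite mulNr -mulrN mulr_ge0 ?(ltW L0)// oppr_ge0 dcharge_moment_le0.
have E : psum_like r (fun z => expR (- (L * \int[mu]_s ((1 - z * expR (L * s))^-1 * derive1 sg s)))).
  apply: psum_expR => //; eexists; apply: psum_ext (P c0) => z /andP[z0 zr].
  rewrite (_ : (fun s => _) = (fun s => - L * ((1 - z * expR (L * s))^-1 * derive1 sg s))); last first.
    by apply/funext => s; ring.
  rewrite RintegralZl// ?mulNr//.
  apply: (integrable_kermom i' uB z0 _ rho1).
  by rewrite (le_trans _ rB)// ler_wpM2r.
have [c pc] := E.
by exists (cauchy_prod a c); exact: psumM.
Qed.

(** Both [z] times the [z]-derivative and [1 / L] times the [s]-derivative of [(1 - z e^(Ls))^-1].
    This coincidence is the source of the Burgers equation. *)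
Definition ker2 (L z s : R) : R := z * expR (L * s) / (1 - z * expR (L * s)) ^+ 2.

Lemma measurable_ker2 (L z : R) : measurable_fun setT (ker2 L z).
Proof.
rewrite /ker2; apply: measurable_funM.
  by apply: measurable_funM => //; exact: measurable_expM.
apply: (@measurableT_comp _ _ _ _ _ _ (@GRing.inv R)); first exact: measurable_inv.
apply: measurable_funX; apply: measurable_funB => //.
by apply: measurable_funM => //; exact: measurable_expM.
Qed.

Lemma ker2_bound (L z s : R) : 0 < L -> 0 < z -> z * expR (L * b) <= 2^-1 -> s <= b ->
  0 <= ker2 L z s <= 2.
Proof.
move=> L0 z0 zb sb; have /andP[h1 h2] := one_sub_zu L0 z0 zb sb.
have /andP[h3 h4] := zu_itv L0 z0 zb sb.
have h : 0 < 1 - z * expR (L * s) by apply: lt_le_trans h1.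
rewrite /ker2 divr_ge0 ?(ltW h3)// ?exprn_ge0 ?(ltW h)//= ler_pdivrMr ?exprn_gt0//.
nra.
Qed.

Lemma dcharge_ker (L z : R) : 0 < L -> 0 < z -> z * expR (L * b) <= 2^-1 ->
  \int[mu]_s ((1 - z * expR (L * s))^-1 * derive1 sg s) =
  - (L * \int[mu]_s (ker2 L z s * sg s)).
Proof.
move=> L0 z0 zb.
have ik2 : mu.-integrable setT (EFin \o (fun s => ker2 L z s * sg s)).
  apply: (@integrable_mul_bounded _ _ _ 2 integrable_charge (measurable_ker2 _ _)) => s sgs.
  have sb : s <= b by apply: (support_le _ sgs) => u /ltW; exact: charge_out.
  by have /andP[k0 k1] := ker2_bound L0 z0 zb sb; rewrite ger0_norm.
rewrite -RintegralZl//.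
rewrite (_ : (fun s => L * _) = (fun s => L * ker2 L z s * sg s)); last first.
  by apply/funext => s; rewrite mulrA.
have sb s : `|s| <= b -> s <= b by apply: le_trans; exact: ler_norm.
have kE s : (1 - z * expR (L * s))^-1 = L^-1 * kker L z s + 1.
  by rewrite /kker mulKf ?gt_eqF// subrK.
apply: (@lipschitz_IBP R sg _ (fun s => L * ker2 L z s) b (2 * L) 2) => //.
- by rewrite mulr_ge0// ltW.
- exact: charge_lip.
- exact: charge_out.
- move=> x y /sb xb /sb yb; rewrite !kE.
  rewrite (_ : _ - _ = L^-1 * (kker L z x - kker L z y)); last by ring.
  rewrite normrM ger0_norm ?invr_ge0 ?(ltW L0)// ler_pdivrMl//.
  apply: (le_trans (kker_lip L0 z0 zb yb xb)).
  by rewrite le_eqVlt; apply/orP; left; apply/eqP; ring.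
- move=> x /sb xb; exact: (ker_le L0 z0 zb xb).
- move=> s /ltW/sb sb'; have d := is_derive_kker L0 z0 zb sb'.
  have d1 := is_deriveZ L^-1 d.
  have d2 : is_derive s 1 (fun=> 1 : R) 0 by exact: is_derive_cst.
  have d3 := is_deriveD d1 d2.
  rewrite (_ : (fun s => (1 - _)^-1) = (L^-1 \*: kker L z) + (fun=> 1)); last first.
    by apply/funext => t; rewrite kE.
  apply: is_derive_eq d3 _; rewrite addr0 /GRing.scale/= mulKf ?gt_eqF//.
  by rewrite /ker2 !mulrA.
- exact: measurable_ker.
- by apply: measurable_funM => //; exact: measurable_ker2.
- move=> s /ltW/sb sb'; have /andP[k0 k1] := ker2_bound L0 z0 zb sb'.
  by rewrite ger0_norm ?(mulr_ge0 (ltW L0) k0)// mulrC ler_wpM2r// ltW.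
Qed.

End charge_transform.

(** * Monotonicity in time of a growing charge *)

Section growth.
Context {R : realType} (L : R) (V : R -> R -> R).
Notation mu := (@lebesgue_measure R).
Local Notation S t := (diagram_charge (V t)).
Local Notation D t s := (derive1 (fun u => diagram_charge (V u) s) t).
Hypothesis L0 : 0 < L.
Hypothesis V_lip : forall t x y : R, 0 < t -> `|V t x - V t y| <= `|x - y|.
Hypothesis V_out : forall t : R, 0 < t -> exists2 M : R, 0 < M & forall s, M <= `|s| -> V t s = `|s|.
Hypothesis S_int : forall t : R, 0 < t -> \int[mu]_s S t s = t.
Hypothesis S_der : forall t s : R, 0 < t -> derivable (fun u => diagram_charge (V u) s) t 1.
Hypothesis D_integrable : forall t : R, 0 < t -> mu.-integrable setT (EFin \o (fun s => D t s)).
Hypothesis S_eqn : forall t : R, 0 < t -> exists M zs : R, [/\ 0 < zs,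
  forall s, M < `|s| -> D t s = 0 &
  forall z : R, 0 < z < zs -> \int[mu]_s ((1 - z * expR (L * s))^-1 * D t s) =
    (1 - z)^-1 * expR (- (L * \int[mu]_s ((1 - z * expR (L * s))^-1 * derive1 (S t) s)))].

Lemma growth_ae_ge0 (t : R) : 0 < t -> {ae mu, forall s, 0 <= D t s}.
Proof.
move=> t0; have [M M0 HM] := V_out t0; have [M' [zs [zs0 HM' eqn]]] := S_eqn t0.
pose b := Num.max M M'.
have bM s : b <= `|s| -> M <= `|s| by apply: le_trans; rewrite le_max lexx.
have bM' s : b < `|s| -> M' < `|s| by apply: le_lt_trans; rewrite le_max lexx orbT.
apply: (@charge_growth_ae_ge0 R (V t) _ b L zs) => //.
- by rewrite lt_max M0.
- by move=> x y; exact: V_lip.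
- by move=> s /bM/HM.
- exact: D_integrable.
- by move=> s /bM'/HM'.
Qed.

Lemma S_lip (t x y : R) : 0 < t -> `|S t x - S t y| <= 1 * `|x - y|.
Proof. by move=> t0; apply: charge_lip => u v; exact: V_lip. Qed.

(** Logarithmic time, because the monotonicity lemma asks for derivability on the whole line. *)
Let f (s tau : R) := S (expR tau) s.

Let f_derive (s tau : R) : is_derive tau 1 (f s) (expR tau * D (expR tau) s).
Proof.
have d1 : is_derive (expR tau) 1 (fun u => diagram_charge (V u) s) (D (expR tau) s).
  by split; [apply: S_der; exact: expR_gt0|rewrite derive1E].
have d2 : is_derive tau 1 (@expR R) (expR tau) by exact: is_derive_expR.
have := @is_derive1_comp R (fun u => diagram_charge (V u) s) (@expR R) tau _ _ d1 d2.
by move=> h; apply: is_derive_eq h _; rewrite mulrC.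
Qed.

Let f_derivable (s tau : R) : derivable (f s) tau 1.
Proof. by have h := f_derive s tau; exact: ex_derive. Qed.

Let f_derive1 (s tau : R) : derive1 (f s) tau = expR tau * D (expR tau) s.
Proof. by rewrite derive1E; have := f_derive s tau => h; rewrite derive_val. Qed.

Let f_cont s : continuous (f s).
Proof. by move=> tau; exact/differentiable_continuous/derivable1_diffP/f_derivable. Qed.

(** Joint measurability for Tonelli, from the Lipschitz bound in [s] and continuity in time. *)
Let f_meas c : measurable_fun setT (fun p : R * R => f p.1 (p.2 + c)).
Proof.
apply: (@measurable_caratheodory R (fun s t => f s (t + c)) 1).
  by move=> t x y; apply: S_lip; exact: expR_gt0.
move=> s; apply: (@measurableT_comp _ _ _ _ _ _ (f s)).
  exact: continuous_measurable_fun.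
exact: measurable_funD.
Qed.

Let df_meas : measurable_fun setT (fun p : R * R => derive1 (f p.1) p.2).
Proof.
apply: (@measurable_fun_cvg _ _ _ _ (fun n (p : R * R) => diff_quotient (f p.1) n.+1%:R^-1 p.2)).
  move=> n; rewrite /diff_quotient; apply: measurable_funM => //; apply: measurable_funB.
    exact: f_meas.
  have := f_meas 0; apply: eq_measurable_fun => p _; by rewrite addr0.
by move=> [s tau] _ /=; apply: diff_quotient_seq.
Qed.

Let ngp (x : R) : R := Num.max 0 (- x).

Let ng_meas : measurable_fun setT (fun p : R * R => ngp (derive1 (f p.1) p.2)).
Proof.
apply: measurable_maxr => //.
by apply: (@measurableT_comp _ _ _ _ _ _ (@GRing.opp R)) => //; exact: df_meas.
Qed.

(** At every time the negative part of the derivative vanishes for almost every [s]. Tonelli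
    exchanges the roles: for almost every [s] it vanishes at almost every time, which is the
    hypothesis of [derivable_ae_ge0_nondecreasing]. *)
Lemma charge_ae_nondecreasing :
  {ae mu, forall s, {homo (fun tau => S (expR tau) s) : x y / x <= y}}.
Proof.
pose g (p : R * R) : \bar R := (ngp (derive1 (f p.1) p.2))%:E.
have mg : measurable_fun setT g by apply/measurable_EFinP; exact: ng_meas.
have g0 p : (0 <= g p)%E by rewrite lee_fin le_max lexx.
have sec_t tau : (\int[mu]_s g (s, tau) = 0)%E.
  have msec : measurable_fun setT (fun s : R => g (s, tau)).
    exact: (measurableT_comp mg (pair2_measurable tau)).
  have H : ae_eq mu setT (fun s : R => g (s, tau)) (cst 0%E).
    have := growth_ae_ge0 (expR_gt0 tau).
    apply: filterS; first exact: (ae_filter_ringOfSetsType mu).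
    move=> s h _; rewrite /g /ngp /= f_derive1 max_l// oppr_le0 mulr_ge0//.
  rewrite (ae_eq_integral (cst 0%E) _ _ _ _ H)//; exact: integral0.
have fub := @fubini_tonelli _ _ (measurableTypeR R) (measurableTypeR R) R mu mu g mg g0.
have E0 : (\int[mu]_s \int[mu]_tau g (s, tau) = 0)%E.
  by rewrite fub; under eq_integral do rewrite sec_t; exact: integral0.
have mF : measurable_fun setT (fun s : R => \int[mu]_tau g (s, tau))%E.
  exact: (@measurable_fun_fubini_tonelli_F _ _ (measurableTypeR R) (measurableTypeR R) R mu g mg g0).
have F0 : forall s : R, (0 <= \int[mu]_tau g (s, tau))%E by move=> s; exact: integral_ge0.
have H1 : ae_eq mu setT (fun s : R => \int[mu]_tau g (s, tau))%E (cst 0%E).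
  apply: (@ae_eq_integral_abs _ (measurableTypeR R) R mu setT measurableT _ mF).1.
  by rewrite -[RHS]E0; apply: eq_integral => s _; exact: gee0_abs (F0 s).
apply: (@filterS _ _ (ae_filter_ringOfSetsType mu) _ _ _ H1).
move=> s /(_ I) /= Hs.
have Hm := @derivable_ae_ge0_nondecreasing R (f s) (@f_derivable s).
suff Hd : {ae mu, forall tau, 0 <= derive1 (f s) tau} by exact: (Hm Hd).
have msec : measurable_fun setT (fun tau : R => g (s, tau)).
  exact: (measurableT_comp mg (pair1_measurable s)).
have H2 : ae_eq mu setT (fun tau : R => g (s, tau)) (cst 0%E).
  apply: (@ae_eq_integral_abs _ (measurableTypeR R) R mu setT measurableT _ msec).1.
  by rewrite -[RHS]Hs; apply: eq_integral => tau _; exact: gee0_abs (g0 _).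
apply: (@filterS _ _ (ae_filter_ringOfSetsType mu) _ _ _ H2).
move=> tau /(_ I) h; have {}h : ngp (derive1 (f s) tau) = 0 by case: h.
have : - derive1 (f s) tau <= ngp (derive1 (f s) tau) by rewrite /ngp le_max lexx orbT.
by rewrite h oppr_le0.
Qed.

(** A null set contains no interval, so an exceptional [s] is approached by good points, and the
    Lipschitz bound in [s] transfers the inequality. *)
Lemma charge_nondecreasing (s t1 t2 : R) : 0 < t1 -> t1 <= t2 -> S t1 s <= S t2 s.
Proof.
move=> t10 t12; have t20 : 0 < t2 by exact: lt_le_trans t12.
apply/ler_addgt0Pr => e e0.
have [A [mA A0 HA]] := charge_ae_nondecreasing.
have [s' /andP[ss' s's] nA] : exists2 s', s < s' < s + e / 2 & ~ A s'.
  apply: contrapT => H.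
  have : `]s, s + e / 2[%classic `<=` A.
    move=> x; rewrite /= in_itv/= => xs; apply: contrapT => nA; apply: H.
    by exists x.
  move=> /(le_measure mu); rewrite !inE => /(_ (measurable_itv _) mA) h.
  have ml : mu (`]s, s + e / 2[%classic : set R) = (e / 2)%:E.
    rewrite lebesgue_measure_itv/= lte_fin ltrDl divr_gt0// -EFinB.
    by rewrite addrAC subrr add0r.
  have := eq_ind _ (fun x => (_ <= x)%E) (eq_ind _ (fun x => (x <= _)%E) h _ ml) _ A0.
  by rewrite lee_fin leNgt divr_gt0.
have mono : {homo (fun tau => S (expR tau) s') : x y / x <= y}.
  by apply: contrapT => h; apply: nA; exact: HA.
have := mono (ln t1) (ln t2); rewrite !lnK ?posrE// ler_ln ?posrE// => /(_ t12) h.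
have d : `|s - s'| <= e / 2.
  by rewrite distrC ger0_norm ?subr_ge0 ?(ltW ss')// lerBlDl ltW.
have h1 := le_trans (S_lip s s' t10) (_ : 1 * `|s - s'| <= e / 2).
have h2 := le_trans (S_lip s s' t20) (_ : 1 * `|s - s'| <= e / 2).
rewrite mul1r in h1 h2; have := h1 d; have := h2 d.
by rewrite !ler_norml => /andP[p1 p2] /andP[p3 p4]; lra.
Qed.

Lemma growth_ge0 (t s : R) : 0 < t -> 0 <= D t s.
Proof.
move=> t0; have H := diff_quotient_seq (@S_der t s t0).
rewrite -(cvg_lim _ H)//; apply: limr_ge; first by apply/cvg_ex; eexists; exact: H.
apply: nearW => n; rewrite /diff_quotient mulr_ge0// subr_ge0.
by apply: charge_nondecreasing => //; rewrite lerDl.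
Qed.

Lemma S_ge0 (t s : R) : 0 < t -> 0 <= S t s.
Proof.
move=> t0; have [M M0 HM] := V_out t0.
by apply: (@charge_ge0 R (V t) M) => // x y; exact: V_lip.
Qed.

(* The charges increase with time, so the support at time 2 contains all the
   supports at times [t < 2]. *)
Lemma uniform_support : exists2 b, 0 < b & forall t, 0 < t < 2 ->
  (forall s, b <= `|s| -> V t s = `|s|) /\ (forall s, b <= `|s| -> D t s = 0).
Proof.
have [M M0 HM] := V_out (ltr0n _ 2 : 0 < 2).
exists M => //.
have S0 u s : 0 < u < 2 -> M <= `|s| -> S u s = 0.
  move=> /andP[u0 u2] Ms; apply/eqP; rewrite eq_le S_ge0// andbT.
  apply: (le_trans (charge_nondecreasing s u0 (ltW u2))).
  by rewrite /diagram_charge HM// subrr mul0r.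
move=> t t02; split => s Ms.
  have /eqP := S0 t s t02 Ms; rewrite /diagram_charge mulf_eq0 subr_eq0.
  by rewrite invr_eq0 pnatr_eq0 orbF => /eqP.
apply: (@near_cst_derive1 R _ _ 0).
have : t \in `]0, 2[ by rewrite in_itv.
by move=> /near_in_itvoo; apply: filterS => u; rewrite in_itv/= => /S0 ->.
Qed.

(** * The Burgers equation and its characteristics *)

Section burgers.
Variable b : R.
Hypothesis b0 : 0 < b.
Hypothesis b_supp : forall t : R, 0 < t < 2 ->
  (forall s, b <= `|s| -> V t s = `|s|) /\ (forall s, b <= `|s| -> D t s = 0).
Local Notation B := (expR (L * b)).
Local Notation r := (2^-1 / B).

Let half : 2^-1 < 1 :> R. Proof. by rewrite invf_lt1// ltr1n. Qed.
Let B1 : 1 < B. Proof. by rewrite expR_gt1 mulr_gt0. Qed.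
Let B0 : 0 < B. Proof. exact: expR_gt0. Qed.
Let r0 : 0 < r. Proof. by rewrite divr_gt0// invr_gt0. Qed.
Let rB : r * B <= 2^-1. Proof. by rewrite divfK// gt_eqF. Qed.
Let r1 : r < 1.
Proof. by rewrite ltr_pdivrMr// mul1r (lt_trans half). Qed.
Let zr (z : R) : z <= r -> z * B <= 2^-1.
Proof. by rewrite ler_pdivlMr. Qed.

Let Vl (t : R) : 0 < t < 2 -> forall x y, `|V t x - V t y| <= `|x - y|.
Proof. by move=> /andP[t0 _] x y; exact: V_lip. Qed.
Let Vo (t : R) : 0 < t < 2 -> forall s, b <= `|s| -> V t s = `|s|.
Proof. by move=> /b_supp[]. Qed.
Let tpos (t : R) : 0 < t < 2 -> 0 < t. Proof. by case/andP. Qed.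

Let uB (g : R -> R) : (forall s, b <= `|s| -> g s = 0) ->
  forall s, g s != 0 -> expR (L * s) <= B.
Proof. by move=> f0 s; apply: support_expR_le => // u /ltW; exact: f0. Qed.

Let sb (g : R -> R) : (forall s, b <= `|s| -> g s = 0) -> forall s, g s != 0 -> s <= b.
Proof. by move=> f0 s; apply: support_le => u /ltW; exact: f0. Qed.

(** The hypothesis covers only [z] below a bound depending on [t]. Both sides are nonnegative power
    series on [[0, r]] with [r] independent of [t], and following curves in [(z, t)] needs this
    uniformity. *)
Lemma growth_eqn (t z : R) : 0 < t < 2 -> 0 <= z <= r ->
  \int[mu]_s ((1 - z * expR (L * s))^-1 * D t s) =
    (1 - z)^-1 * expR (- (L * \int[mu]_s ((1 - z * expR (L * s))^-1 * derive1 (S t) s))).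
Proof.
move=> t02; have [M [zs [zs0 _ eqn]]] := S_eqn (tpos t02).
have [_ Dout] := b_supp t02.
apply: (@psum_identity R r (fun z => \int[mu]_s ((1 - z * expR (L * s))^-1 * D t s))
   (fun z => (1 - z)^-1 * expR (- (L * \int[mu]_s ((1 - z * expR (L * s))^-1 * derive1 (S t) s)))) zs) => //.
- eexists; apply: (psum_integral (D_integrable (tpos t02)) (uB Dout) (ltW B0) rB half).
  move=> j; apply: Rintegral_ge0 => s _; apply: mulr_ge0; first exact/exprn_ge0/expR_ge0.
  exact: growth_ge0 (tpos t02).
- apply: (psum_charge_transform b0 (Vl t02) (Vo t02) L0 r0 r1 (ltW B0) _ rB half).
  move=> s h; rewrite ler_expR ler_pM2l//.
  exact: (dcharge_neq0 (Vo t02) h).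
Qed.

(** This is the extended equation at [z = 0], where the exponent vanishes because [derive1 (S t)]
    has integral 0. *)
Lemma Rintegral_growth (t : R) : 0 < t < 2 -> \int[mu]_s D t s = 1.
Proof.
move=> t02; have z0 : (0 : R) <= 0 <= r by rewrite lexx ltW.
have := growth_eqn t02 z0.
under eq_Rintegral do rewrite mul0r subr0 invr1 mul1r.
move=> ->; rewrite subr0 invr1 mul1r.
under eq_Rintegral do rewrite mul0r subr0 invr1 mul1r.
by rewrite (Rintegral_dcharge b0 (Vl t02) (Vo t02)) mulr0 oppr0 expR0.
Qed.

Let SI (t : R) : 0 < t < 2 -> mu.-integrable setT (EFin \o S t).
Proof. by move=> t02; exact: (integrable_charge b0 (Vl t02) (Vo t02)). Qed.
Let Sout (t : R) : 0 < t < 2 -> forall s, b <= `|s| -> S t s = 0.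
Proof. by move=> t02 s; exact: (charge_out (Vo t02)). Qed.

(* Scheffe: nonnegative difference quotients of mass 1 converge pointwise to a
   limit of mass 1, hence in L1. *)
Lemma growth_L1 (t : R) (h : nat -> R) : 0 < t < 2 -> (forall n, h n != 0) ->
  (forall n, 0 < t + h n < 2) -> h n @[n --> \oo] --> 0 ->
  \int[mu]_s `|(h n)^-1 * (S (t + h n) s - S t s) - D t s| @[n --> \oo] --> 0.
Proof.
move=> t02 h0 th hc; have t0 := tpos t02.
pose q n s := (h n)^-1 * (S (t + h n) s - S t s).
have iq n : mu.-integrable setT (EFin \o q n).
  exact: (integrableZl measurableT _ (integrable_subr measurableT (SI (th n)) (SI t02))).
(* Here the area normalisation enters: the charge at time [t] has integral exactly [t]. *)
have q1 n : \int[mu]_s q n s = 1.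
  rewrite /q RintegralZl//; last exact: (integrable_subr measurableT (SI (th n)) (SI t02)).
  rewrite RintegralB//; try exact: SI.
  rewrite (S_int (tpos (th n))) (S_int t0) (_ : t + h n - t = h n); last by ring.
  exact: mulVf.
have q0 n s : 0 <= q n s.
  rewrite /q; have [hn|hn] := ltP 0 (h n).
    rewrite mulr_ge0 ?invr_ge0 ?(ltW hn)// subr_ge0.
    by apply: charge_nondecreasing => //; rewrite lerDl ltW.
  rewrite mulr_le0// ?invr_le0// subr_le0.
  by apply: charge_nondecreasing; [exact: tpos (th n)|rewrite gerDl].
have qc s : q n s @[n --> \oo] --> D t s.
  have /cvgr_dnbhsP := derive1_cvg (@S_der t s t0); apply; split => //.
have iD := D_integrable t0.
have mD : measurable_fun setT (fun s => D t s) by have /integrableP[/measurable_EFinP] := iD.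
have mq n : measurable_fun setT (q n) by have /integrableP[/measurable_EFinP] := iq n.
(* The positive part of [D t - q n] is dominated by [D t], and since the masses agree its integral
   is half the L1 distance. *)
pose w n s := Num.max 0 (D t s - q n s).
have mw n : measurable_fun setT (w n).
  by apply: measurable_maxr => //; apply: measurable_funB.
have wD n s : `|w n s| <= D t s.
  rewrite ger0_norm ?le_max ?lexx// ge_max growth_ge0//= gerBl; exact: q0.
have wc : {ae mu, forall s, w n s @[n --> \oo] --> (cst 0 : R -> R) s}.
  apply: aeW => s; rewrite /w /=.
  have e0 : Num.max 0 (D t s - D t s) = 0 by rewrite subrr maxxx.
  rewrite -[X in _ --> X]e0.
  have cm : continuous (fun x : R => Num.max 0 x).
    by move=> x; apply: (@continuous_max _ _ (cst 0) id); [exact: cvg_cst|exact: cvg_id].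
  apply: (@cvg_comp _ _ _ (fun n => D t s - q n s) (fun x : R => Num.max 0 x)); last exact: cm.
  by apply: cvgB; [exact: cvg_cst|exact: qc].
have [_ wcv] := Rdominated_cvg mw (measurable_cst _) wc iD wD.
have iw n : mu.-integrable setT (EFin \o w n).
  apply: (le_integrable measurableT _ _ iD) => [|s _]; first by apply/measurable_EFinP; exact: mw.
  by rewrite /= lee_fin (le_trans (wD n s))// ler_norm.
have E n : \int[mu]_s `|q n s - D t s| = 2 * \int[mu]_s w n s.
  have i1 := integrable_subr measurableT (iq n) iD.
  have i2 : mu.-integrable setT (EFin \o (fun s => 2 * w n s)) by exact: (integrableZl measurableT 2 (iw n)).
  transitivity (\int[mu]_s (2 * w n s + (q n s - D t s))).
    apply: eq_Rintegral => s _; rewrite /w; case: (ltP 0 (D t s - q n s)) => hh.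
      by rewrite ltr0_norm; [ring|rewrite -oppr_gt0 opprB].
    by rewrite ger0_norm; [ring|rewrite -oppr_le0 opprB].
  rewrite RintegralD// RintegralB// q1 Rintegral_growth// subrr addr0 RintegralZl//.
have -> : (fun n => \int[mu]_s `|q n s - D t s|) = (fun n => 2 * \int[mu]_s w n s).
  by apply/funext => n; rewrite E.
rewrite -(mulr0 2) (_ : (0 : R) = \int[mu]_s cst 0 s); last by rewrite /Rintegral integral0.
by apply: cvgM; [exact: cvg_cst|exact: wcv].
Qed.

(** The difference quotients in time come without a dominating function, so L1 convergence is used:
    a bounded [F] against an L1-small error, plus a small change of [F] against mass 1. Subtracting
    [S t] separates off the motion of [F] against a frozen charge. *)
Lemma growth_moving (F : R -> R -> R) (t C d : R) : 0 < t < 2 -> 0 < d -> 0 <= C ->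
  (forall y, measurable_fun setT (F y)) ->
  (forall y s, `|y| < d -> s <= b -> `|F (t + y) s| <= C) ->
  (forall y s, `|y| < d -> s <= b -> `|F (t + y) s - F t s| <= C * `|y|) ->
  is_derive t 1 (fun u => \int[mu]_s (F u s * (S u s - S t s))) (\int[mu]_s (F t s * D t s)).
Proof.
move=> t02 d0 C0 mF FC Fl; have t0 := tpos t02.
set I := (fun u => _).
suff H1 : diff_quotient I h t @[h --> 0^'] --> \int[mu]_s (F t s * D t s).
  have dI : derivable I t 1 by apply/derivable_cvgP/cvg_ex; eexists; exact: H1.
  by split => //; rewrite -derive1E; apply: cvg_unique (derive1_cvg dI) H1.
have I0 : I t = 0.
  by rewrite /I; under eq_Rintegral do rewrite subrr mulr0; rewrite /Rintegral integral0.
apply/cvgr_dnbhsP => h0 [h0n h0c].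
have ev : \forall n \near \oo, `|h0 n| < d /\ 0 < t + h0 n < 2.
  near=> n; split; near: n.
    by move/cvgr0Pnorm_lt : h0c => /(_ d d0).
  have cth : t + h0 n @[n --> \oo] --> t.
    by rewrite -[X in _ --> X]addr0; apply: cvgD => //; exact: cvg_cst.
  have : t \in `]0, 2[ by rewrite in_itv.
  move=> /near_in_itvoo ht.
  have [K _ HK] := cth _ ht.
  by exists K => // n nK; have := HK n nK; rewrite /= in_itv.
have [N _ HN] := ev.
pose h n := h0 (n + N)%N.
have hN n : `|h n| < d /\ 0 < t + h n < 2 by apply: HN => /=; rewrite leq_addl.
have hc : h n @[n --> \oo] --> 0 by rewrite -(cvg_shiftn N) in h0c.
have hn0 n : h n != 0 by exact: h0n.
rewrite -(cvg_shiftn N) -/h.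
have L1 := growth_L1 t02 hn0 (fun n => (hN n).2) hc.
have iD := D_integrable t0; have [_ Dout] := b_supp t02.
have iFD u : `|u - t| < d -> mu.-integrable setT (EFin \o (fun s => F u s * D t s)).
  move=> ud; apply: (@integrable_mul_bounded _ _ _ C iD (mF u)) => s /(sb Dout) sb'.
  by have := FC (u - t) s ud sb'; rewrite addrC subrK.
have iFDt : mu.-integrable setT (EFin \o (fun s => F t s * D t s)).
  by apply: iFD; rewrite subrr normr0.
pose q n s := (h n)^-1 * (S (t + h n) s - S t s).
have qout n s : b <= `|s| -> q n s = 0.
  by move=> bs; rewrite /q !Sout ?subrr ?mulr0//; exact: (hN n).2.
have iq n : mu.-integrable setT (EFin \o q n).
  exact: (integrableZl measurableT _ (integrable_subr measurableT (SI (hN n).2) (SI t02))).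
have iFq n : mu.-integrable setT (EFin \o (fun s => F (t + h n) s * q n s)).
  apply: (@integrable_mul_bounded _ _ _ C (iq n) (mF _)) => s /(sb (qout n)) sb'.
  exact: FC (hN n).1 sb'.
have dqE n : diff_quotient I (h n) t = \int[mu]_s (F (t + h n) s * q n s).
  rewrite /diff_quotient I0 subr0 /I -RintegralZl//; last first.
    have i1 := integrableZl measurableT (h n) (iFq n).
    apply: eq_integrable i1 => // s _; rewrite /= /q -EFinM; congr EFin.
    by rewrite mulrCA mulVKf.
  by apply: eq_Rintegral => s _; rewrite /q mulrCA.
under eq_fun do rewrite dqE.
have bound n : `|\int[mu]_s (F t s * D t s) - \int[mu]_s (F (t + h n) s * q n s)| <=
    C * `|h n| + C * \int[mu]_s `|q n s - D t s|.
  have iFhD : mu.-integrable setT (EFin \o (fun s => F (t + h n) s * D t s)).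
    by apply: iFD; rewrite addrAC subrr add0r; exact: (hN n).1.
  rewrite -(subrKA (\int[mu]_s (F (t + h n) s * D t s))) (le_trans (ler_normD _ _))// lerD//.
    rewrite -RintegralB//.
    have i1 := integrable_subr measurableT iFDt iFhD.
    apply: (le_trans (le_normr_Rintegral measurableT i1)).
    have i2 : mu.-integrable setT (EFin \o (fun s => C * `|h n| * D t s)) by exact: (integrableZl measurableT _ iD).
    rewrite [leRHS](_ : _ = \int[mu]_s (C * `|h n| * D t s)); last first.
      by rewrite RintegralZl// Rintegral_growth// mulr1.
    apply: le_Rintegral => //; first exact: integrable_norm i1.
    move=> s _; rewrite -mulrBl normrM (ger0_norm (growth_ge0 s t0)).
    have [->|Ds] := eqVneq (D t s) 0; first by rewrite !mulr0.
    rewrite ler_wpM2r ?growth_ge0// distrC; apply: Fl; [exact: (hN n).1|exact: sb Dout _ Ds].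
  rewrite -RintegralB//.
  have i1 := integrable_subr measurableT iFhD (iFq n).
  apply: (le_trans (le_normr_Rintegral measurableT i1)).
  have iqD := integrable_subr measurableT (iq n) iD.
  have inq : mu.-integrable setT (EFin \o (fun s => `|q n s - D t s|)) by exact: integrable_norm iqD.
  have i2 : mu.-integrable setT (EFin \o (fun s => C * `|q n s - D t s|)) by exact: (integrableZl measurableT _ inq).
  rewrite -RintegralZl//.
  apply: le_Rintegral => //; first exact: integrable_norm i1.
  move=> s _; rewrite -mulrBr normrM [`|D t s - _|]distrC.
  have [bs|/ltW sb'] := leP b `|s|; first by rewrite qout// Dout// subrr normr0 !mulr0.
  rewrite ler_wpM2r//; apply: FC; first exact: (hN n).1.
  by rewrite (le_trans (ler_norm _)).
have bc : C * `|h n| + C * \int[mu]_s `|q n s - D t s| @[n --> \oo] --> 0.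
  rewrite -(addr0 0); apply: cvgD.
    rewrite -(mulr0 C) -(@normr0 R R); apply: cvgM; first exact: cvg_cst.
    exact: cvg_norm.
  by rewrite -(mulr0 C); apply: cvgM; [exact: cvg_cst|exact: L1].
apply/cvgrPdist_le => e e0; move/cvgr0Pnorm_le : bc => /(_ e e0).
by apply: filterS => n Hn; apply: (le_trans (bound n)); exact: le_trans (ler_norm _) Hn.
Unshelve. all: by end_near. Qed.

(** The [z]-derivative of [ker2]. *)
Definition ker2z (z s : R) : R :=
  expR (L * s) * (1 + z * expR (L * s)) / (1 - z * expR (L * s)) ^+ 3.

Let zu (z s : R) : 0 < z -> z <= r -> s <= b -> 0 < z * expR (L * s) <= 2^-1.
Proof. by move=> z0 zr' sb'; exact: (zu_itv L0 z0 (zr zr') sb'). Qed.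

(** With [u = e^(Ls)] the remainder is exactly [(u y)^2 / ((1 - z u)^2 (1 - (z + y) u))]; each of
    the three factors below is at least 1/2, whence the 8. *)
Lemma ker_taylor (z y s : R) : 0 < z -> z <= r -> 0 < z + y -> z + y <= r -> s <= b ->
  `|(1 - (z + y) * expR (L * s))^-1 - (1 - z * expR (L * s))^-1
    - y * (expR (L * s) / (1 - z * expR (L * s)) ^+ 2)| <= 8 * B ^+ 2 * y ^+ 2.
Proof.
move=> z0 zr' zy0 zyr sb'; have /andP[h1 h2] := zu z0 zr' sb'; have /andP[h3 h4] := zu zy0 zyr sb'.
have u0 := expR_gt0 (L * s); have uB' : expR (L * s) <= B by rewrite ler_expR ler_pM2l.
set u := expR (L * s) in h1 h2 h3 h4 u0 uB' *.
have a0 : 2^-1 <= 1 - z * u by lra.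
have a1 : 2^-1 <= 1 - (z + y) * u by lra.
have n0 : 0 < 1 - z * u by apply: lt_le_trans a0; rewrite invr_gt0.
have n1 : 0 < 1 - (z + y) * u by apply: lt_le_trans a1; rewrite invr_gt0.
have -> : (1 - (z + y) * u)^-1 - (1 - z * u)^-1 - y * (u / (1 - z * u) ^+ 2) =
    (u * y) ^+ 2 / ((1 - z * u) ^+ 2 * (1 - (z + y) * u)).
  by field; rewrite !gt_eqF.
rewrite ger0_norm ?divr_ge0 ?sqr_ge0// ?mulr_ge0 ?exprn_ge0 ?(ltW n0) ?(ltW n1)//.
rewrite ler_pdivrMr ?mulr_gt0 ?exprn_gt0//.
have -> : 8 * B ^+ 2 * y ^+ 2 = 8 * (B * y) ^+ 2 by ring.
have h5 : (u * y) ^+ 2 <= (B * y) ^+ 2.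
  by rewrite !exprMn ler_wpM2r ?sqr_ge0// lerXn2r ?nnegrE ?(ltW u0)// ltW.
have h6 : 8^-1 <= (1 - z * u) ^+ 2 * (1 - (z + y) * u).
  have -> : 8^-1 = 2^-1 ^+ 2 * 2^-1 :> R by field.
  by apply: ler_pM => //; rewrite lerXn2r ?nnegrE ?invr_ge0 ?(ltW n0).
have h7 : 0 <= (B * y) ^+ 2 by exact: sqr_ge0.
apply: (le_trans h5); rewrite -mulrA mulrCA ler_peMr//.
by rewrite mulrC -ler_pdivrMr// mul1r.
Qed.

(** The exact remainder is [(u y)^2 (a + 2 a' - a a') / (a^3 a'^2)] with [a] and [a'] in [[1/2, 1]].
    The bracket is at most 3 and the denominator at least 1/32, which gives 96, below 128. *)
Lemma ker2_taylor (z y s : R) : 0 < z -> z <= r -> 0 < z + y -> z + y <= r -> s <= b ->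
  `|ker2 L (z + y) s - ker2 L z s - y * ker2z z s| <= 128 * B ^+ 2 * y ^+ 2.
Proof.
move=> z0 zr' zy0 zyr sb'; have /andP[h1 h2] := zu z0 zr' sb'; have /andP[h3 h4] := zu zy0 zyr sb'.
have u0 := expR_gt0 (L * s); have uB' : expR (L * s) <= B by rewrite ler_expR ler_pM2l.
rewrite /ker2 /ker2z.
set u := expR (L * s) in h1 h2 h3 h4 u0 uB' *.
have a0 : 2^-1 <= 1 - z * u by lra.
have a1 : 2^-1 <= 1 - (z + y) * u by lra.
have n0 : 0 < 1 - z * u by apply: lt_le_trans a0; rewrite invr_gt0.
have n1 : 0 < 1 - (z + y) * u by apply: lt_le_trans a1; rewrite invr_gt0.
have -> : (z + y) * u / (1 - (z + y) * u) ^+ 2 - z * u / (1 - z * u) ^+ 2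
     - y * (u * (1 + z * u) / (1 - z * u) ^+ 3) =
    (u * y) ^+ 2 * ((1 - z * u) + 2 * (1 - (z + y) * u) - (1 - z * u) * (1 - (z + y) * u)) /
    ((1 - z * u) ^+ 3 * (1 - (z + y) * u) ^+ 2).
  by field; rewrite !gt_eqF.
set a := 1 - z * u in a0 n0 *; set a' := 1 - (z + y) * u in a1 n1 *.
have a2 : a <= 1 by rewrite /a; lra.
have a3 : a' <= 1 by rewrite /a'; lra.
have m0 : 0 <= a + 2 * a' - a * a' <= 3 by nra.
have /andP[m1 m2] := m0.
have den0 : 0 < a ^+ 3 * a' ^+ 2 by rewrite mulr_gt0 ?exprn_gt0.
rewrite ger0_norm; last exact: divr_ge0 (mulr_ge0 (sqr_ge0 _) m1) (ltW den0).
rewrite ler_pdivrMr//.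
have -> : 128 * B ^+ 2 * y ^+ 2 = 128 * (B * y) ^+ 2 by ring.
have h5 : (u * y) ^+ 2 <= (B * y) ^+ 2.
  by rewrite !exprMn ler_wpM2r ?sqr_ge0// lerXn2r ?nnegrE ?(ltW u0)// ltW.
have h6 : 32^-1 <= a ^+ 3 * a' ^+ 2.
  have -> : 32^-1 = 2^-1 ^+ 3 * 2^-1 ^+ 2 :> R by field.
  by apply: ler_pM => //; rewrite ?exprn_ge0 ?invr_ge0// lerXn2r ?nnegrE ?invr_ge0 ?(ltW n0) ?(ltW n1).
have h7 : 0 <= (B * y) ^+ 2 by exact: sqr_ge0.
have h8 := sqr_ge0 (u * y).
apply: (@le_trans _ _ ((B * y) ^+ 2 * 3)); first by apply: ler_pM.
have : 4 <= 128 * (a ^+ 3 * a' ^+ 2) by lra.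
by nra.
Qed.

Lemma ker2z_bound (z s : R) : 0 < z -> z <= r -> s <= b -> 0 <= ker2z z s <= 12 * B.
Proof.
move=> z0 zr' sb'; have /andP[h1 h2] := zu z0 zr' sb'.
have u0 := expR_gt0 (L * s); have uB' : expR (L * s) <= B by rewrite ler_expR ler_pM2l.
rewrite /ker2z; set u := expR (L * s) in h1 h2 u0 uB' *.
have a0 : 2^-1 <= 1 - z * u by lra.
have n0 : 0 < 1 - z * u by apply: lt_le_trans a0; rewrite invr_gt0.
have h6 : 8^-1 <= (1 - z * u) ^+ 3.
  have -> : 8^-1 = 2^-1 ^+ 3 :> R by field.
  by rewrite lerXn2r ?nnegrE ?invr_ge0 ?(ltW n0).
apply/andP; split.
  by rewrite divr_ge0 ?mulr_ge0 ?exprn_ge0 ?(ltW n0) ?(ltW u0)// addr_ge0// ltW.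
rewrite ler_pdivrMr ?exprn_gt0//.
apply: (@le_trans _ _ (B * (3 / 2))).
  by apply: ler_pM; rewrite ?(ltW u0)//; lra.
by have := B0; nra.
Qed.

Lemma measurable_ker2z (z : R) : measurable_fun setT (ker2z z).
Proof.
have me := @measurable_expM R L.
rewrite /ker2z; apply: measurable_funM.
  apply: measurable_funM => //; apply: measurable_funD => //; exact: measurable_funM.
apply: (@measurableT_comp _ _ _ _ _ _ (@GRing.inv R)); first exact: measurable_inv.
apply: measurable_funX; apply: measurable_funB => //; exact: measurable_funM.
Qed.

Lemma measurable_kersq (z : R) :
  measurable_fun setT (fun s : R => expR (L * s) / (1 - z * expR (L * s)) ^+ 2).
Proof.
have me := @measurable_expM R L.
apply: measurable_funM => //.
apply: (@measurableT_comp _ _ _ _ _ _ (@GRing.inv R)); first exact: measurable_inv.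
apply: measurable_funX; apply: measurable_funB => //; exact: measurable_funM.
Qed.

(** With [P] the integral of [S t s / (1 - z e^(Ls))], [Pz] is [z] times the [z]-derivative of [P],
    and [Pzz] is the [z]-derivative of [Pz], not the second derivative of [P]. *)
Definition Pz (z t : R) : R := \int[mu]_s (ker2 L z s * S t s).
Definition Pzz (z t : R) : R := \int[mu]_s (ker2z z s * S t s).
Definition hz (z t : R) : R := \int[mu]_s ((1 - z * expR (L * s))^-1 * D t s).

Lemma hzE (z t : R) : 0 < t < 2 -> 0 < z -> z <= r ->
  hz z t = (1 - z)^-1 * expR (L ^+ 2 * Pz z t).
Proof.
move=> t02 z0 zr'; rewrite /hz growth_eqn ?(ltW z0)//.
rewrite (dcharge_ker b0 (Vl t02) (Vo t02) L0 z0 (zr zr')) -/(Pz z t).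
by congr (_ * expR _); ring.
Qed.

Let zint (z : R) : 0 < z < r -> exists2 d, 0 < d & forall y, `|y| < d -> 0 < z + y /\ z + y <= r.
Proof.
move=> /andP[z0 zr']; exists (Num.min z (r - z)).
  by rewrite lt_min z0 subr_gt0.
move=> y; rewrite lt_min => /andP[y1 y2]; move: y1 y2; rewrite !ltr_norml.
by move=> /andP[p1 p2] /andP[p3 p4]; split; lra.
Qed.

Lemma is_derive_Pz (z t : R) : 0 < t < 2 -> 0 < z < r ->
  is_derive z 1 (fun z => Pz z t) (Pzz z t).
Proof.
move=> t02 z0r; have [d d0 Hd] := zint z0r; have /andP[z0 zr'] := z0r.
have So := Sout t02.
apply: (@derive_integral R (S t) (fun z s => ker2 L z s) (ker2z z) z (128 * B ^+ 2) d) => //.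
- exact: SI.
- move=> y /Hd[p1 p2]; apply: (@integrable_mul_bounded _ _ _ 2 (SI t02) (measurable_ker2 _ _)).
  move=> s /(sb So) sb'; have /andP[k0 k1] := ker2_bound L0 p1 (zr p2) sb'.
  by rewrite ger0_norm.
- apply: (@integrable_mul_bounded _ _ _ (12 * B) (SI t02) (measurable_ker2z _)).
  move=> s /(sb So) sb'; have /andP[k0 k1] := ker2z_bound z0 (ltW zr') sb'.
  by rewrite ger0_norm.
- by move=> y s /Hd[p1 p2] /(sb So) sb'; apply: ker2_taylor => //; exact: ltW.
Qed.

(** Two computations of [z] times the [z]-derivative of [hz]: under the integral sign, and from the
    closed form [hzE]. The left side is also the time derivative of [Pz] at fixed [z], so this
    carries the Burgers equation. *)
Lemma growth_ker2 (z t : R) : 0 < t < 2 -> 0 < z < r ->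
  \int[mu]_s (ker2 L z s * D t s) = z * (hz z t * ((1 - z)^-1 + L ^+ 2 * Pzz z t)).
Proof.
move=> t02 z0r; have [d d0 Hd] := zint z0r; have /andP[z0 zr'] := z0r.
have [_ Do] := b_supp t02; have iD := D_integrable (tpos t02).
pose k s := expR (L * s) / (1 - z * expR (L * s)) ^+ 2.
have kb s : s <= b -> `|k s| <= 4 * B.
  move=> sb'; have /andP[h1 h2] := zu z0 (ltW zr') sb'.
  have u0 := expR_gt0 (L * s); have uB' : expR (L * s) <= B by rewrite ler_expR ler_pM2l.
  have a0 : 2^-1 <= 1 - z * expR (L * s) by lra.
  have n0 : 0 < 1 - z * expR (L * s) by apply: lt_le_trans a0; rewrite invr_gt0.
  rewrite /k ger0_norm ?divr_ge0 ?exprn_ge0 ?(ltW u0) ?(ltW n0)// ler_pdivrMr ?exprn_gt0//.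
  have h6 : 4^-1 <= (1 - z * expR (L * s)) ^+ 2.
    have -> : 4^-1 = 2^-1 ^+ 2 :> R by field.
    by rewrite lerXn2r ?nnegrE ?invr_ge0 ?(ltW n0).
  by have := B0; nra.
have ik : mu.-integrable setT (EFin \o (fun s => k s * D t s)).
  apply: (@integrable_mul_bounded _ _ _ (4 * B) iD (measurable_kersq _)).
  by move=> s /(sb Do) /kb.
have d1 : is_derive z 1 (fun z => hz z t) (\int[mu]_s (k s * D t s)).
  apply: (@derive_integral R (fun s => D t s) (fun z s => (1 - z * expR (L * s))^-1) k z (8 * B ^+ 2) d) => //.
  - move=> y /Hd[p1 p2]; exact: (integrable_kermom iD (uB Do) (ltW p1) (zr p2) half).
  - by move=> y s /Hd[p1 p2] /(sb Do) sb'; apply: ker_taylor => //; exact: ltW.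
have d2 : is_derive z 1 (fun z => (1 - z)^-1 * expR (L ^+ 2 * Pz z t))
    ((1 - z)^-1 * expR (L ^+ 2 * Pz z t) * ((1 - z)^-1 + L ^+ 2 * Pzz z t)).
  have z1 : 1 - z != 0 by rewrite gt_eqF// subr_gt0 (lt_trans zr').
  have dP := is_derive_Pz t02 z0r.
  have e0 : is_derive z 1 (fun z : R => 1 - z) (- 1).
    apply: (is_derive_eq (is_deriveB (is_derive_cst (1 : R) z 1) (is_derive_id z 1))).
    by rewrite sub0r.
  have e1 := @is_deriveV R (fun z => 1 - z) z _ 1 z1 e0.
  have e2 := is_deriveZ (L ^+ 2) dP.
  have e3 : is_derive (L ^+ 2 * Pz z t) 1 (@expR R) (expR (L ^+ 2 * Pz z t)) by exact: is_derive_expR.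
  have e4 := @is_derive1_comp R (@expR R) (fun z => L ^+ 2 * Pz z t) z _ _ e3 e2.
  have e5 := is_deriveM e1 e4.
  apply: is_derive_eq e5 _; rewrite /GRing.scale/= -exprVn.
  by ring.
have nr : \forall y \near z, (1 - y)^-1 * expR (L ^+ 2 * Pz y t) = hz y t.
  have : z \in `]0, r[ by rewrite in_itv/= z0.
  move=> /near_in_itvoo; apply: filterS => y; rewrite in_itv/= => /andP[y0 yr].
  by rewrite hzE// ltW.
have d3 := near_eq_is_derive nr d2.
have := @derive_val _ _ _ _ _ _ _ d3; rewrite (@derive_val _ _ _ _ _ _ _ d1) -hzE ?(ltW zr')// => E.
rewrite -E -RintegralZl//.
by apply: eq_Rintegral => s _; rewrite /ker2 /k; ring.
Qed.

Lemma integrable_ker2 (z t : R) : 0 < t < 2 -> 0 < z -> z <= r ->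
  mu.-integrable setT (EFin \o (fun s => ker2 L z s * S t s)).
Proof.
move=> t02 z0 zr'.
apply: (@integrable_mul_bounded _ _ _ 2 (SI t02) (measurable_ker2 _ _)) => s /(sb (Sout t02)) sb'.
by have /andP[k0 k1] := ker2_bound L0 z0 (zr zr') sb'; rewrite ger0_norm.
Qed.

Lemma Pz_bounds (z t : R) : 0 < t < 2 -> 0 < z -> z <= r -> 0 <= Pz z t <= 2 * t.
Proof.
move=> t02 z0 zr'.
have kb s : S t s != 0 -> 0 <= ker2 L z s <= 2.
  by move=> /(sb (Sout t02)) sb'; exact: ker2_bound L0 z0 (zr zr') sb'.
have S0 s : 0 <= S t s by exact: S_ge0 (tpos t02).
apply/andP; split.
  apply: Rintegral_ge0 => s _; have [->|/kb/andP[k0 _]] := eqVneq (S t s) 0; first by rewrite mulr0.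
  exact: mulr_ge0.
rewrite -[X in _ <= _ * X](S_int (tpos t02)) -RintegralZl//; last exact: SI.
apply: le_Rintegral => //; first exact: integrable_ker2.
  exact: (integrableZl measurableT _ (SI t02)).
move=> s _; have [->|/kb/andP[_ k1]] := eqVneq (S t s) 0; first by rewrite !mulr0.
exact: ler_wpM2r.
Qed.

Lemma Pzz_ge0 (z t : R) : 0 < t < 2 -> 0 < z -> z <= r -> 0 <= Pzz z t.
Proof.
move=> t02 z0 zr'; apply: Rintegral_ge0 => s _.
have [->|/(sb (Sout t02)) sb'] := eqVneq (S t s) 0; first by rewrite mulr0.
have /andP[k0 _] := ker2z_bound z0 zr' sb'.
by apply: mulr_ge0 => //; exact: S_ge0 (tpos t02).
Qed.

Lemma hz_bounds (z t : R) : 0 < t < 2 -> 0 < z -> z <= r -> 0 <= hz z t <= 2.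
Proof.
move=> t02 z0 zr'; have [_ Do] := b_supp t02.
have iD := D_integrable (tpos t02).
apply/andP; split.
  rewrite hzE// mulr_ge0 ?expR_ge0// invr_ge0 subr_ge0 (le_trans zr')// ltW//.
rewrite -[leRHS]mulr1 -[X in _ <= _ * X](Rintegral_growth t02) -RintegralZl//.
apply: le_Rintegral => //.
- exact: (integrable_kermom iD (uB Do) (ltW z0) (zr zr') half).
- exact: (integrableZl measurableT _ iD).
move=> s _; have [->|/(sb Do) sb'] := eqVneq (D t s) 0; first by rewrite !mulr0.
apply: ler_wpM2r; first exact: growth_ge0 (tpos t02).
exact: le_trans (ler_norm _) (ker_le L0 z0 (zr zr') sb').
Qed.

Lemma is_derive_Pz_curve (zf : R -> R) (t dz K d : R) : 0 < t < 2 -> 0 < d -> 0 <= K ->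
  (forall y, `|y| < d -> 0 < zf (t + y) < r) ->
  (forall y, `|y| < d -> `|zf (t + y) - zf t| <= K * `|y|) ->
  is_derive t 1 zf dz ->
  is_derive t 1 (fun u => Pz (zf u) u)
    (dz * Pzz (zf t) t +
     zf t * (hz (zf t) t * ((1 - zf t)^-1 + L ^+ 2 * Pzz (zf t) t))).
Proof.
move=> t02 d0 K0 zfr zfK dzf.
have zt : 0 < zf t < r by have := zfr 0; rewrite normr0 addr0; apply.
have /andP[zt0 ztr] := zt.
(* 2 bounds [ker2]. The other entry bounds its change along the curve: first order [12 B], Taylor
   constant [128 B^2], and a displacement of size at most 1, so that its square is no larger than
   itself. *)
pose C := Num.max 2 ((12 * B + 128 * B ^+ 2) * K).
have dI := @growth_moving (fun u s => ker2 L (zf u) s) t C d t02 d0.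
have {}dI : is_derive t 1 (fun u => \int[mu]_s (ker2 L (zf u) s * (S u s - S t s)))
    (\int[mu]_s (ker2 L (zf t) s * D t s)).
  apply: dI.
  - by rewrite le_max ler0n.
  - by move=> y; exact: measurable_ker2.
  - move=> y s /zfr/andP[z0 zr'] sb'.
    have /andP[k0 k1] := ker2_bound L0 z0 (zr (ltW zr')) sb'.
    by rewrite ger0_norm// le_max k1.
  - move=> y s yd sb'; have /andP[z0 zr'] := zfr _ yd; have zK := zfK _ yd.
    have zE : zf (t + y) = zf t + (zf (t + y) - zf t) by rewrite [RHS]addrC subrK.
    set e := zf (t + y) - zf t in zK zE.
    have T := @ker2_taylor (zf t) e s zt0 (ltW ztr); rewrite -zE in T.
    have {}T := T z0 (ltW zr') sb'.
    have /andP[kz0 kz1] := ker2z_bound zt0 (ltW ztr) sb'.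
    have e1 : `|e| <= 1 by have r1' := r1; rewrite /e ler_norml; apply/andP; split; lra.
    have h1 : e ^+ 2 <= `|e|.
      by rewrite -[e ^+ 2]ger0_norm ?sqr_ge0// normrX expr2 ler_piMl.
    have h2 : `|e * ker2z (zf t) s| <= 12 * B * `|e|.
      by rewrite normrM mulrC ler_wpM2r// ger0_norm.
    rewrite -[X in `|X|](subrK (e * ker2z (zf t) s)).
    apply: (le_trans (ler_normD _ _)); apply: (le_trans (lerD T h2)).
    apply: (@le_trans _ _ ((12 * B + 128 * B ^+ 2) * `|e|)).
      by have := ler_wpM2l (sqr_ge0 B) h1; lra.
    apply: (@le_trans _ _ ((12 * B + 128 * B ^+ 2) * K * `|y|)).
      rewrite -mulrA ler_wpM2l// addr_ge0// mulr_ge0 ?sqr_ge0//.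
    by rewrite ler_wpM2r// le_max lexx orbT.
have dP := is_derive_Pz t02 zt.
have dPc := @is_derive1_comp R (fun z => Pz z t) zf t _ _ dP dzf.
have dS := is_deriveD dI dPc.
have nr : \forall u \near t,
    ((fun u => \int[mu]_s (ker2 L (zf u) s * (S u s - S t s))) + ((fun z => Pz z t) \o zf)) u
    = Pz (zf u) u.
  have h1 : t \in `]0, 2[ by rewrite in_itv.
  have h2 : t \in `](t - d), (t + d)[ by rewrite in_itv/= ltrBlDr ltrDl d0.
  have n1 := near_in_itvoo h1; have n2 := near_in_itvoo h2.
  near=> u.
  have u02 : 0 < u < 2 by have : u \in `]0, 2[ by near: u; exact: n1.
  have ud : `|u - t| < d.
    have : u \in `](t - d), (t + d)[ by near: u; exact: n2.
    by rewrite in_itv/= ltr_norml => /andP[p1 p2]; apply/andP; split; lra.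
  have := zfr _ ud; rewrite addrC subrK => /andP[z0 /ltW zr'].
  rewrite fctE /= /Pz -RintegralD//; first last.
  - exact: integrable_ker2.
  - have := integrable_subr measurableT (integrable_ker2 u02 z0 zr') (integrable_ker2 t02 z0 zr').
    by apply: eq_integrable => // s _ /=; rewrite mulrBr.
  - by apply: eq_Rintegral => s _; rewrite mulrBr subrK.
apply: (is_derive_eq (near_eq_is_derive nr dS)).
by rewrite (growth_ker2 t02 zt) addrC mulrC.
Unshelve. all: by end_near. Qed.

(* Along [zeta u = z exp (L^2 h (1 - u))] with [h = hz z 1] the quantity
   [hz (zeta u) u] is constant: its distance [e] to [h] solves [e' = c e] with
   [c >= 0] and vanishes at time 1, so [e ^+ 2] is nonnegative, nondecreasing
   and zero at time 1. *)
Lemma hz_functional_eqn (z : R) : 0 < z -> z * expR (L ^+ 2 * 2) < r ->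
  hz z 1 * (1 - z * expR (L ^+ 2 * hz z 1)) = 1.
Proof.
move=> z0 zlt.
have one2 : 0 < (1 : R) < 2 by rewrite ltr01 ltr1n.
have L2 : 0 <= L ^+ 2 by exact: sqr_ge0.
have zr' : z <= r.
  rewrite (le_trans _ (ltW zlt))// ler_peMr ?(ltW z0)// -expR0 ler_expR mulr_ge0//.
set h := hz z 1.
have /andP[h0 h2] : 0 <= h <= 2 by exact: hz_bounds.
pose c := L ^+ 2 * h.
have c0 : 0 <= c by exact: mulr_ge0.
pose zf u := z * expR (c * (1 - u)).
(* Since [h <= 2], the assumption on [z] keeps the whole curve inside []0, r[], back to time 0
   included. *)
have zfr u : 0 <= u -> 0 < zf u < r.
  move=> u0; rewrite /zf mulr_gt0 ?expR_gt0//= (le_lt_trans _ zlt)// ler_wpM2l ?(ltW z0)//.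
  rewrite ler_expR /c -mulrA ler_wpM2l// -[leRHS]mulr1.
  apply: (@le_trans _ _ (h * 1)); last by rewrite ler_wpM2r.
  by rewrite ler_wpM2l// gerBl.
have zf1 : zf 1 = z by rewrite /zf subrr mulr0 expR0 mulr1.
have dzf (t : R) : is_derive t 1 zf (- (c * zf t)).
  have e1 : is_derive t 1 (fun u : R => 1 - u) (- 1).
    apply: (is_derive_eq (is_deriveB (is_derive_cst (1 : R) t 1) (is_derive_id t 1))).
    by rewrite sub0r.
  have e2 := is_deriveZ c e1.
  have e3 : is_derive (c * (1 - t)) 1 (@expR R) (expR (c * (1 - t))) by exact: is_derive_expR.
  have e4 := @is_derive1_comp R (@expR R) (fun u => c * (1 - u)) t _ _ e3 e2.
  have e5 := is_deriveZ z e4.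
  by apply: (is_derive_eq e5); rewrite /GRing.scale/= /zf; ring.
have zfK (t y : R) : 0 < t < 2 -> `|y| < Num.min t (2 - t) ->
    `|zf (t + y) - zf t| <= z * (c * expR (c * 2)) * `|y|.
  move=> /andP[t0 t2]; rewrite lt_min !ltr_norml => /andP[/andP[p1 p2] /andP[p3 p4]].
  rewrite /zf -mulrBr normrM (ger0_norm (ltW z0)) -mulrA ler_wpM2l ?(ltW z0)//.
  have := @expR_lip R 2 c (1 - (t + y)) (1 - t) c0.
  rewrite (_ : 1 - (t + y) - (1 - t) = - y); last by ring.
  by rewrite normrN; apply; rewrite ler_norml; apply/andP; split; lra.
pose H u := hz (zf u) u.
(* [rho u * H u] is the [z]-derivative of [hz] at the moving point. *)
pose rho u := (1 - zf u)^-1 + L ^+ 2 * Pzz (zf u) u.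
have dH (t : R) : 0 < t < 2 -> is_derive t 1 H (L ^+ 2 * zf t * rho t * H t * (H t - h)).
  move=> t02; have /andP[t0 t2] := t02; have /andP[zt0 ztr] := zfr _ (ltW t0).
  have d0 : 0 < Num.min t (2 - t) by rewrite lt_min t0 subr_gt0.
  have zn y : `|y| < Num.min t (2 - t) -> 0 < zf (t + y) < r.
    rewrite lt_min => /andP[]; rewrite ltr_norml => /andP[p1 p2] _; apply: zfr.
    by rewrite -(subrr t) lerD2l ltW.
  have K0 : 0 <= z * (c * expR (c * 2)).
    by rewrite mulr_ge0 ?(ltW z0)// mulr_ge0// expR_ge0.
  have dP := is_derive_Pz_curve t02 d0 K0 zn (fun y => zfK t y t02) (dzf t).
  have e2 := is_deriveZ (L ^+ 2) dP.
  have e3 : is_derive (L ^+ 2 * Pz (zf t) t) 1 (@expR R) (expR (L ^+ 2 * Pz (zf t) t)).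
    exact: is_derive_expR.
  have e4 := @is_derive1_comp R (@expR R) (fun u => L ^+ 2 * Pz (zf u) u) t _ _ e3 e2.
  have z1 : 1 - zf t != 0 by rewrite gt_eqF// subr_gt0 (lt_trans ztr).
  have e0 : is_derive t 1 (fun u : R => 1 - zf u) (c * zf t).
    apply: (is_derive_eq (is_deriveB (is_derive_cst (1 : R) t 1) (dzf t))).
    by rewrite sub0r opprK.
  have e1 := @is_deriveV R (fun u => 1 - zf u) t _ 1 z1 e0.
  have e5 := is_deriveM e1 e4.
  have nr : \forall u \near t, (1 - zf u)^-1 * expR (L ^+ 2 * Pz (zf u) u) = H u.
    have : t \in `]0, 2[ by rewrite in_itv.
    move=> /near_in_itvoo; apply: filterS => u; rewrite in_itv/= => u02.
    have /andP[q0 q1] := zfr u (ltW (tpos u02)).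
    by rewrite /H hzE// ltW.
  apply: (is_derive_eq (near_eq_is_derive nr e5)).
  rewrite /H /rho [hz (zf t) t]hzE ?(ltW ztr)// /GRing.scale/= -exprVn.
  by rewrite /c; ring.
have rho0 (t : R) : 0 < t < 2 -> 0 <= rho t.
  move=> t02; have /andP[zt0 ztr] := zfr _ (ltW (tpos t02)).
  rewrite /rho addr_ge0//; last by rewrite mulr_ge0// Pzz_ge0// ltW.
  by rewrite invr_ge0 subr_ge0 (le_trans (ltW ztr))// ltW.
have H0 (t : R) : 0 < t < 2 -> 0 <= H t.
  move=> t02; have /andP[zt0 ztr] := zfr _ (ltW (tpos t02)).
  by have /andP[] := hz_bounds t02 zt0 (ltW ztr).
pose E u := (H u - h) ^+ 2.
have dE (t : R) : 0 < t < 2 ->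
    is_derive t 1 E (2 * (L ^+ 2 * zf t * rho t * H t) * (H t - h) ^+ 2).
  move=> t02; have d1 := is_deriveB (dH t t02) (is_derive_cst h t 1).
  apply: (is_derive_eq (is_deriveM d1 d1)); rewrite /GRing.scale/= !fctE subr0.
  by ring.
have HE (t : R) : 0 < t -> t < 1 -> H t = h.
  move=> t0 t1.
  have in02 x : x \in `[t, 1] -> 0 < x < 2.
    rewrite in_itv/= => /andP[tx x1]; rewrite (lt_le_trans t0)//=.
    by rewrite (le_lt_trans x1)// ltr1n.
  have sub x : x \in `]t, 1[ -> x \in `[t, 1].
    by rewrite !in_itv/= => /andP[/ltW-> /ltW->].
  have : E t <= E 1.
    apply: (@ger0_derive1_ndecr R E t 1) => //.
    - by move=> x /sub/in02/dE h'; exact: ex_derive.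
    - move=> x /sub/in02 x02; have h' := dE x x02; rewrite derive1E derive_val.
      have /andP[q0 _] := zfr x (ltW (tpos x02)).
      apply: mulr_ge0; last exact: sqr_ge0.
      apply: mulr_ge0; first exact: ler0n.
      exact: mulr_ge0 (mulr_ge0 (mulr_ge0 L2 (ltW q0)) (rho0 x x02)) (H0 x x02).
    - apply: continuous_in_subspaceT => x; rewrite inE/= => /in02/dE h'.
      apply: differentiable_continuous; apply/derivable1_diffP; exact: ex_derive.
    - exact: ltW.
  have H1 : H 1 = h by rewrite /H zf1.
  have -> : E 1 = 0 by rewrite /E H1 subrr expr0n.
  rewrite /E => e0.
  have /eqP : (H t - h) ^+ 2 = 0 by apply/eqP; rewrite eq_le e0 sqr_ge0.
  by rewrite sqrf_eq0 subr_eq0 => /eqP.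
(* Time 0 is reached along these times, all below 1: there [Pz] is at most [2 * tau n], so the
   exponential tends to 1. *)
pose tau (n : nat) : R := n.+2%:R^-1.
have tau0 n : 0 < tau n by rewrite invr_gt0.
have tau1 n : tau n < 1 by rewrite invf_lt1// ltr1n.
have tauc : tau n @[n --> \oo] --> 0.
  have := @cvg_harmonic R; rewrite -(cvg_shiftS (@harmonic R)).
  by apply: cvg_trans; apply: near_eq_cvg; apply: nearW => n.
have eqn n : h * (1 - zf (tau n)) = expR (L ^+ 2 * Pz (zf (tau n)) (tau n)).
  have t02 : 0 < tau n < 2 by rewrite tau0 (lt_trans (tau1 n))// ltr1n.
  have /andP[q0 q1] := zfr _ (ltW (tau0 n)).
  rewrite -{1}(HE _ (tau0 n) (tau1 n)) /H hzE ?(ltW q1)// mulrAC mulVf ?mul1r//.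
  by rewrite gt_eqF// subr_gt0 (lt_trans q1).
have c1 : h * (1 - zf (tau n)) @[n --> \oo] --> h * (1 - z * expR c).
  apply: cvgM; first exact: cvg_cst.
  apply: cvgB; first exact: cvg_cst.
  have -> : z * expR c = zf 0 by rewrite /zf subr0 mulr1.
  apply: (@cvg_comp _ _ _ tau zf _ (nbhs (0 : R)) _ tauc).
  have h' := dzf 0; apply: differentiable_continuous; apply/derivable1_diffP; exact: ex_derive.
have c2 : expR (L ^+ 2 * Pz (zf (tau n)) (tau n)) @[n --> \oo] --> expR (0 : R).
  apply: (@cvg_comp _ _ _ (fun n => L ^+ 2 * Pz (zf (tau n)) (tau n)) (@expR R)); last exact: continuous_expR.
  have : L ^+ 2 * Pz (zf (tau n)) (tau n) @[n --> \oo] --> L ^+ 2 * 0; last by rewrite mulr0.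
  apply: cvgM; first exact: cvg_cst.
  apply: (@squeeze_cvgr _ _ _ _ (cst 0) (fun n => 2 * tau n)).
  - apply: nearW => n; have t02 : 0 < tau n < 2 by rewrite tau0 (lt_trans (tau1 n))// ltr1n.
    have /andP[q0 q1] := zfr _ (ltW (tau0 n)).
    exact: Pz_bounds t02 q0 (ltW q1).
  - exact: cvg_cst.
  - by rewrite -[X in _ --> X](mulr0 2); apply: cvgM; [exact: cvg_cst|].
rewrite expR0 in c2; rewrite (_ : (fun n => _) = (fun n => expR (L ^+ 2 * Pz (zf (tau n)) (tau n)))) in c1.
  exact: cvg_unique c1 c2.
exact/funext.
Qed.

Lemma charge_functional_eqn : exists2 zs, 0 < zs & forall z, 0 < z < zs ->
  let h := (1 - z)^-1 * expR (- (L * \int[mu]_s ((1 - z * expR (L * s))^-1 * derive1 (S 1) s))) in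
  h * (1 - z * expR (L ^+ 2 * h)) = 1.
Proof.
have e0 : 0 < expR (L ^+ 2 * 2) by exact: expR_gt0.
exists (r / expR (L ^+ 2 * 2)) => [|z /andP[z0]]; first by rewrite divr_gt0.
rewrite ltr_pdivlMr// => zlt /=.
have one2 : 0 < (1 : R) < 2 by rewrite ltr01 ltr1n.
rewrite -growth_eqn//; first exact: hz_functional_eqn.
rewrite (ltW z0)//= (le_trans _ (ltW zlt))// ler_peMr ?(ltW z0)// -expR0 ler_expR.
by rewrite mulr_ge0// sqr_ge0.
Qed.

End burgers.

Lemma growth_functional_eqn : exists2 zs, 0 < zs & forall z, 0 < z < zs ->
  let h := (1 - z)^-1 * expR (- (L * \int[mu]_s ((1 - z * expR (L * s))^-1 * derive1 (S 1) s))) in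
  h * (1 - z * expR (L ^+ 2 * h)) = 1.
Proof. by have [b b0 bs] := uniform_support; exact: (charge_functional_eqn b0 bs). Qed.

End growth.

(** * Area, centring and scaling of diagrams *)

Section diagrams.
Context {R : realType}.
Notation mu := (@lebesgue_measure R).
Implicit Types (v : R -> R).

Lemma diagram_areaE v : diagram_area v =
  (2^-1%:E * \int[mu]_s (Num.max 0 (v s - `|s|))%:E)%E.
Proof.
rewrite /diagram_area /product_measure1; congr (_ * _)%E.
apply: eq_integral => s _ /=.
rewrite (_ : xsection _ s = `[`|s|, v s[%classic); last first.
  by apply/seteqP; split => y; rewrite /xsection /= inE /subgraph /= in_itv.
have /= -> := @lebesgue_measure_itv R `[`|s|, v s[.
rewrite lte_fin; case: ltP => h; last by rewrite max_l// subr_le0.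
by rewrite -EFinB max_r// subr_ge0 ltW.
Qed.

Lemma measurable_height v : (forall x y, `|v x - v y| <= `|x - y|) ->
  measurable_fun setT (fun s : R => (Num.max 0 (v s - `|s|))%:E).
Proof.
move=> vl; apply/measurable_EFinP; apply: measurable_maxr => //.
rewrite (_ : (fun s => _) = (fun s => 2 * diagram_charge v s)).
  by apply: measurable_funM => //; exact: (@measurable_charge R v vl).
by apply/funext => s; rewrite /diagram_charge mulrCA divff// mulr1.
Qed.

(** If [s0] were nonzero, [v s - |s|] would equal [|s0|] all the way to infinity on one side. An
    interval of length [4 / |s0|] there already gives integral 4, hence area at least 2. *)
Lemma diagram_area1_out v : continual_diagram v -> diagram_area v = 1%E ->
  exists2 M, 0 < M & forall s, M <= `|s| -> v s = `|s|.
Proof.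
move=> [vl [s0 [M HM]]] v1; exists (Num.max 1 M); first by rewrite lt_max ltr01.
move=> s; rewrite ge_max => /andP[_ Ms]; rewrite HM//.
suff -> : s0 = 0 by rewrite subr0.
apply/eqP/negPn/negP => s00.
have mf : measurable_fun setT (fun s : R => (Num.max 0 (v s - `|s|))%:E).
  exact: measurable_height.
have f0 (x : R) : (0 <= (Num.max 0 (v x - `|x|))%:E)%E by rewrite lee_fin le_max lexx.
pose N := Num.max 0 M + `|s0|; pose K := 4 / `|s0|.
have n0 : 0 < `|s0| by rewrite normr_gt0.
have K0 : 0 < K by rewrite divr_gt0.
have [a Ha] : exists a : R, forall s, a <= s <= a + K -> `|s0| <= v s - `|s|.
  have [s0p|s0n] := leP 0 s0.
    exists (- N - K) => x; rewrite subrK => /andP[_ xN].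
    have x0 : x <= 0 by rewrite (le_trans xN)// oppr_le0 addr_ge0// le_max lexx.
    have Mx : M <= `|x|.
      rewrite ler0_norm// lerNr (le_trans xN)// lerN2 (@le_trans _ _ (Num.max 0 M))//.
        by rewrite le_max lexx orbT.
      by rewrite lerDl.
    rewrite HM// (ger0_norm s0p) (ler0_norm x0) ler0_norm ?subr_le0 ?(le_trans x0)//; lra.
  exists N => x /andP[Nx _].
  have x0 : 0 <= x by rewrite (le_trans _ Nx)// addr_ge0// le_max lexx.
  have Mx : M <= `|x|.
    rewrite ger0_norm// (le_trans _ Nx)// (@le_trans _ _ (Num.max 0 M))//.
      by rewrite le_max lexx orbT.
    by rewrite lerDl.
  rewrite HM// (ger0_norm x0) (ltr0_norm s0n) ger0_norm; last by rewrite subr_ge0 (le_trans (ltW s0n)).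
  lra.
pose I : set R := `[a, a + K]%classic.
have h1 : (\int[mu]_(s in I) cst `|s0|%:E s <=
           \int[mu]_s (Num.max 0 (v s - `|s|))%:E)%E.
  apply: (@le_trans _ _ (\int[mu]_(s in I) (Num.max 0 (v s - `|s|))%:E)%E).
    apply: ge0_le_integral => //.
    - exact: measurable_itv.
    - by move=> x _; rewrite lee_fin.
    - exact: measurable_funTS.
    - move=> x; rewrite /I /= in_itv/= => /Ha h; rewrite lee_fin le_max h orbT//.
  apply: (@ge0_subset_integral _ (measurableTypeR R) R mu I setT) => //.
  exact: measurable_itv.
have mI : mu I = K%:E.
  rewrite /I lebesgue_measure_itv/= lte_fin ltrDl K0 -EFinB.
  by rewrite addrAC subrr add0r.
have {}h1 : (4%:E <= \int[mu]_s (Num.max 0 (v s - `|s|))%:E)%E.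
  rewrite integral_cst in h1; last exact: measurable_itv.
  have := eq_ind _ (fun m => (_ * m <= _)%E) h1 _ mI; rewrite -EFinM.
  by rewrite (_ : `|s0| * K = 4)// /K mulrCA divff ?mulr1// gt_eqF.
have : (2^-1%:E * 4%:E <= 2^-1%:E * \int[mu]_s (Num.max 0 (v s - `|s|))%:E)%E.
  by apply: lee_wpmul2l => //; rewrite lee_fin.
rewrite -diagram_areaE v1 -EFinM lee_fin; lra.
Qed.

Lemma charge_area1 v (b : R) : 0 < b -> (forall x y, `|v x - v y| <= `|x - y|) ->
  (forall s, b <= `|s| -> v s = `|s|) -> diagram_area v = 1%E ->
  (\int[mu]_s (diagram_charge v s)%:E = 1)%E.
Proof.
move=> b0 vl vo; rewrite diagram_areaE => v1; rewrite -v1.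
have mc : measurable_fun setT (fun s => (diagram_charge v s)%:E).
  by apply/measurable_EFinP; exact: (@measurable_charge R v vl).
rewrite -ge0_integralZl//; last 2 first.
- exact: measurable_height.
- by move=> s _; rewrite lee_fin le_max lexx.
apply: eq_integral => s _; rewrite -EFinM; congr EFin.
have c0 := @charge_ge0 R v b b0 vl vo s.
rewrite max_r; first by rewrite /diagram_charge mulrC.
by move: c0; rewrite /diagram_charge pmulr_lge0// invr_gt0.
Qed.

Lemma charge_scale v (c s : R) : 0 < c ->
  diagram_charge (fun s => c * v (s / c)) s = c * diagram_charge v (s / c).
Proof.
move=> c0; rewrite /diagram_charge mulrA; congr (_ / _); rewrite mulrBr; congr (_ - _).
by rewrite normrM [`|c^-1|]gtr0_norm ?invr_gt0// mulrCA divff ?mulr1// gt_eqF.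
Qed.

(** Height and width both scale by [c]; with [c] the square root of [t] this is the mass [t] of the
    auto-model. *)
Lemma Rintegral_charge_scale v (b c : R) : 0 < b -> 0 < c ->
  (forall x y, `|v x - v y| <= `|x - y|) -> (forall s, b <= `|s| -> v s = `|s|) ->
  diagram_area v = 1%E ->
  \int[mu]_s diagram_charge (fun s => c * v (s / c)) s = c ^+ 2.
Proof.
move=> b0 c0 vl vo v1; have E := charge_area1 b0 vl vo v1.
pose F (s : R) := c^-1 * s.
have dF (s : R) : is_derive s 1 F c^-1.
  by apply: (is_derive_eq (is_deriveZ c^-1 (is_derive_id s 1))); rewrite /GRing.scale/= mulr1.
have F' : derive1 F = cst c^-1 by apply/funext => s; rewrite derive1E; have h := dF s; rewrite derive_val.
have sub := @increasing_ge0_integration_by_substitutionT R F (diagram_charge v).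
have {}sub : (\int[mu]_x (diagram_charge v x)%:E =
    \int[mu]_x (((diagram_charge v \o F) * derive1 F) x)%:E)%E.
  apply: sub; rewrite ?F'.
  - by move=> x y xy; rewrite /F ltr_pM2l// invr_gt0.
  - by move=> x; exact: cvg_cst.
  - exact: is_cvg_cst.
  - exact: is_cvg_cst.
  - by move=> x; have h := dF x; exact: ex_derive.
  - by apply: gt0_cvgMrNy; [rewrite invr_gt0|exact: cvg_id].
  - by apply: gt0_cvgMry; [rewrite invr_gt0|exact: cvg_id].
  - exact: charge_continuous.
  - exact: charge_ge0 b0 vl vo.
rewrite E F' in sub.
have I : \int[mu]_s (c^-1 * diagram_charge v (c^-1 * s)) = 1.
  rewrite /Rintegral (_ : \int[mu]_s _ = 1)%E// sub.
  by apply: eq_integral => s _; rewrite /F fctE /= mulrC.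
have bs s : b * c <= `|s| -> b <= `|s / c|.
  by rewrite normrM [`|c^-1|]gtr0_norm ?invr_gt0// ler_pdivlMr.
have i1 : mu.-integrable setT (EFin \o (fun s => c^-1 * diagram_charge v (c^-1 * s))).
  have vl' x y : `|c * v (x / c) - c * v (y / c)| <= `|x - y|.
    rewrite -mulrBr normrM gtr0_norm// mulrC -ler_pdivlMr//.
    apply: (le_trans (vl _ _)); rewrite -mulrBl normrM [`|c^-1|]gtr0_norm ?invr_gt0//.
  have vo' s : b * c <= `|s| -> c * v (s / c) = `|s|.
    move=> /bs/vo ->; rewrite normrM [`|c^-1|]gtr0_norm ?invr_gt0// mulrCA divff ?mulr1// gt_eqF//.
  have bc0 : 0 < b * c by rewrite mulr_gt0.
  have := integrableZl measurableT (c^-1 * c^-1) (integrable_charge bc0 vl' vo').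
  apply: eq_integrable => // s _ /=; rewrite -EFinM charge_scale// [s / c]mulrC.
  by rewrite mulrA mulfVK// gt_eqF.
rewrite -[RHS]mulr1 -I -RintegralZl//; apply: eq_Rintegral => s _.
by rewrite charge_scale// expr2 -mulrA mulVKf ?gt_eqF// [s / c]mulrC.
Qed.

(** An infinite positive or negative part would make the extended integral infinite. This is how an
    equation between extended reals carries integrability. *)
Lemma integral_finite_integrable (f : R -> R) (c : R) : measurable_fun setT f ->
  (\int[mu]_s (f s)%:E = c%:E)%E -> mu.-integrable setT (EFin \o f).
Proof.
move=> mf; rewrite integralE => E; apply/integrableP; split; first exact/measurable_EFinP.
have mE : measurable_fun setT (EFin \o f) by exact/measurable_EFinP.
have p0 : (0 <= \int[mu]_s ((EFin \o f)^\+ s))%E by exact: integral_ge0.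
have n0 : (0 <= \int[mu]_s ((EFin \o f)^\- s))%E by exact: integral_ge0.
have -> : (\int[mu]_s `|(EFin \o f) s| = \int[mu]_s ((EFin \o f)^\+ s + (EFin \o f)^\- s))%E.
  by apply: eq_integral => s _; exact: (congr1 (@^~ s) (fune_abse (EFin \o f))).
rewrite ge0_integralD//; first last.
- exact: measurable_funeneg.
- exact: measurable_funepos.
have {}E : (\int[mu]_s ((EFin \o f)^\+ s) - \int[mu]_s ((EFin \o f)^\- s) = c%:E)%E := E.
move: E p0 n0; case: (\int[mu]_s ((EFin \o f)^\+ s))%E => [p| |]; case: (\int[mu]_s ((EFin \o f)^\- s))%E => [n| |]//=.
by rewrite -EFinD ltry.
Qed.

End diagrams.

(** * Powers of q as exponentials *)

Section q_exponentials.
Context {R : realType} (q : R).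
Hypothesis q01 : 0 < q < 1.
Local Notation L := (ln q^-1).

Let q0 : 0 < q. Proof. by case/andP: q01. Qed.

Lemma lnV_gt0 : 0 < L.
Proof. by have /andP[_ q1] := q01; rewrite ln_gt0// invf_gt1. Qed.

Lemma powR_ln (x : R) : q `^ x = expR (- (L * x)).
Proof. by rewrite /powR gt_eqF// lnV ?posrE// mulNr opprK mulrC. Qed.

Lemma powR_sub (x s : R) : q `^ (x - s) = q `^ x * expR (L * s).
Proof. by rewrite !powR_ln -expRD; congr expR; ring. Qed.

Lemma powR_lt1 (x : R) : 0 < x -> 0 < q `^ x < 1.
Proof. by move=> x0; rewrite powR_gt0//= powR_ln expR_lt1 oppr_lt0 mulr_gt0// lnV_gt0. Qed.

Lemma powR_surj (z : R) : 0 < z -> q `^ (- (ln z / L)) = z.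
Proof.
move=> z0; rewrite powR_ln mulrN opprK mulrCA divff ?mulr1 ?lnK ?posrE//.
by rewrite gt_eqF// lnV_gt0.
Qed.

End q_exponentials.

(** * The auto-model as a growing charge *)

Section auto_models.
Context {R : realType} (w : R -> R -> R).
Notation mu := (@lebesgue_measure R).
Hypothesis w_diagram : forall q : R, 0 < q < 1 -> continual_diagram (w q).
Hypothesis w_area : forall q : R, 0 < q < 1 -> diagram_area (w q) = 1%E.

(** Rescaling both axes by the square root of [t] preserves slopes; the diagram rescaled is that of
    parameter q^(sqrt t), which again lies in []0, 1[]. *)
Lemma auto_model_lip (q t x y : R) : 0 < q < 1 -> 0 < t ->
  `|auto_model w q t x - auto_model w q t y| <= `|x - y|.
Proof.
move=> q01 t0; have c0 : 0 < Num.sqrt t by rewrite sqrtr_gt0.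
have [vl _] := w_diagram (powR_lt1 q01 c0).
rewrite /auto_model -mulrBr normrM gtr0_norm// mulrC -ler_pdivlMr//.
by apply: (le_trans (vl _ _)); rewrite -mulrBl normrM [`|_^-1|]gtr0_norm ?invr_gt0.
Qed.

Lemma auto_model_out (q t : R) : 0 < q < 1 -> 0 < t ->
  exists2 M, 0 < M & forall s, M <= `|s| -> auto_model w q t s = `|s|.
Proof.
move=> q01 t0; have c0 : 0 < Num.sqrt t by rewrite sqrtr_gt0.
have p01 := powR_lt1 q01 c0.
have [M M0 HM] := diagram_area1_out (w_diagram p01) (w_area p01).
exists (M * Num.sqrt t) => [|s Ms]; first by rewrite mulr_gt0.
have e : `|s / Num.sqrt t| = `|s| / Num.sqrt t.
  by rewrite normrM [`|_^-1|]gtr0_norm ?invr_gt0.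
rewrite /auto_model HM; first by rewrite e mulrCA divff ?mulr1// gt_eqF.
by rewrite e ler_pdivlMr.
Qed.

Lemma Rintegral_auto_charge (q t : R) : 0 < q < 1 -> 0 < t ->
  \int[mu]_s auto_charge w q t s = t.
Proof.
move=> q01 t0; have c0 : 0 < Num.sqrt t by rewrite sqrtr_gt0.
have p01 := powR_lt1 q01 c0.
have [M M0 HM] := diagram_area1_out (w_diagram p01) (w_area p01).
have [vl _] := w_diagram p01.
have := Rintegral_charge_scale M0 c0 vl HM (w_area p01).
by rewrite sqr_sqrtr// ltW.
Qed.

Lemma auto_model1 (q : R) : 0 <= q -> auto_model w q 1 = w q.
Proof.
by move=> q0; apply/funext => s; rewrite /auto_model sqrtr1 mul1r divr1 powRr1.
Qed.

Hypothesis w_derivable : forall q t s : R, 0 < q < 1 -> 0 < t ->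
     derivable (fun u : R => auto_charge w q u s) t 1.
Hypothesis w_equation : forall q t : R, 0 < q < 1 -> 0 < t ->
     exists a b : R,
       [/\ fsupp (ds_charge w q t) `<=` `[a, b],
           fsupp (dt_charge w q t) `<=` `[a, b] &
           forall x : R, x \notin `[a, b] ->
             (\int[lebesgue_measure]_s
                ((1 - q `^ (x - s))^-1 * dt_charge w q t s)%:E)%E =
             ((1 - q `^ x)^-1 *
              expR (- (ln q^-1 *
                \int[lebesgue_measure]_s
                  ((1 - q `^ (x - s))^-1 * ds_charge w q t s))))%:E].

Lemma fsupp_out (f : R -> R) (A : set R) s : fsupp f `<=` A -> ~ A s -> f s = 0.
Proof.
move=> fA nA; apply: contrapT => /eqP fs; apply: nA; apply: fA.
exact: subset_closure.
Qed.

Lemma measurable_dt_charge (q t : R) : 0 < q < 1 -> 0 < t ->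
  measurable_fun setT (dt_charge w q t).
Proof.
move=> q01 t0.
have mS (u : R) : 0 < u -> measurable_fun setT (auto_charge w q u).
  by move=> u0; apply: measurable_charge => x y; exact: auto_model_lip.
apply: (@measurable_fun_cvg _ _ _ _
  (fun n s => diff_quotient (fun u => auto_charge w q u s) n.+1%:R^-1 t)).
  move=> n; rewrite /diff_quotient; apply: measurable_funM => //; apply: measurable_funB.
    by apply: mS; rewrite addr_gt0.
  exact: mS.
by move=> s _; apply: diff_quotient_seq; exact: w_derivable.
Qed.

(** At [x = b + 1] the equation makes the kernel times [dt_charge] integrable, and on the support
    the inverse of the kernel lies in []0, 1[]. *)
Lemma integrable_dt_charge (q t : R) : 0 < q < 1 -> 0 < t ->
  mu.-integrable setT (EFin \o dt_charge w q t).
Proof.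
move=> q01 t0; have [a [b [_ supD eqn]]] := w_equation q01 t0.
pose x := b + 1.
have xab : x \notin `[a, b] by rewrite in_itv/= negb_and -!ltNge ltrDl ltr01 orbT.
have mD := measurable_dt_charge q01 t0.
have mk : measurable_fun setT (fun s : R => 1 - q `^ (x - s)).
  under eq_fun do rewrite powR_sub//.
  by apply: measurable_funB => //; apply: measurable_funM => //; exact: measurable_expM.
have mki : measurable_fun setT (fun s : R => (1 - q `^ (x - s))^-1).
  exact: (measurableT_comp (@measurable_inv R) mk).
have iF := integral_finite_integrable (measurable_funM mki mD) (eqn x xab).
have D0 s : dt_charge w q t s != 0 -> 0 < q `^ (x - s) < 1.
  move=> Ds; apply: powR_lt1 => //; rewrite subr_gt0.
  have : `[a, b]%classic s by apply: contrapT => /(fsupp_out supD) h; rewrite h eqxx in Ds.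
  by rewrite /= in_itv/= => /andP[_ sb]; rewrite (le_lt_trans sb)// ltrDl.
have := @integrable_mul_bounded _ _ _ 1 iF mk; set f := EFin \o _.
have -> : f = EFin \o dt_charge w q t.
  apply/funext => s; rewrite /f /=; congr EFin.
  have [->|/D0/andP[h1 h2]] := eqVneq (dt_charge w q t s) 0; first by rewrite !mulr0.
  by rewrite mulVKf// gt_eqF// subr_gt0.
apply => s; rewrite /= mulf_eq0 negb_or => /andP[_ /D0/andP[h1 h2]].
by rewrite ger0_norm ?subr_ge0 ?(ltW h2)// gerBl ltW.
Qed.

(** The growth results are applied to the auto-model, whose value at time 1 is [w q]. The
    substitution [z = q^x] turns q^(x - s) into [z e^(Ls)]. *)
Lemma auto_model_functional_eqn (q : R) (L := ln q^-1) : 0 < q < 1 ->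
  exists2 zs, 0 < zs & forall z, 0 < z < zs ->
    let h := (1 - z)^-1 * expR (- (L * \int[mu]_s ((1 - z * expR (L * s))^-1 *
      derive1 (diagram_charge (w q)) s))) in
    h * (1 - z * expR (L ^+ 2 * h)) = 1.
Proof.
move=> q01; have L0 : 0 < L by exact: lnV_gt0.
have := @growth_functional_eqn R L (auto_model w q) L0.
have q0 : 0 <= q by case/andP: q01 => /ltW.
rewrite auto_model1//; apply.
- by move=> t x y t0; exact: auto_model_lip.
- by move=> t t0; exact: auto_model_out.
- by move=> t t0; exact: Rintegral_auto_charge.
- by move=> t s t0; exact: w_derivable.
- by move=> t t0; exact: integrable_dt_charge.
move=> t t0; have [a [b [_ supD eqn]]] := w_equation q01 t0.
(* [z < q^b] says that the corresponding [x] lies to the right of [b]; the first witness bounds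
   [[a, b]] in absolute value. *)
exists (Num.max `|a| `|b|), (q `^ b); split; first by rewrite powR_gt0//; case/andP: q01.
  move=> s; rewrite gt_max => /andP[sa sb]; apply: (fsupp_out supD).
  rewrite /= in_itv/= => /andP[as' sb'].
  have [s0|s0] := leP 0 s.
    by move: sb; rewrite (ger0_norm s0) ltNge (le_trans sb')// ler_norm.
  move: sa; rewrite (ltr0_norm s0) ltNge => /negP; apply.
  by rewrite lerNl (le_trans _ as')// lerNl -normrN ler_norm.
move=> z /andP[z0 zb].
pose x := - (ln z / L).
have zE : q `^ x = z by exact: powR_surj.
have xab : x \notin `[a, b].
  rewrite in_itv/= negb_and -!ltNge; apply/orP; right.
  by move: zb; rewrite -zE !powR_ln// ltr_expR ltrN2 ltr_pM2l.
have := eqn x xab; rewrite zE => /(congr1 fine) /=.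
under eq_integral do rewrite powR_sub// zE.
have -> : \int[mu]_s ((1 - q `^ (x - s))^-1 * ds_charge w q t s) =
    \int[mu]_s ((1 - z * expR (L * s))^-1 * derive1 (diagram_charge (auto_model w q t)) s).
  by apply: eq_Rintegral => s _; rewrite powR_sub// zE.
by move=> E; exact: E.
Qed.

End auto_models.

(** * The transform of a diagram and what it determines *)

Section diagram_transform.
Context {R : realType}.
Notation mu := (@lebesgue_measure R).
Implicit Types (v : R -> R) (L : R).

(** Up to the factor [1 - q], the q-deformed R-function in the variable [z = q^x]. *)
Definition qtransform L v (z : R) : R := (1 - z)^-1 *
  expR (- (L * \int[mu]_s ((1 - z * expR (L * s))^-1 * derive1 (diagram_charge v) s))).

Lemma qtransform_inj L v y (z : R) : 0 < L -> z < 1 -> qtransform L v z = qtransform L y z ->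
  \int[mu]_s ((1 - z * expR (L * s))^-1 * derive1 (diagram_charge v) s) =
  \int[mu]_s ((1 - z * expR (L * s))^-1 * derive1 (diagram_charge y) s).
Proof.
move=> L0 z1; have n1 : (1 - z)^-1 != 0 by rewrite invr_eq0 gt_eqF// subr_gt0.
move=> E; exact: (mulfI (lt0r_neq0 L0) (oppr_inj (expR_inj (mulfI n1 E)))).
Qed.

Lemma heightE v : (fun u => v u - `|u|) = 2 \*: diagram_charge v.
Proof. by apply/funext => u; rewrite /diagram_charge /GRing.scale/= [RHS]mulrC divfK. Qed.

(** Where the derivative fails to exist both sides take the default value 0, so the identity holds
    at every point. *)
Lemma derive1_height v (s : R) :
  derive1 (fun u => v u - `|u|) s = 2 * derive1 (diagram_charge v) s.
Proof.
rewrite heightE; have [dv|ndv] := pselect (derivable (diagram_charge v) s 1).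
  by rewrite !derive1E deriveZ.
rewrite !derive1_not_derivable ?mulr0// => d; apply: ndv.
have d' : derivable (2^-1 \*: (2 \*: diagram_charge v)) s 1 by exact: derivableZ.
rewrite (_ : diagram_charge v = 2^-1 \*: (2 \*: diagram_charge v)); first exact: d'.
apply/funext => u; change (diagram_charge v u = 2^-1 * (2 * diagram_charge v u)).
by rewrite mulKf.
Qed.

(** Uniqueness is tested against diagrams of arbitrary centre [s0], whose charge takes opposite
    constant values at the two ends. *)
Lemma diagram_tail v : continual_diagram v -> exists N s0 : R, [/\ 0 < N,
  forall s, N <= s -> diagram_charge v s = - s0 / 2 &
  forall s, s <= - N -> diagram_charge v s = s0 / 2].
Proof.
move=> [_ [s0 [M HM]]]; pose N := Num.max 1 (Num.max M `|s0|).
have N0 : 0 < N by rewrite lt_max ltr01.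
have [h1 h2] : M <= N /\ `|s0| <= N by rewrite !le_max !lexx !orbT.
move: h2; rewrite ler_norml => /andP[h2 h3].
exists N, s0; split => // s Ns.
  have s1 : 0 <= s by lra.
  rewrite /diagram_charge HM; last by rewrite ger0_norm// (le_trans h1).
  rewrite (ger0_norm s1) ger0_norm; last by lra.
  by congr (_ / _); ring.
have s1 : s <= 0 by lra.
rewrite /diagram_charge HM; last by rewrite ler0_norm// lerNr (le_trans Ns)// lerN2.
rewrite (ler0_norm s1) ler0_norm; last by lra.
by congr (_ / _); ring.
Qed.

Lemma diagram_dcharge_out v (N s0 : R) :
  (forall s, N <= s -> diagram_charge v s = - s0 / 2) ->
  (forall s, s <= - N -> diagram_charge v s = s0 / 2) ->
  forall s, N < `|s| -> derive1 (diagram_charge v) s = 0.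
Proof.
move=> h1 h2 s; rewrite ltr_normr => /orP[sN|]; last rewrite ltrNr => sN.
  have /near_in_itvoy n : s \in `]N, +oo[ by rewrite in_itv/= sN.
  apply: (@near_cst_derive1 R _ _ (- s0 / 2)); apply: filterS n => t.
  by rewrite in_itv/= andbT => /ltW; exact: h1.
have /near_in_itvNyo n : s \in `]-oo, (- N)[ by rewrite in_itv.
apply: (@near_cst_derive1 R _ _ (s0 / 2)); apply: filterS n => t.
by rewrite in_itv/= => /ltW; exact: h2.
Qed.

Lemma integrable_diagram_dcharge v (N : R) : (forall x y, `|v x - v y| <= `|x - y|) ->
  (forall s, N < `|s| -> derive1 (diagram_charge v) s = 0) ->
  mu.-integrable setT (EFin \o derive1 (diagram_charge v)).
Proof.
move=> vl out; apply: (integrable_support (measurable_dcharge vl) out).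
exact: (bounded_integrable_itv _ _ (measurable_dcharge vl) (dcharge_le vl)).
Qed.

(** Equal increments make the difference of the charges constant. As each charge has opposite values
    at [N] and [- N], that constant equals its own negative. *)
Lemma diagram_ext v y : continual_diagram v -> continual_diagram y ->
  (forall c d, c <= d -> \int[mu]_(s in `[c, d])
     (derive1 (diagram_charge v) s - derive1 (diagram_charge y) s) = 0) -> v = y.
Proof.
move=> vd yd I0; have [vl _] := vd; have [yl _] := yd.
have [N1 [s1 [N10 t1 t2]]] := diagram_tail vd.
have [N2 [s2 [N20 t3 t4]]] := diagram_tail yd.
have iv := integrable_diagram_dcharge vl (diagram_dcharge_out t1 t2).
have iy := integrable_diagram_dcharge yl (diagram_dcharge_out t3 t4).
pose f s := diagram_charge v s - diagram_charge y s.
have fE c d : c <= d -> f d = f c.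
  move=> cd; have := I0 c d cd.
  rewrite RintegralB//; last 2 first.
  - exact: integrableS iv.
  - exact: integrableS iy.
  rewrite (lipschitz_FTC cd ler01 (charge_lip vl)) (lipschitz_FTC cd ler01 (charge_lip yl)).
  by rewrite /f => h; lra.
have [N [N0 N1N N2N]] : exists N, [/\ 0 <= N, N1 <= N & N2 <= N].
  by exists (Num.max N1 N2); rewrite !le_max !lexx (ltW N10) orbT.
have fN : f N = f (- N) by apply: fE; lra.
have f0 : f N = 0.
  have : f N = - f (- N).
    by rewrite /f t1// t3// t2 ?lerN2// t4 ?lerN2//; lra.
  by rewrite -fN; lra.
apply/funext => s.
have : f s = 0.
  have [sN|/ltW Ns] := leP s N; first by rewrite -(fE _ _ sN).
  by rewrite (fE _ _ Ns).
by rewrite /f /diagram_charge => h; lra.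
Qed.

(** * The equation of Omega: uniqueness, and its validity for all admissible x *)

Section omega.
Variable q : R.
Hypothesis q01 : 0 < q < 1.
Local Notation L := (ln q^-1).

(** The differential of [v s - |s|] is twice that of the charge, which cancels the factor 1/2 in
    front. [beta < x] keeps [z e^(Ls)] away from 1 on the support. *)
Lemma qR_functionE v (x beta : R) : beta < x ->
  mu.-integrable setT (EFin \o derive1 (diagram_charge v)) ->
  (forall s, derive1 (diagram_charge v) s != 0 -> s <= beta) ->
  qR_function v x q = (1 - q) * qtransform L v (q `^ x).
Proof.
move=> bx iv vb; have L0 := lnV_gt0 q01.
rewrite /qR_function /qtransform mulrA; congr (_ * expR (- _)).
have uB s : derive1 (diagram_charge v) s != 0 -> expR (L * s) <= expR (L * beta).
  by move=> /vb sb; rewrite ler_expR ler_pM2l.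
have /andP[r0 r1] : 0 < q `^ (x - beta) < 1 by apply: powR_lt1 => //; rewrite subr_gt0.
have rE : q `^ x * expR (L * beta) <= q `^ (x - beta) by rewrite powR_sub.
have ik := integrable_kermom iv uB (powR_ge0 q x) rE r1.
rewrite (_ : \int[mu]_s _ = 2 * \int[mu]_s ((1 - q `^ x * expR (L * s))^-1 * derive1 (diagram_charge v) s)).
  by rewrite mulrCA !mulrA divff// mul1r.
rewrite -RintegralZl//; apply: eq_Rintegral => s _.
by rewrite derive1_height powR_sub// [X in _ = 2 * X]mulrC mulrA.
Qed.

(** For an R-function [(1 - q) h] the shift of [x] is [L h], and [q] to the power [- L h] is
    [e^(L^2 h)]. *)
Lemma Omega_eqnE (x h : R) :
  ((1 - q) * h * (1 - q `^ (x - L / (1 - q) * ((1 - q) * h))) = 1 - q) <->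
  h * (1 - q `^ x * expR (L ^+ 2 * h)) = 1.
Proof.
have q1 : 1 - q != 0 by case/andP: q01 => _ h1; rewrite gt_eqF// subr_gt0.
rewrite (_ : L / (1 - q) * ((1 - q) * h) = L * h); last by rewrite mulrA divfK.
rewrite powR_sub// mulrA -expr2 -mulrA; split => [|->]; last by rewrite mulr1.
by rewrite -[RHS]mulr1 => /(mulfI q1).
Qed.

Lemma Omega_spec_small v : Omega_spec q v -> exists2 zs, 0 < zs & forall z, 0 < z < zs ->
  qtransform L v z * (1 - z * expR (L ^+ 2 * qtransform L v z)) = 1.
Proof.
move=> [vd spec]; have [vl _] := vd; have [N [s0 [N0 t1 t2]]] := diagram_tail vd.
have out := diagram_dcharge_out t1 t2.
have iv := integrable_diagram_dcharge vl out.
have q0 : 0 < q by case/andP: q01.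
exists (q `^ N); first by rewrite powR_gt0.
move=> z /andP[z0 zN]; pose x := - (ln z / L).
have zE : q `^ x = z by exact: powR_surj.
have Nx : N < x by move: zN; rewrite -zE !powR_ln// ltr_expR ltrN2 ltr_pM2l// lnV_gt0.
have vN s : derive1 (diagram_charge v) s != 0 -> s <= N by exact: support_le.
have sx s : fsupp (derive1 (diagram_charge v)) s -> s < x.
  move=> cl; rewrite (le_lt_trans _ Nx)// leNgt; apply/negP => Ns.
  have /near_in_itvoy n : s \in `]N, +oo[ by rewrite in_itv/= Ns.
  have [a [/= ha]] := cl _ n; rewrite in_itv/= andbT => Na.
  by have := vN a ha; rewrite leNgt Na.
have := spec x sx; rewrite (qR_functionE Nx iv vN) zE => h.
by have := (Omega_eqnE x (qtransform L v z)).1 h; rewrite zE.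
Qed.

(** The a priori bound that places the transform in the range where the root for small [z] is
    unique. *)
Lemma qtransform_le v (N : R) : 0 < N -> (forall x y, `|v x - v y| <= `|x - y|) ->
  (forall s, N < `|s| -> derive1 (diagram_charge v) s = 0) ->
  exists H zs, [/\ 0 < H, 0 < zs & forall z, 0 < z < zs -> 0 < qtransform L v z <= H].
Proof.
move=> N0 vl out; have L0 := lnV_gt0 q01.
have iv := integrable_diagram_dcharge vl out.
have B0 := expR_gt0 (L * N).
have B1 : 1 < expR (L * N) by rewrite expR_gt1 mulr_gt0.
pose I := \int[mu]_s `|derive1 (diagram_charge v) s|.
exists (2 * expR (L * (2 * I))), (2^-1 / expR (L * N)); split.
- by rewrite mulr_gt0 ?expR_gt0.
- by rewrite divr_gt0// invr_gt0.
move=> z /andP[z0]; rewrite ltr_pdivlMr// => /ltW zB.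
have z2 : z <= 2^-1 by rewrite (le_trans _ zB)// ler_peMr ?(ltW z0)// ltW.
have z1 : 2^-1 <= 1 - z by lra.
have z1' : 0 < 1 - z by apply: lt_le_trans z1; rewrite invr_gt0.
apply/andP; split; first by rewrite mulr_gt0 ?expR_gt0// invr_gt0.
apply: ler_pM; rewrite ?expR_ge0// ?invr_ge0 ?(ltW z1')//.
  by rewrite invf_ple ?posrE.
rewrite ler_expR -mulrN ler_wpM2l ?(ltW L0)//.
have half : 2^-1 < 1 :> R by rewrite invf_lt1// ltr1n.
have := moment_remainder iv (fun s => support_expR_le L0 out) 0 (ltW z0) zB half.
rewrite big_ord0 subr0 expr0 mulr1 (_ : (1 - 2^-1)^-1 = 2); last by field.
by rewrite ler_norml lerNl => /andP[].
Qed.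

(* The equation [h = 1 + z h exp (a h)] is a contraction in [h] for small [z]. *)
Lemma small_root_unique (a H : R) : 0 <= a -> 0 < H -> exists2 zs, 0 < zs &
  forall z h1 h2, 0 < z < zs -> 0 < h1 <= H -> 0 < h2 <= H ->
  h1 * (1 - z * expR (a * h1)) = 1 -> h2 * (1 - z * expR (a * h2)) = 1 -> h1 = h2.
Proof.
move=> a0 H0; pose E := expR (a * H); have E0 : 0 < E by exact: expR_gt0.
pose K := E + H * (a * E).
have K0 : 0 < K by rewrite ltr_pwDl// mulr_ge0 ?(ltW H0)// mulr_ge0// ltW.
exists K^-1 => [|z h1 h2 /andP[z0 zK] /andP[h10 h1H] /andP[h20 h2H] e1 e2].
  by rewrite invr_gt0.
have d : `|expR (a * h1) - expR (a * h2)| <= a * E * `|h1 - h2|.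
  by apply: expR_lip => //; rewrite ger0_norm// ltW.
have key : h1 - h2 = z * ((h1 - h2) * expR (a * h1) + h2 * (expR (a * h1) - expR (a * h2))).
  by lra.
apply/eqP; rewrite -subr_eq0 -normr_eq0; apply/eqP.
have b1 : `|(h1 - h2) * expR (a * h1) + h2 * (expR (a * h1) - expR (a * h2))| <= K * `|h1 - h2|.
  apply: (le_trans (ler_normD _ _)); rewrite !normrM /K mulrDl lerD//.
    rewrite mulrC ler_wpM2r// ger0_norm ?expR_ge0// ler_expR ler_wpM2l//.
  rewrite (ger0_norm (ltW h20)) -mulrA; apply: ler_pM => //; exact: ltW.
have b2 : `|h1 - h2| <= z * K * `|h1 - h2|.
  rewrite {1}key normrM (ger0_norm (ltW z0)) -mulrA ler_wpM2l// ltW//.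
have zK1 : z * K < 1 by rewrite -ltr_pdivlMr// mul1r.
by apply/eqP; rewrite eq_le normr_ge0 andbT; have := normr_ge0 (h1 - h2); nra.
Qed.

(** [poly_pos_interval] applied to both [g] and [- g], whose polynomial integrals all vanish. *)
Lemma moments0_interval (g : R -> R) (N : R) :
  mu.-integrable setT (EFin \o g) -> (forall s, N < `|s| -> g s = 0) ->
  (forall j, \int[mu]_s (expR (L * s) ^+ j * g s) = 0) ->
  forall c d, c <= d -> \int[mu]_(s in `[c, d]) g s = 0.
Proof.
move=> ig g0 m0 c d cd; have L0 := lnV_gt0 q01.
have pos (k : R) : 0 <= k * \int[mu]_(s in `[c, d]) g s.
  have ik : mu.-integrable setT (EFin \o (fun s => k * g s)).
    exact: (integrableZl measurableT _ ig).
  have k0 s : N < `|s| -> k * g s = 0 by move=> /g0 ->; rewrite mulr0.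
  rewrite -RintegralZl//; last exact: integrableS ig.
  apply: (poly_pos_interval L0 ik k0 _ cd) => P _.
  rewrite (moment_poly ik (fun s => support_expR_le L0 k0)) big1// => j _.
  rewrite (_ : \int[mu]_s _ = k * \int[mu]_s (expR (L * s) ^+ j * g s)).
    by rewrite m0 !mulr0.
  rewrite -RintegralZl//; last exact: (integrable_mom ig (fun s => support_expR_le L0 g0)).
  by apply: eq_Rintegral => s _; rewrite mulrCA.
by apply/eqP; rewrite eq_le; have := pos 1; have := pos (- 1); rewrite mulN1r mul1r oppr_ge0 => -> ->.
Qed.

(** For small [z] both transforms are bounded roots of the same equation, hence equal. Comparing
    expansions equates the moments of the two charge differentials, and these determine the
    diagrams. *)
Lemma Omega_spec_unique v y : Omega_spec q v -> Omega_spec q y -> v = y.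
Proof.
move=> vs ys; have [zv zv0 ev] := Omega_spec_small vs; have [zy zy0 ey] := Omega_spec_small ys.
have [vd _] := vs; have [yd _] := ys; have [vl _] := vd; have [yl _] := yd.
have L0 := lnV_gt0 q01.
have [N1 [s1 [N10 t1 t2]]] := diagram_tail vd.
have [N2 [s2 [N20 t3 t4]]] := diagram_tail yd.
have out1 := diagram_dcharge_out t1 t2; have out2 := diagram_dcharge_out t3 t4.
have iv := integrable_diagram_dcharge vl out1.
have iy := integrable_diagram_dcharge yl out2.
have [H1 [z1 [H10 z10 b1]]] := qtransform_le N10 vl out1.
have [H2 [z2 [H20 z20 b2]]] := qtransform_le N20 yl out2.
have a0 : 0 <= L ^+ 2 by exact: sqr_ge0.
have H0 : 0 < Num.max H1 H2 by rewrite lt_max H10.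
have [z3 z30 uniq] := small_root_unique a0 H0.
pose N := Num.max N1 N2.
have N0 : 0 < N by rewrite lt_max N10.
pose zs := Num.min (2^-1 / expR (L * N)) (Num.min (Num.min zv zy) (Num.min z3 (Num.min z1 z2))).
have B0 := expR_gt0 (L * N).
have B1 : 1 < expR (L * N) by rewrite expR_gt1 mulr_gt0.
have zs0 : 0 < zs by rewrite !lt_min divr_gt0 ?invr_gt0// zv0 zy0 z30 z10.
pose g s := derive1 (diagram_charge v) s - derive1 (diagram_charge y) s.
have ig : mu.-integrable setT (EFin \o g) by exact: integrable_subr.
have g0 s : N < `|s| -> g s = 0.
  by rewrite gt_max => /andP[h1 h2]; rewrite /g out1// out2// subrr.
have half : 2^-1 < 1 :> R by rewrite invf_lt1// ltr1n.
have out1' s : N < `|s| -> derive1 (diagram_charge v) s = 0.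
  by rewrite gt_max => /andP[/out1].
have out2' s : N < `|s| -> derive1 (diagram_charge y) s = 0.
  by rewrite gt_max => /andP[_ /out2].
have zsB z : z < zs -> z * expR (L * N) <= 2^-1.
  by rewrite lt_min => /andP[/ltW]; rewrite ler_pdivlMr.
have kg z : 0 < z < zs -> \int[mu]_s ((1 - z * expR (L * s))^-1 * g s) = 0.
  move=> /andP[z0 zzs]; have zB := zsB _ zzs.
  move: zzs; rewrite !lt_min => /andP[_ /andP[/andP[zzv zzy] /andP[zz3 /andP[zz1 zz2]]]].
  have EI : \int[mu]_s ((1 - z * expR (L * s))^-1 * g s) =
      \int[mu]_s ((1 - z * expR (L * s))^-1 * derive1 (diagram_charge v) s) -
      \int[mu]_s ((1 - z * expR (L * s))^-1 * derive1 (diagram_charge y) s).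
    rewrite -RintegralB//; last 2 first.
    - exact: (integrable_kermom iv (fun s => support_expR_le L0 out1') (ltW z0) zB half).
    - exact: (integrable_kermom iy (fun s => support_expR_le L0 out2') (ltW z0) zB half).
    by apply: eq_Rintegral => s _; rewrite /g mulrBr.
  have /andP[p1 p2] : 0 < qtransform L v z <= H1 by apply: b1; rewrite z0.
  have /andP[p3 p4] : 0 < qtransform L y z <= H2 by apply: b2; rewrite z0.
  have E : qtransform L v z = qtransform L y z.
    apply: (uniq z (qtransform L v z) (qtransform L y z)).
    - by rewrite z0.
    - by rewrite p1 le_max p2.
    - by rewrite p3 le_max p4 orbT.
    - by apply: ev; rewrite z0.
    - by apply: ey; rewrite z0.
  have z1' : z < 1.
    have h : z <= z * expR (L * N) by apply: ler_peMr; exact: ltW.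
    exact: le_lt_trans (le_trans h zB) half.
  have {}E := qtransform_inj L0 z1' E.
  by rewrite EI E subrr.
have m0 : forall j, \int[mu]_s (expR (L * s) ^+ j * g s) = 0.
  apply: (@coef_eq0 R _ ((1 - 2^-1)^-1 * \int[mu]_s `|g s|) (expR (L * N)) zs) => //.
  - rewrite mulr_ge0 ?invr_ge0 ?subr_ge0 ?(ltW half)//; exact: Rintegral_ge0.
  - move=> k z zz; have /andP[z0 zzs] := zz.
    have := moment_remainder ig (fun s => support_expR_le L0 g0) k.+1 (ltW z0) (zsB _ zzs) half.
    by rewrite kg// sub0r normrN.
exact: diagram_ext vd yd (moments0_interval ig g0 m0).
Qed.

(** The support is closed and misses [x], hence misses a neighbourhood of [x]. This gap later gives
    q^(x - beta) < 1. *)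
Lemma fsupp_gap (f : R -> R) (x : R) : (forall s, fsupp f s -> s < x) ->
  exists2 beta, beta < x & forall s, f s != 0 -> s <= beta.
Proof.
move=> hx; have nx : ~ fsupp f x by move=> /hx; rewrite ltxx.
have [e e0 He] : exists2 e, 0 < e & forall s, `|x - s| < e -> f s = 0.
  apply: contrapT => H; apply: nx => A /nbhs_ballP[e /= e0 eA].
  apply: contrapT => nA; apply: H; exists e => // s xs.
  apply/eqP; apply: contrapT => /negP hs; apply: nA; exists s; split => //.
  exact: eA.
exists (x - e) => [|s hs]; first by rewrite gtrBl.
have sx : s < x by apply: hx; exact: subset_closure.
rewrite leNgt; apply/negP => xes; move: hs; rewrite He ?eqxx// ger0_norm; lra.
Qed.

(** If the charge were constant from a negative point on, it would be 0 there. The graph would meet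
    [|s|] at some [c < 0], and slopes of size at most 1 would keep it from exceeding [|s|] further
    left, so the area would be 0. Hence admissible [x] are positive and [(1 - z)^-1] expands up to
    [z = q^x]. *)
Lemma charge_support_gt0 v (b beta : R) : 0 < b -> (forall x y, `|v x - v y| <= `|x - y|) ->
  (forall s, b <= `|s| -> v s = `|s|) -> diagram_area v = 1%E ->
  (forall s, derive1 (diagram_charge v) s != 0 -> s <= beta) -> 0 <= beta.
Proof.
move=> b0 vl vo v1 vb; rewrite leNgt; apply/negP => beta0.
pose c := beta / 2; have cb : beta < c by rewrite /c; lra.
have c0 : c < 0 by rewrite /c; lra.
have r0 s : c <= s -> diagram_charge v s = 0.
  move=> cs; have [M [sM bM]] : exists M, s <= M /\ b <= M.
    by exists (Num.max s b); rewrite !le_max !lexx orbT.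
  have := lipschitz_FTC sM ler01 (charge_lip vl).
  rewrite (charge_out vo); last by rewrite ger0_norm// (le_trans (ltW b0)).
  rewrite (_ : \int[mu]_(u in `[s, M]) _ = 0); first by rewrite sub0r => /esym/eqP; rewrite oppr_eq0 => /eqP.
  rewrite /Rintegral (_ : (\int[mu]_(u in _) _ = 0)%E)//.
  apply: integral0_eq => u; rewrite /= in_itv/= => /andP[su _]; congr EFin.
  apply/eqP; apply: contrapT => /negP /vb ub.
  by have := lt_le_trans cb (le_trans cs su); rewrite ltNge ub.
have l0 s : diagram_charge v s = 0.
  have [cs|/ltW sc] := leP c s; first exact: r0.
  apply/eqP; rewrite eq_le (charge_ge0 b0 vl vo) andbT.
  have vc : v c = - c.
    have := r0 c (lexx c); rewrite /diagram_charge ltr0_norm// => h; lra.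
  have := vl s c; rewrite vc ler_norml => /andP[_]; rewrite ler0_norm ?subr_le0// => h.
  rewrite /diagram_charge ler0_norm ?(le_trans sc (ltW c0))//; lra.
have := charge_area1 b0 vl vo v1.
under eq_integral do rewrite l0.
by rewrite integral0 => /eqP; rewrite eq_sym onee_eq0.
Qed.

(* Both sides of [h = 1 + z h exp (L^2 h)] are power series in [z] with
   nonnegative coefficients, so the equation propagates from small [z] to the
   whole range of convergence. *)
Lemma Omega_spec_of_small v (b zs : R) : continual_diagram v -> diagram_area v = 1%E ->
  0 < b -> (forall s, b <= `|s| -> v s = `|s|) -> 0 < zs ->
  (forall z, 0 < z < zs ->
    qtransform L v z * (1 - z * expR (L ^+ 2 * qtransform L v z)) = 1) ->
  Omega_spec q v.
Proof.
move=> vd v1 b0 vo zs0 eqn; split => // x /fsupp_gap[beta bx vb].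
have [vl _] := vd; have L0 := lnV_gt0 q01.
have x0 : 0 < x by rewrite (le_lt_trans _ bx)//; exact: charge_support_gt0 b0 vl vo v1 vb.
have iv := integrable_dcharge vl vo.
rewrite (qR_functionE bx iv vb); apply/Omega_eqnE.
have /andP[r0 r1] := powR_lt1 q01 x0.
have bx0 : 0 < x - beta by rewrite subr_gt0.
have /andP[p0 p1] := powR_lt1 q01 bx0.
have uB s : derive1 (diagram_charge v) s != 0 -> expR (L * s) <= expR (L * beta).
  by move=> /vb sb; rewrite ler_expR ler_pM2l.
have rE : q `^ x * expR (L * beta) <= q `^ (x - beta) by rewrite powR_sub.
set r := q `^ x in r0 r1 rE *.
have ph : psum_like r (qtransform L v).
  exact: (psum_charge_transform b0 vl vo L0 r0 r1 (expR_ge0 _) uB rE p1).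
have [a pa] := ph.
have [c pc] : psum_like r (fun z => expR (L ^+ 2 * qtransform L v z)).
  by apply: psum_expR => //; eexists; exact: (psumZ (sqr_ge0 L) pa).
have p1' : psum r (fun k => (1 : {poly R})`_k) (fun=> 1).
  apply: psum_ext (psum_finite r _) => [z _|k]; first by rewrite hornerC.
  by rewrite coef1; case: eqP.
have pX : psum r (fun k => ('X : {poly R})`_k) id.
  apply: psum_ext (psum_finite r _) => [z _|k]; first by rewrite hornerX.
  by rewrite coefX; case: eqP.
have H := @psum_identity R r (qtransform L v)
  (fun z => 1 + z * (qtransform L v z * expR (L ^+ 2 * qtransform L v z))) zs r0 zs0 ph.
have {}H : qtransform L v r = 1 + r * (qtransform L v r * expR (L ^+ 2 * qtransform L v r)).
  apply: H; last by rewrite lexx ltW.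
    by eexists; exact: (psumD p1' (psumM pX (psumM pa pc))).
  by move=> z /eqn e; rewrite -[X in _ = X + _]e; ring.
by rewrite mulrBr mulr1 {1}H; ring.
Qed.

End omega.
End diagram_transform.

Theorem theorem6p4 (R : realType) (w : R -> R -> R)
  (w_diagram : forall q : R, 0 < q < 1 -> continual_diagram (w q))
  (w_area : forall q : R, 0 < q < 1 -> diagram_area (w q) = 1%E)
  (w_derivable : forall q t s : R, 0 < q < 1 -> 0 < t ->
     derivable (fun u : R => auto_charge w q u s) t 1)
  (w_equation : forall q t : R, 0 < q < 1 -> 0 < t ->
     exists a b : R,
       [/\ fsupp (ds_charge w q t) `<=` `[a, b],
           fsupp (dt_charge w q t) `<=` `[a, b] &
           forall x : R, x \notin `[a, b] ->
             (\int[lebesgue_measure]_s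
                ((1 - q `^ (x - s))^-1 * dt_charge w q t s)%:E)%E =
             ((1 - q `^ x)^-1 *
              expR (- (ln q^-1 *
                \int[lebesgue_measure]_s
                  ((1 - q `^ (x - s))^-1 * ds_charge w q t s))))%:E]) :
  forall q : R, 0 < q < 1 -> unique (Omega_spec q) (w q).
Proof.
move=> q q01.
have [b b0 wb] := diagram_area1_out (w_diagram q q01) (w_area q q01).
have [zs zs0 eqn] := auto_model_functional_eqn w_diagram w_area w_derivable w_equation q01.
have ws := Omega_spec_of_small q01 (w_diagram q q01) (w_area q q01) b0 wb zs0 eqn.
by split => // y ys; exact: (Omega_spec_unique q01 ws ys).
Qed.
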